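(* Let $N\geq2$, $N\leq p<\infty$ and $1\leq r<q<\infty$. Let $K,V:\mathbf{R}^N\to(0,\infty)$ be Lebesgue measurable functions such that $K\in L^\alpha_{loc}(\mathbf{R}^N)$ for some $\alpha\in(1,\infty]$; $\inf_{\mathbf{R}^N}V\geq V_0$ for some constant $V_0>0$; and $K^{\frac{s+\beta(s-q)}{s-r}}V^{-\beta}\in L^1(\mathbf{R}^N)$ for some $\beta\in\left[0,\frac{r}{q-r}\right]$ and some $s\in[q,\infty)$. Then the embedding $M^{q,p}_V(\mathbf{R}^N)\hookrightarrow L^r_K(\mathbf{R}^N)$ is compact.
   Context: For a positive weight $W$ and $1\le t<\infty$, $L^t_W(\mathbf{R}^N)=\{u\in L^1_{loc}(\mathbf{R}^N):\|u\|^t_{L^t_W}=\int_{\mathbf{R}^N}|u|^tW\,dx<\infty\}$. For $N\le p<\infty$ and $\inf V>0$, $M^{q,p}_V(\mathbf{R}^N)$ is the space of $u\in L^q(\mathbf{R}^N)$ with $\int|u|^qV\,dx<\infty$ and weak gradient $|\nabla u|\in L^p(\mathbf{R}^N)$, normed by $\|u\|_{M^{q,p}_V}=\|u\|_{L^q_V}+\|\nabla u\|_{L^p}$. *)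

(* Defs.v *)
From HB Require Import structures.
From mathcomp Require Import all_boot all_order all_algebra.
From mathcomp Require Import all_classical all_reals all_analysis.
Set Implicit Arguments.
Unset Strict Implicit.
Unset Printing Implicit Defensive.
Import Order.TTheory GRing.Theory Num.Theory.
Import numFieldNormedType.Exports.
Local Open Scope classical_set_scope.
Local Open Scope ring_scope.

Fact rV_display : measure_display. Proof. exact: default_measure_display. Qed.

Section borel_rV.
Context {R : realType} (n : nat).

Let coors : 'I_n -> 'rV[R]_n -> measurableTypeR R := fun i v => v ord0 i.

Let rV_set0 : g_sigma_preimage coors set0.
Proof. exact: sigma_algebra0. Qed.

Let rV_setC A : g_sigma_preimage coors A -> g_sigma_preimage coors (~` A).
Proof. exact: sigma_algebraC. Qed.

Let rV_bigcup (F : _^nat) : (forall i, g_sigma_preimage coors (F i)) ->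
  g_sigma_preimage coors (\bigcup_i (F i)).
Proof. exact: sigma_algebra_bigcup. Qed.

HB.instance Definition _ := @isMeasurable.Build rV_display
  'rV[R]_n (g_sigma_preimage coors) rV_set0 rV_setC rV_bigcup.
End borel_rV.

Section rV_measurability.
Context {R : realType}.

Lemma measurable_coord n (i : 'I_n) :
  measurable_fun [set: 'rV[R]_n] (fun v => v ord0 i : measurableTypeR R).
Proof.
move=> _ Y mY; rewrite setTI; apply: sub_sigma_algebra => /=.
rewrite -bigcup_seq/=; exists i => /=; first by rewrite mem_index_enum.
by exists Y => //; rewrite setTI.
Qed.

Lemma measurable_fun_coordP d (T : measurableType d) n (f : T -> 'rV[R]_n) :
  (forall i, measurable_fun [set: T] (fun x => f x ord0 i : measurableTypeR R)) ->
  measurable_fun [set: T] f.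
Proof.
move=> mf _ A mA; rewrite setTI.
have sA : sigma_algebra [set: T] measurable by exact: sigma_algebra_measurable.
suff: A \in [set B : set 'rV[R]_n | measurable (f @^-1` B)] by rewrite inE.
rewrite inE; move: A mA; apply: smallest_sub.
  split => /=.
  - by rewrite preimage_set0.
  - by move=> B mB; rewrite setTD preimage_setC; exact: measurableC.
  - by move=> F mF; rewrite preimage_bigcup; exact: bigcup_measurable.
move=> B /=; rewrite -bigcup_seq/= => -[i _ [Y mY <-]].
by rewrite setTI -[X in measurable X]setTI; exact: mf.
Qed.

Definition consrV n (z : measurableTypeR R * 'rV[R]_n) : 'rV[R]_n.+1 :=
  \row_i oapp (z.2 ord0) z.1 (unlift ord0 i).

Definition unconsrV n (v : 'rV[R]_n.+1) : measurableTypeR R * 'rV[R]_n :=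
  (v ord0 ord0, \row_i v ord0 (lift ord0 i)).

Lemma consrVK n : cancel (@consrV n) (@unconsrV n).
Proof.
move=> [x v]; rewrite /unconsrV /consrV/=; congr pair.
  by rewrite mxE unlift_none.
by apply/rowP => i; rewrite !mxE liftK.
Qed.

Lemma measurable_consrV n : measurable_fun [set: _ * _] (@consrV n).
Proof.
apply: measurable_fun_coordP => i; case: (unliftP ord0 i) => [j ->|->].
  rewrite (_ : (fun _ => _) = (fun v : 'rV[R]_n => v ord0 j) \o snd).
    by apply: measurableT_comp; [exact: measurable_coord|exact: measurable_snd].
  by apply/funext => z; rewrite mxE liftK.
rewrite (_ : (fun _ => _) = fst); first exact: measurable_fst.
by apply/funext => z; rewrite mxE unlift_none.
Qed.

Lemma measurable_unconsrV n : measurable_fun [set: 'rV[R]_n.+1] (@unconsrV n).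
Proof.
apply/measurable_fun_pairP; split; first exact: measurable_coord.
apply: measurable_fun_coordP => i.
rewrite (_ : (fun _ => _) = fun v : 'rV[R]_n.+1 => v ord0 (lift ord0 i)).
  exact: measurable_coord.
by apply/funext => v; rewrite /= mxE.
Qed.

End rV_measurability.

Section cons_measure.
Context {R : realType} (n : nat).
Variable mu : {sigma_finite_measure set 'rV[R]_n -> \bar R}.

Definition cons_measure : set 'rV[R]_n.+1 -> \bar R :=
  pushforward (lebesgue_measure \x mu)%E (@consrV R n).

Let cons_measure0 : cons_measure set0 = 0%E.
Proof. by rewrite /cons_measure /pushforward preimage_set0 measure0. Qed.

Let cons_measure_ge0 A : (0 <= cons_measure A)%E.
Proof. exact: (measure_ge0 (lebesgue_measure \x mu)%E). Qed.

Let cons_measure_sigma_additive : semi_sigma_additive cons_measure.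
Proof.
have mpre A : measurable A -> measurable (@consrV R n @^-1` A).
  by move=> mA; rewrite -[X in measurable X]setTI; exact: measurable_consrV.
move=> F mF tF mUF; rewrite /cons_measure /pushforward preimage_bigcup.
apply: (@measure_semi_sigma_additive _ _ _ (lebesgue_measure \x mu)%E).
- by move=> i; exact: mpre.
- apply/trivIsetP => /= i j _ _ ij; rewrite -preimage_setI.
  by move/trivIsetP : tF => /(_ _ _ _ _ ij) ->//; rewrite preimage_set0.
- by rewrite -preimage_bigcup; exact: mpre.
Qed.

HB.instance Definition _ := isMeasure.Build _ _ _ cons_measure
  cons_measure0 cons_measure_ge0 cons_measure_sigma_additive.

Let cons_measure_sigma_finite : sigma_finite [set: _] cons_measure.
Proof.
have /sigma_finiteP[F [TF ndF Foo]] := sigma_finiteT (@lebesgue_measure R).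
have /sigma_finiteP[G [TG ndG Goo]] := sigma_finiteT mu.
exists (fun k => @unconsrV R n @^-1` (F k `*` G k)).
  apply/esym; rewrite -subTset => v _.
  have [i _ Fi] : (\bigcup_i F i) (unconsrV v).1 by rewrite -TF.
  have [j _ Gj] : (\bigcup_i G i) (unconsrV v).2 by rewrite -TG.
  exists (maxn i j) => //; split.
    by move: Fi; exact/subsetPset/ndF/leq_maxl.
  by move: Gj; exact/subsetPset/ndG/leq_maxr.
move=> k; have [mF ?] := Foo k; have [mG ?] := Goo k.
split.
  rewrite -[X in measurable X]setTI.
  by apply: measurable_unconsrV => //; exact: measurableX.
rewrite /cons_measure /pushforward -comp_preimage.
rewrite (_ : _ \o _ = id) ?preimage_id; last exact/funext/consrVK.
by rewrite product_measure1E// lte_mul_pinfty// ge0_fin_numE.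
Qed.

HB.instance Definition _ := Measure_isSigmaFinite.Build _ _ _ cons_measure
  cons_measure_sigma_finite.
End cons_measure.

(* The n-fold product of the one-dimensional Lebesgue measure, on Borel sets. *)
Fixpoint borel_lebesgue {R : realType} (n : nat) :
    {sigma_finite_measure set 'rV[R]_n -> \bar R} :=
  match n with
  | 0 => \d_ (0 : 'rV[R]_0)
  | m.+1 => cons_measure (borel_lebesgue m)
  end.

Lemma borel_lebesgue_box {R : realType} (n : nat)
    (A : 'I_n -> set (measurableTypeR R)) : (forall i, measurable (A i)) ->
  borel_lebesgue n [set v | forall i, A i (v ord0 i)] =
  (\prod_(i < n) lebesgue_measure (A i))%E.
Proof.
elim: n A => [|n IHn] A mA.
  by rewrite big_ord0 /= diracE mem_set// => -[].
set B := [set v : 'rV[R]_n | forall i, A (lift ord0 i) (v ord0 i)].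
have mB : measurable B.
  rewrite (_ : B =
      \bigcap_(i in [set: 'I_n]) ((fun v => v ord0 i) @^-1` A (lift ord0 i))).
    apply: fin_bigcap_measurable => // i _.
    by rewrite -[X in measurable X]setTI; exact: measurable_coord.
  by apply/seteqP; split => v /=; [move=> + i _; exact | move=> + i; exact].
rewrite big_ord_recl -IHn//.
rewrite -[RHS](@product_measure1E _ _ _ _ _ lebesgue_measure)//.
rewrite /cons_measure /pushforward; congr (product_measure1 _ _ _).
apply/seteqP; split => -[x v] /= Av.
  split=> [|i]; first by have := Av ord0; rewrite mxE unlift_none.
  by have := Av (lift ord0 i); rewrite mxE liftK.
move=> i; rewrite mxE; case: (unliftP ord0 i) => [j ->|->] /=.
  exact: Av.2.
exact: Av.1.
Qed.

Definition lebesgue_rVType (R : realType) (n : nat) :=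
  caratheodory_type (mu_ext (@borel_lebesgue R n)).

(* The Caratheodory sets of the outer measure extending borel_lebesgue are
   exactly the Lebesgue measurable sets. *)
Definition lebesgue_rV {R : realType} (n : nat) :
    {measure set (lebesgue_rVType R n) -> \bar R} :=
  @completed_measure_extension _ _ _ (@borel_lebesgue R n).

Section function_spaces.
Context {R : realType} {N : nat}.
Local Notation Rn := 'rV[R]_N.
Local Notation mu := (@lebesgue_rV R N).
Implicit Types (u W : Rn -> R) (t : \bar R).

Definition lebesgue_measurable u :=
  measurable_fun [set: lebesgue_rVType R N] (u : lebesgue_rVType R N -> R).

(* As usual, elements of the function spaces below are represented by
   functions, two functions equal almost everywhere being indistinguishable
   for the norms. *)
Definition Lp_space t : set (Rn -> R) :=
  [set u | lebesgue_measurable u /\ ('N[mu]_t[EFin \o u] < +oo)%E].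

Definition Lp_loc t : set (Rn -> R) :=
  [set u | lebesgue_measurable u /\
    forall C : set Rn, compact C -> ('N[mu]_t[EFin \o (u \_ C)] < +oo)%E].

Definition weighted_int (t : R) W u : \bar R :=
  (\int[mu]_x (`|u x| `^ t * W x)%:E)%E.

Definition weighted_norm (t : R) W u : \bar R :=
  (weighted_int t W u `^ t^-1)%E.

Definition weighted_Lp (t : R) W : set (Rn -> R) :=
  [set u | Lp_loc 1%E u /\ (weighted_int t W u < +oo)%E].

Definition partial (i : 'I_N) (f : Rn -> R) : Rn -> R :=
  'D_(delta_mx ord0 i) f.

Definition smooth (f : Rn -> R) :=
  forall l : seq 'I_N, let g := foldr partial f l in
    continuous g /\ (forall i x, derivable g x (delta_mx ord0 i)).

Definition test_function (phi : Rn -> R) :=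
  smooth phi /\ compact (closure [set x | phi x != 0]).

Definition is_weak_gradient u (G : Rn -> Rn) :=
  (forall i, Lp_loc 1%E (fun x => G x ord0 i)) /\
  forall phi i, test_function phi ->
    (\int[mu]_x (u x * partial i phi x)%:E =
     - \int[mu]_x (G x ord0 i * phi x)%:E)%E.

(* The weak gradient is unique up to a null set, so the choice made here is
   immaterial. *)
Definition weak_gradient u : Rn -> Rn := xget (fun=> 0) (is_weak_gradient u).

(* `|v| on 'rV[R]_N is the sup norm. *)
Definition euclidean_norm (v : Rn) : R := Num.sqrt (\sum_i v ord0 i ^+ 2).

Definition Mspace (q p : R) (V : Rn -> R) : set (Rn -> R) :=
  [set u | [/\ Lp_space q%:E u, (weighted_int q V u < +oo)%E,
    exists G, is_weak_gradient u G &
    Lp_space p%:E (euclidean_norm \o weak_gradient u)]].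

Definition Mnorm (q p : R) (V : Rn -> R) u : \bar R :=
  (weighted_norm q V u +
   'N[mu]_(p%:E)[EFin \o (euclidean_norm \o weak_gradient u)])%E.

(* X is continuously included in Y, and every bounded sequence of X has a
   subsequence that converges in Y. *)
Definition compact_embedding (X : set (Rn -> R)) (normX : (Rn -> R) -> \bar R)
    (Y : set (Rn -> R)) (normY : (Rn -> R) -> \bar R) :=
  [/\ X `<=` Y,
      exists C : R, forall u, X u -> (normY u <= C%:E * normX u)%E &
      forall u_ : nat -> Rn -> R, (forall k, X (u_ k)) ->
        (exists C : R, forall k, (normX (u_ k) <= C%:E)%E) ->
        exists (f : nat -> nat) v, [/\ {homo f : i j / (i < j)%N}, Y v &
          normY (u_ (f k) \- v) @[k --> \oo] --> 0%E]].

End function_spaces.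

(* Main.v *)
(* Testing the weak gradient against products of bumps shows that almost
   everywhere u(x + h e_i) - u(x) is the integral of the i-th weak derivative
   over the segment, hence ||u(. + y) - u||_p <= C h ||grad u||_p for y in
   [0, h]^N. This estimate gives everything: comparing |u| > l with |u| <= l/2
   along small shifts improves L^q to L^s for every s >= q, and comparing u with
   its averages over small cubes, which are equicontinuous, yields by a diagonal
   argument an almost everywhere convergent subsequence of a bounded sequence.
   Finally K |w|^r <= t^(1-th) eta + t^(-th) (|w|^q V + |w|^s) for all t > 0, where
   sigma = (s + beta (s - q)) / (s - r), eta = K^sigma V^(-beta) and th = 1 / sigma: t = 1
   gives the continuous embedding, and for large t dominated convergence applied
   to min(K |u_k - u|^r, t^(1-th) eta) gives convergence in L^r_K. *)
Require Import Defs.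
From HB Require Import structures.
From mathcomp Require Import all_boot all_order all_algebra.
From mathcomp Require Import all_classical all_reals all_analysis.
From mathcomp Require Import measurable_realfun.
From mathcomp Require Import ring lra.
Set Implicit Arguments.
Unset Strict Implicit.
Unset Printing Implicit Defensive.
Import Order.TTheory GRing.Theory Num.Theory.
Import numFieldNormedType.Exports.
Local Open Scope classical_set_scope.
Local Open Scope ring_scope.

(** * Smooth bumps *)

(** Two measures are in play. The statement lives on the Caratheodory completion, where [K] and [V]
    are merely Lebesgue measurable, while the Fubini and translation arguments rest on the product
    structure of [borel_lebesgue]. So [u] and its weak partial derivatives are replaced by almost
    everywhere equal Borel functions; the shift estimates and the extraction of subsequences are
    carried out for [borel_lebesgue], and integrals containing [K] or [V] stay in the completion.
    [smooth] speaks of all iterated partials, which is why the test functions are products of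
    one-variable bumps: a partial derivative then touches a single factor. The gain from L^q to L^s
    is not homogeneous in its data. All bounds are therefore stated for u / m, with m > 0 an upper
    bound of the norm, and are scaled back at the end. The limit of the subsequence only has to lie
    in L^r_K, so no weak gradient is constructed for it: Fatou hands it the L^q_V and L^s bounds. *)

Section bump.
Context {R : realType}.
Implicit Types (p : {poly R}) (x : R).

Definition smooth_tower (d : nat -> R -> R) :=
  forall k x, is_derive x (1 : R) (d k) (d k.+1 x).

(* The derivative of [p(1/x) exp(-1/x)] is of the same shape. *)
Definition flat_exp p x : R :=
  if 0 < x then p.[x^-1] * expR (- x^-1) else 0.

Lemma flat_expD p p' x : flat_exp (p + p') x = flat_exp p x + flat_exp p' x.
Proof. by rewrite /flat_exp; case: ifP; rewrite ?addr0// hornerD mulrDl. Qed.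

(** By linearity it is enough to treat c X^n, where exp(1/x) >= x^-(n+1) / (n+1)! gives x^-n
    exp(-1/x) <= (n+1)! x. The linear bound makes the difference quotient at 0 continuous. *)
Lemma flat_exp_bound p : exists C, forall x, `|flat_exp p x| <= C * `|x|.
Proof.
suff H n (c : R) : exists C, forall x, `|flat_exp (c *: 'X^n) x| <= C * `|x|.
  rewrite -[p]coefK poly_def; elim/big_ind: _ => [|p1 p2 [C1 H1] [C2 H2]|i _].
  - by exists 0 => x; rewrite /flat_exp horner0 mul0r if_same normr0 mul0r.
  - exists (C1 + C2) => x; rewrite flat_expD (le_trans (ler_normD _ _))//.
    by rewrite mulrDl lerD.
  - exact: H.
exists (`|c| * n.+1`!%:R) => x; rewrite /flat_exp; case: ifPn => [x0|_]; last first.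
  by rewrite normr0 !mulr_ge0.
rewrite !hornerE normrM (gtr0_norm (expR_gt0 _)) normrM normrX.
rewrite (gtr0_norm (_ : 0 < x^-1)) ?invr_gt0// (gtr0_norm x0) -!mulrA ler_wpM2l//.
rewrite expRN ler_pdivrMr ?expR_gt0//.
have := expR_ge1Dxn n (ltW (_ : 0 < x^-1)); rewrite invr_gt0 => /(_ x0).
move=> h; have : x^-1 ^+ n.+1 / n.+1`!%:R <= expR x^-1 by apply: le_trans h; rewrite lerDr.
rewrite ler_pdivrMr ?ltr0n ?fact_gt0// exprS mulrC => H.
rewrite mulrAC -ler_pdivrMr//; apply: le_trans H _.
by rewrite mulrC.
Qed.

Lemma is_derive_flat_exp p x :
  is_derive x (1 : R) (flat_exp p) (flat_exp ('X^2 * (p - p^`())) x).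
Proof.
have [x0|x0|->{x}] := ltrgt0P x.
- pose f := fun y => p.[y^-1] * expR (- y^-1).
  apply: (@near_eq_is_derive _ _ _ f).
    near=> y; rewrite /f /flat_exp ifT//; near: y; exact: lt_nbhsr.
  have dV : is_derive x (1 : R) (fun y => y^-1) (- x ^- 2 *: 1).
    by apply: is_deriveV; rewrite gt_eqF.
  have dNV : is_derive x (1 : R) (fun y => - y^-1) (- (- x ^- 2 *: 1)).
    exact: is_deriveN.
  have d1 := @is_derive1_comp R (horner p) _ x _ _ (is_derive_poly p x^-1) dV.
  have d2 := @is_derive1_comp R (@expR R) _ x _ _ (is_derive_expR (- x^-1)) dNV.
  apply: (is_derive_eq (is_deriveM d1 d2)).
  rewrite /flat_exp x0 /= !hornerE /GRing.scale/=.
  by rewrite exprVn; ring.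
- apply: (@near_eq_is_derive _ _ _ (cst 0)).
    near=> y; rewrite /flat_exp ifF//; apply/negbTE; rewrite -leNgt.
    by apply/ltW; near: y; exact: lt_nbhsl.
  by rewrite /flat_exp ltNge (ltW x0)/=; exact: is_derive_cst.
(* At 0 the quotient of [flat_exp p z] by z is [flat_exp ('X * p) z], as 1/z is the value of ['X] at
   1/z; it tends to 0 by [flat_exp_bound]. *)
- apply/is_derive1_caratheodory; exists (flat_exp ('X * p)); split.
  + move=> z; rewrite /flat_exp ltxx subr0; case: ifPn => z0; last by rewrite mul0r.
    by rewrite !hornerE; field; rewrite gt_eqF.
  + have [C HC] := flat_exp_bound ('X * p).
    have f0 : flat_exp ('X * p) 0 = 0 by rewrite /flat_exp ltxx.
    suff : flat_exp ('X * p) y @[y --> (0:R)] --> (0:R) by rewrite /prop_for /continuous_at f0.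
    apply/norm_cvg0P.
    apply: (@squeeze_cvgr _ _ _ _ (cst 0) (fun x => C * `|x|)).
    * by apply: nearW => y; rewrite normr_ge0 HC.
    * exact: cvg_cst.
    * rewrite -[X in _ --> X](mulr0 C); apply: cvgMr.
      by rewrite -[X in _ --> X](@normr0 R R); apply: cvg_norm; exact: cvg_id.
  + by rewrite /flat_exp ltxx.
Unshelve. all: by end_near. Qed.

Lemma flat_exp_smooth p : exists d, smooth_tower d /\ d 0%N = flat_exp p.
Proof.
exists (fun k => flat_exp (iter k (fun p => 'X^2 * (p - p^`())) p)); split => //.
by move=> k x; exact: is_derive_flat_exp.
Qed.

End bump.

(** * One-variable smooth functions, given with all their derivatives *)

Section towers.
Context {R : realType}.
Implicit Types (d e : nat -> R -> R) (g : R -> R).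

Definition smooth1 g := exists2 d, smooth_tower d & d 0%N = g.

Lemma smooth_tower_continuous d k : smooth_tower d -> continuous (d k).
Proof.
move=> td x; apply/differentiable_continuous/derivable1_diffP.
by have [] := td k x.
Qed.

Lemma smooth1_continuous g : smooth1 g -> continuous g.
Proof. by case=> d td <-; exact: smooth_tower_continuous. Qed.

Lemma smooth1_affine g (c a : R) : smooth1 g -> smooth1 (fun x => g (c * x + a)).
Proof.
move=> [d td <-]; exists (fun k x => c ^+ k * d k (c * x + a)); last first.
  by apply/funext => x; rewrite mul1r.
move=> k x.
have dA : is_derive x (1 : R) (fun x => c * x + a) c.
  have -> : (fun x => c * x + a) = (c *: (id : R -> R)) + cst a by [].
  by apply: is_derive_eq; rewrite addr0 /GRing.scale/= mulr1.
have := @is_derive1_comp R (d k) _ x _ _ (td k (c * x + a)) dA.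
move=> /(@is_deriveZ _ _ _ _ (c ^+ k)) H.
by apply: (is_derive_eq H); rewrite /GRing.scale/= exprS; ring.
Qed.

Lemma smooth1M g1 g2 : smooth1 g1 -> smooth1 g2 -> smooth1 (fun x => g1 x * g2 x).
Proof.
move=> [d td <-] [e te <-].
(* Leibniz rule without binomial coefficients: the k-th derivative is a sum over a list of pairs of
   orders, with repetitions, and [step] differentiates either factor of each term. *)
pose step (s : seq (nat * nat)) :=
  [seq (p.1.+1, p.2) | p <- s] ++ [seq (p.1, p.2.+1) | p <- s].
exists (fun k x => \sum_(p <- iter k step [:: (0, 0)%N]) d p.1 x * e p.2 x).
  move=> k x; rewrite iterS; elim: (iter k step _) => [|p s IHs].
    rewrite /step /= big_nil.
    by under eq_fun do rewrite big_nil; exact: is_derive_cst.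
  under eq_fun do rewrite big_cons.
  have H := is_deriveM (td p.1 x) (te p.2 x).
  have {IHs}H := is_deriveD H IHs.
  apply: (is_derive_eq H); rewrite /step big_cat/= !big_cons/= !big_cat/=.
  by rewrite !big_map/= big_cons big_map /GRing.scale/=; ring.
by apply/funext => x; rewrite /= big_cons big_nil addr0.
Qed.

End towers.

(** * Products of one-variable functions as test functions *)

Section test_functions.
Context {R : realType} {N : nat}.
Implicit Types (d : 'I_N -> nat -> R -> R) (g : 'I_N -> R -> R) (i : 'I_N).
Local Notation Rn := 'rV[R]_N.

Definition prod_fun g (v : Rn) : R := \prod_i g i (v ord0 i).

Definition repl_fun g i (f : R -> R) j := if j == i then f else g j.

Lemma is_derive_prod_fun g i (v : Rn) (df : R) :
  is_derive (v ord0 i) (1 : R) (g i) df ->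
  is_derive v (delta_mx ord0 i) (prod_fun g)
    (df * \prod_(j < N | j != i) g j (v ord0 j)).
Proof.
move=> dg; set c := \prod_(j < N | j != i) _.
have E : (fun h : R => prod_fun g (h *: delta_mx ord0 i + v)) =
         (fun h => c * g i (h + v ord0 i)).
  apply/funext => h; rewrite /prod_fun (bigD1 i)//= mulrC; congr (_ * _).
    by apply: eq_bigr => j ji; rewrite !mxE eqxx (negbTE ji) mulr0 add0r.
  by rewrite !mxE !eqxx mulr1.
have H : is_derive (0 : R) 1 (fun h : R => prod_fun g (h *: delta_mx ord0 i + v)) (c * df).
  rewrite E.
  have dS : is_derive (0 : R) 1 (fun h : R => h + v ord0 i) 1 by exact: is_derive_shift.
  have dg' : is_derive (0 + v ord0 i) 1 (g i) df by rewrite add0r.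
  have := @is_derive1_comp R (g i) _ 0 _ _ dg' dS.
  move=> /(@is_deriveZ _ _ _ _ c) HH.
  by apply: (is_derive_eq HH); rewrite mulr1.
case: H => [H1 H2]; apply: DeriveDef; first exact/derivable1P.
rewrite mulrC -H2 /derive; set q1 := fun h => h^-1 *: _; set q2 := fun h => h^-1 *: _.
suff -> : q1 = q2 by [].
by apply/funext => h; rewrite /q1 /q2 /=; rewrite addr0 scale0r add0r [_%:A]mulr1.
Qed.

Lemma continuous_prod_fun g : (forall i, continuous (g i)) -> continuous (prod_fun g).
Proof.
move=> cg; apply: (@continuous_big R 'I_N *%R 1 xpredT (@mul_continuous R) Rn _
  (fun i (v : Rn) => g i (v ord0 i))) => i _ v.
apply: (@continuous_comp _ _ _ (fun v : Rn => v ord0 i) (g i)).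
  exact: coord_continuous.
exact: cg.
Qed.

Lemma partial_prod_fun g i f : (forall x, is_derive x (1 : R) (g i) (f x)) ->
  partial i (prod_fun g) = prod_fun (repl_fun g i f).
Proof.
move=> df; apply/funext => v; rewrite /partial.
have [_ ->] := is_derive_prod_fun (df (v ord0 i)).
rewrite /prod_fun [in RHS](bigD1 i)//= /repl_fun eqxx; congr (_ * _).
by apply: eq_bigr => j /negbTE ->.
Qed.

(** Induction on the list of partials: an iterated partial of the product is again a product of
    level 0 functions of towers, and one more partial in direction i moves the i-th tower up by one
    level. *)
Lemma smooth_prod_fun g : (forall i, smooth1 (g i)) -> smooth (prod_fun g).
Proof.
move=> sg l /=.
suff [d td ->] : exists2 d : 'I_N -> nat -> R -> R, (forall i, smooth_tower (d i)) &
    foldr partial (prod_fun g) l = prod_fun (d ^~ 0%N).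
  split=> [|i v].
    by apply: continuous_prod_fun => i; exact: smooth_tower_continuous.
  by have [] := @is_derive_prod_fun (d ^~ 0%N) i v _ (td i 0%N (v ord0 i)).
elim: l => [|i l [d td IH]] /=.
  have /choice[d hd] i : exists d : nat -> R -> R, smooth_tower d /\ d 0%N = g i.
    by have [d] := sg i; exists d.
  exists d => [i|]; first by have [] := hd i.
  by congr prod_fun; apply/funext => i; have [] := hd i.
exists (fun j => if j == i then (fun k => d i k.+1) else d j) => [j|].
  by case: ifP => _ //; move=> k x; exact: td.
rewrite IH (@partial_prod_fun (d ^~ 0%N) i (d i 1%N) (td i 0%N)).
by congr prod_fun; apply/funext => j; rewrite /repl_fun; case: ifP.
Qed.

Lemma compact_box (a b : 'I_N -> R) :
  compact [set v : Rn | forall i, v ord0 i \in `[a i, b i]].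
Proof.
by apply: (@rV_compact _ _ (fun i => [set` `[a i, b i]])) => i; exact: segment_compact.
Qed.

Lemma test_function_prod_fun g (a b : 'I_N -> R) : (forall i, smooth1 (g i)) ->
  (forall i x, g i x != 0 -> x \in `[a i, b i]) -> test_function (prod_fun g).
Proof.
move=> sg gab; split; first exact: smooth_prod_fun.
have cB := @compact_box a b.
apply: (subclosed_compact _ cB); first exact: closed_closure.
rewrite [X in _ `<=` X](iffLR (closure_id _)); last first.
  by apply: compact_closed => //; exact: norm_hausdorff.
apply: closureS => v /= gv i; apply: gab; apply: contra_neq gv => gv.
by rewrite /prod_fun (bigD1 i)//= gv mul0r.
Qed.

End test_functions.

(** * Bumps on an interval and their sliding integrals *)

Section itv_bump.
Context {R : realType}.
Implicit Types (a b x y h : R) (f g : R -> R).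
Local Notation leb := (@lebesgue_measure R).

Lemma flat_exp1_ge0 x : 0 <= flat_exp 1 x.
Proof. by rewrite /flat_exp hornerE mul1r; case: ifP => // _; exact: expR_ge0. Qed.

Lemma flat_exp1_le1 x : flat_exp 1 x <= 1.
Proof.
rewrite /flat_exp hornerE mul1r; case: ifPn => // x0.
by rewrite -expR0 ler_expR oppr_le0 invr_ge0 ltW.
Qed.

Lemma flat_exp1_cvg x : 0 < x -> flat_exp 1 (n.+1%:R * x) @[n --> \oo] --> (1 : R).
Proof.
move=> x0.
have E n : flat_exp 1 (n.+1%:R * x) = expR (- x^-1 * n.+1%:R^-1).
  rewrite /flat_exp hornerE mul1r pmulr_rgt0// x0; congr expR.
  by rewrite invfM mulNr mulrC.
have cv : - x^-1 * n.+1%:R^-1 @[n --> \oo] --> (0 : R).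
  by rewrite -(mulr0 (- x^-1)); apply: cvgMr; exact: cvg_harmonic.
have := @continuous_cvg _ _ _ _ _ _ (@expR R) _ (@continuous_expR R 0) cv; rewrite expR0.
rewrite (_ : (fun n => flat_exp 1 (n.+1%:R * x)) = expR \o (fun n : nat => - x^-1 / n.+1%:R)).
  by apply.
by apply/funext => n; rewrite E.
Qed.

(** The support stays in [a, b] while the factor n + 1 steepens both ends, so the bumps tend to the
    indicator of ]a, b[ and stay below it. *)
Definition itv_bump n a b x := flat_exp 1 (n.+1%:R * (x - a)) * flat_exp 1 (n.+1%:R * (b - x)).

Lemma itv_bump_smooth n a b : smooth1 (itv_bump n a b).
Proof.
have s1 : smooth1 (flat_exp (1 : {poly R})).
  by have [d [td d0]] := flat_exp_smooth (1 : {poly R}); exists d.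
apply: smooth1M.
  have := smooth1_affine n.+1%:R (- n.+1%:R * a) s1.
  by congr smooth1; apply/funext => x; congr flat_exp; ring.
have := smooth1_affine (- n.+1%:R) (n.+1%:R * b) s1.
by congr smooth1; apply/funext => x; congr flat_exp; ring.
Qed.

Lemma itv_bump_ge0 n a b x : 0 <= itv_bump n a b x.
Proof. by rewrite mulr_ge0 ?flat_exp1_ge0. Qed.

Lemma itv_bump_supp n a b x : itv_bump n a b x != 0 -> a < x < b.
Proof.
rewrite mulf_eq0 negb_or => /andP[].
rewrite /flat_exp; case: ifP => [+ _|]; last by rewrite eqxx.
case: ifP => [+ + _|]; last by rewrite eqxx.
by rewrite !pmulr_rgt0// !subr_gt0 => -> ->.
Qed.

Lemma itv_bump_le1 n a b x : itv_bump n a b x <= 1.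
Proof. by rewrite mulr_ile1 ?flat_exp1_ge0 ?flat_exp1_le1. Qed.

Lemma itv_bump_cvg (a b x : R) : itv_bump n a b x @[n --> \oo] --> ((a < x < b)%R%:R : R).
Proof.
have [/andP[ax xb]|xab] := boolP (a < x < b).
  rewrite -[X in _ --> X]mulr1.
  by apply: cvgM; apply: flat_exp1_cvg; rewrite subr_gt0.
rewrite (_ : (fun n => itv_bump n a b x) = cst 0); first exact: cvg_cst.
apply/funext => n; apply/eqP; apply: contraNT xab; exact: itv_bump_supp.
Qed.

Lemma integral_derive f g a b : (forall x, is_derive x (1 : R) f (g x)) ->
  continuous g -> a < b ->
  (\int[leb]_(x in `[a, b]) (g x)%:E = (f b - f a)%:E)%E.
Proof.
move=> df cg ab.
have cf : continuous f.
  move=> x; apply/differentiable_continuous/derivable1_diffP.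
  by have [] := df x.
rewrite (@continuous_FTC2 _ g f) ?EFinB//.
- exact/continuous_subspaceT.
- split.
  + by move=> x _; have [] := df x.
  + exact/cvg_at_right_filter/cf.
  + exact/cvg_at_left_filter/cf.
- by move=> x _; rewrite derive1E; have [] := df x.
Qed.

Lemma primitive g a b : continuous g -> (forall x, g x != 0 -> a < x < b) ->
  exists f, forall x, is_derive x (1 : R) f (g x).
Proof.
move=> cg gab; exists (fun y => \int[leb]_(t in `]-oo, y]) (g t))%R => y.
have mg : measurable_fun setT g by exact: continuous_measurable_fun.
have ig : leb.-integrable setT (EFin \o g).
  rewrite (_ : EFin \o g = (EFin \o g) \_ `[a, b]); last first.
    apply/funext => x; rewrite patchE; case: ifPn => // xab /=.
    congr EFin; apply/eqP; apply: contraNT xab => /gab/andP[ax xb].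
    by rewrite inE/= in_itv/= !ltW.
  rewrite -integrable_mkcond//.
  apply: continuous_compact_integrable; first exact: segment_compact.
  exact: continuous_subspaceT.
have yy1 : y < y + 1 by rewrite ltrDl.
have igy : leb.-integrable `]-oo, y + 1] (EFin \o g) by exact: integrableS ig.
have [|dF] := @continuous_FTC1 R g -oo%O y (y + 1) yy1 igy _ (cg y).
  exact: ltNyr.
by rewrite derive1E => <-; exact/derivableP.
Qed.

(** With P a primitive of the bump, take f(x) = P(x) - P(x - h), the integral of the bump over the
    shifts t in [0, h]. Its derivative is a difference of two bumps, which is what turns a tested
    weak derivative into a finite difference. *)
Lemma itv_bump_window n a b h : 0 < h ->
  exists f, [/\ smooth1 f, forall x, is_derive x (1 : R) f (itv_bump n a b x - itv_bump n a b (x - h)),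
    forall x, (\int[leb]_(t in `[0%R, h]) (itv_bump n a b (x - t))%:E = (f x)%:E)%E &
    forall x, f x != 0 -> x \in `[a, b + h]].
Proof.
move=> h0; set g := itv_bump n a b.
have sg : smooth1 g by exact: itv_bump_smooth.
have cg := smooth1_continuous sg.
have [P dP] := primitive cg (@itv_bump_supp n a b).
pose f x := P x - P (x - h).
have dS x t : is_derive x (1 : R) (fun x => x - t) 1 by exact: is_derive_shift.
have df x : is_derive x (1 : R) f (g x - g (x - h)).
  have d1 := @is_derive1_comp R P _ x _ _ (dP (x - h)) (dS x h).
  by apply: (is_derive_eq (is_deriveB (dP x) d1)); rewrite mulr1.
have fE x : (\int[leb]_(t in `[0%R, h]) (g (x - t))%:E = (f x)%:E)%E.
  have dR y : is_derive y (1 : R) (fun t => - P (x - t)) (g (x - y)).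
    have d0 : is_derive y (1 : R) (fun t => x - t) (-1).
      have -> : (fun t => x - t) = cst x - id by [].
      by apply: is_derive_eq; rewrite sub0r.
    have d1 := @is_derive1_comp R P _ y _ _ (dP (x - y)) d0.
    by apply: (is_derive_eq (is_deriveN d1)); rewrite mulrN1 opprK.
  rewrite (integral_derive dR)// ?subr0 ?opprK 1?addrC//.
  move=> y; apply: (@continuous_comp _ _ _ (fun t => x - t) g); last exact: cg.
  by apply: continuousB; [exact: cst_continuous|].
exists f; split => //.
- have [d td d0] := sg.
  exists (fun k => if k is j.+1 then (fun x => d j x - d j (x - h)) else f) => //.
  case=> [|k] x; first by rewrite d0; exact: df.
  have d1 := @is_derive1_comp R (d k) _ x _ _ (td k (x - h)) (dS x h).
  by apply: (is_derive_eq (is_deriveB (td k x) d1)); rewrite mulr1.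
- move=> x; apply: contraNT => xab; apply/eqP/EFin_inj; rewrite -fE.
  apply: integral0_eq => t; rewrite /= in_itv/= => /andP[t0 th].
  congr EFin; apply/eqP; apply: contraNT xab => /itv_bump_supp.
  by rewrite in_itv/= => /andP[? ?]; apply/andP; split; lra.
Qed.

End itv_bump.

(** * Borel and Lebesgue measure on row vectors *)

Section measure_preserving.
Local Open Scope ereal_scope.
Context d1 d2 (X : measurableType d1) (Y : measurableType d2) (R : realType).
Variables (m1 : {measure set X -> \bar R}) (m2 : {measure set Y -> \bar R}).
Variables (phi : X -> Y) (mphi : measurable_fun setT phi).
Hypothesis phiP : forall A, measurable A -> m1 (phi @^-1` A) = m2 A.

Lemma ge0_integral_preserving (f : Y -> \bar R) : measurable_fun setT f -> (forall y, 0 <= f y) ->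
  \int[m2]_y f y = \int[m1]_x f (phi x).
Proof.
move=> mf f0; rewrite -(ge0_integral_pushforward mphi m1 measurableT)//.
apply: (@eq_measure_integral _ _ _ setT
  (measure_function_pushforward__canonical__measure_function_Measure m1 mphi) m2 f).
by move=> A mA _ /=; rewrite -phiP.
Qed.

Lemma integral_preserving (f : Y -> \bar R) : measurable_fun setT f ->
  \int[m2]_y f y = \int[m1]_x f (phi x).
Proof.
move=> mf; rewrite -[RHS]/(\int[m1]_x (f \o phi) x).
rewrite integralE [RHS]integralE (funepos_comp f phi) (funeneg_comp f phi).
rewrite ge0_integral_preserving//; last exact: measurable_funepos.
by rewrite ge0_integral_preserving//; exact: measurable_funeneg.
Qed.

End measure_preserving.

Section density.
Local Open Scope ereal_scope.
Context d (T : measurableType d) (R : realType) (mu : {measure set T -> \bar R}).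
Variables (g : T -> \bar R) (mg : measurable_fun setT g) (g0 : forall x, 0 <= g x).

(** Turns nonnegative functions into measures, so that uniqueness of measures on boxes can compare
    them. *)
Definition density (A : set T) : \bar R := \int[mu]_(x in A) g x.

Let density0 : density set0 = 0. Proof. exact: integral_set0. Qed.

Let density_ge0 A : 0 <= density A. Proof. exact: integral_ge0. Qed.

Let density_sigma_additive : semi_sigma_additive density.
Proof.
move=> F mF tF mUF; rewrite /density ge0_integral_bigcup//; last first.
  exact: measurable_funTS.
apply: is_cvg_ereal_nneg_natsum_cond => n _ _; exact: integral_ge0.
Qed.

HB.instance Definition _ := isMeasure.Build _ _ _ density
  density0 density_ge0 density_sigma_additive.

Definition density_measure : {measure set T -> \bar R} := density.

End density.

(** * Open boxes, translation invariance, functions with zero integral over every box *)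

Section open_boxes.
Context {R : realType} {N : nat}.
Local Notation Rn := 'rV[R]_N.
Local Notation lam := (@borel_lebesgue R N).
Implicit Types (a b : 'I_N -> R) (x y : Rn).

Definition obox a b : set Rn := [set v | forall i, a i < v ord0 i < b i].

Lemma oboxI a b a' b' :
  obox a b `&` obox a' b' = obox (fun i => Num.max (a i) (a' i)) (fun i => Num.min (b i) (b' i)).
Proof.
apply/seteqP; split=> v /=.
  by move=> [h1 h2] i; rewrite gt_max lt_min; have /andP[-> ->] := h1 i; have /andP[-> ->] := h2 i.
by move=> h; split => i; have := h i; rewrite gt_max lt_min => /andP[/andP[? ?] /andP[? ?]]; apply/andP.
Qed.

Lemma obox_eq0 a b i : b i <= a i -> obox a b = set0.
Proof.
move=> ba; apply/seteqP; split => // v /(_ i)/andP[h1 h2].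
by have := lt_trans h1 h2; rewrite ltNge ba.
Qed.

Lemma measurable_obox a b : measurable (obox a b).
Proof.
rewrite (_ : obox a b =
    \bigcap_(i in [set: 'I_N]) ((fun v : Rn => v ord0 i) @^-1` `]a i, b i[%classic)).
  apply: fin_bigcap_measurable => // i _.
  by rewrite -[X in measurable X]setTI; apply: measurable_coord.
apply/seteqP; split => v /= h i; first by move=> _; rewrite /= in_itv/= h.
by have := h i Logic.I; rewrite /= in_itv.
Qed.

Definition cube (r : R) : set Rn := obox (fun=> - r) (fun=> r).

Lemma cube_cover : \bigcup_n cube n%:R = setT.
Proof.
apply/seteqP; split => // v _; exists (Num.truncn (\sum_i `|v ord0 i|)).+1 => // i.
rewrite -ltr_norml; apply: le_lt_trans (truncnS_gt _).
by rewrite (bigD1 i)//= lerDl sumr_ge0.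
Qed.

Lemma cube_homo r r' : r <= r' -> cube r `<=` cube r'.
Proof.
move=> rr v h i; have /andP[h1 h2] := h i.
by rewrite (lt_le_trans h2)// andbT (le_lt_trans _ h1)// lerN2.
Qed.

Lemma obox_sub_cube a b : exists n : nat, obox a b `<=` cube n%:R.
Proof.
exists (Num.truncn (\sum_i (`|a i| + `|b i|))).+1 => v h i; have /andP[h1 h2] := h i.
have : `|a i| + `|b i| < (Num.truncn (\sum_i (`|a i| + `|b i|))).+1%:R.
  by apply: le_lt_trans (truncnS_gt _); rewrite (bigD1 i)//= lerDl sumr_ge0.
have := ler_norm (b i); have := ler_norm (- a i); rewrite normrN.
by have := normr_ge0 (a i); have := normr_ge0 (b i) => *; apply/andP; split; lra.
Qed.

Lemma borel_lebesgue_oboxE a b :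
  lam (obox a b) = (\prod_i lebesgue_measure `]a i, b i[%classic)%E.
Proof.
by rewrite -borel_lebesgue_box//; congr (lam _).
Qed.

Lemma borel_lebesgue_obox a b : (forall i, a i <= b i) ->
  lam (obox a b) = (\prod_i (b i - a i))%:E.
Proof.
move=> ab; rewrite borel_lebesgue_oboxE -prodEFin.
apply: eq_bigr => i _; rewrite lebesgue_measure_itv/= lte_fin.
by case: ltgtP (ab i) => // -> _; rewrite subrr.
Qed.

Lemma borel_lebesgue_obox_lty a b : (lam (obox a b) < +oo)%E.
Proof.
rewrite borel_lebesgue_oboxE ltey_eq prode_fin_num// => i _.
by rewrite lebesgue_measure_itv/=; case: ifP.
Qed.

Definition oboxes : set (set Rn) := [set A | exists a b, A = obox a b].

Lemma measurable_oboxes : @measurable _ Rn = <<s oboxes >>.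
Proof.
apply/seteqP; split => A; last first.
  move: A; apply: smallest_sub; first exact: sigma_algebra_measurable.
  by move=> _ [a [b ->]]; exact: measurable_obox.
move: A; apply: smallest_sub; first exact: smallest_sigma_algebra.
move=> B /=; rewrite -bigcup_seq/= => -[i _ [Y mY <-]].
have mi : measurable_fun (setT : set (g_sigma_algebraType oboxes))
    (fun v : g_sigma_algebraType oboxes => (v : Rn) ord0 i : measurableTypeR R).
  apply: (measurability _ (RGenOInfty.measurableE R)) => _ [_ [z ->] <-].
  (* The half-space z < v_i is a countable union of cubes cut at z in direction i. *)
  rewrite setTI (_ : _ @^-1` _ = \bigcup_n obox
      (fun j => if j == i then z else - n%:R) (fun=> n%:R)); last first.
    apply/seteqP; split => [v /=|v [n _ h]/=]; last first.
      by have := h i; rewrite eqxx in_itv/= andbT => /andP[].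
    rewrite in_itv/= andbT => zv; have [n _ h] : (\bigcup_n cube n%:R) (v : Rn).
      by rewrite cube_cover.
    exists n => // j; case: eqP => [->|_]; last exact: h.
    by rewrite zv; have /andP[] := h i.
  apply: bigcupT_measurable => n; apply: sub_sigma_algebra.
  by eexists; eexists.
have := mi measurableT Y mY.
by rewrite setTI.
Qed.

Lemma oboxesI : setI_closed oboxes.
Proof. by move=> _ _ [a [b ->]] [a' [b' ->]]; rewrite oboxI; eexists; eexists. Qed.

Lemma obox_measure_unique (m1 m2 : {measure set Rn -> \bar R}) :
  (forall a b, m1 (obox a b) = m2 (obox a b)) ->
  (forall n : nat, (m1 (cube n%:R) < +oo)%E) ->
  forall A, measurable A -> m1 A = m2 A.
Proof.
move=> m12 fin; apply: (measure_unique oboxes (fun n => cube n%:R)) => //.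
- exact: measurable_oboxes.
- exact: oboxesI.
- by move=> n; eexists; eexists.
- exact: cube_cover.
- by move=> _ [a [b ->]].
Qed.

Lemma measurable_addrV : measurable_fun setT (fun z : Rn * Rn => z.1 + z.2).
Proof.
apply: measurable_fun_coordP => i.
rewrite (_ : (fun _ => _) = fun z : Rn * Rn => z.1 ord0 i + z.2 ord0 i).
  by apply: measurable_funD; apply: (measurableT_comp (measurable_coord i));
    [exact: measurable_fst|exact: measurable_snd].
by apply/funext => z; rewrite !mxE.
Qed.

Lemma measurable_translation y : measurable_fun setT (fun x : Rn => x + y).
Proof.
apply: measurable_fun_coordP => i.
rewrite (_ : (fun _ => _) = fun x : Rn => x ord0 i + y ord0 i).
  by apply: measurable_funD => //; exact: measurable_coord.
by apply/funext => z; rewrite !mxE.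
Qed.

Lemma borel_lebesgue_translation y A : measurable A ->
  lam ((fun x => x + y) @^-1` A) = lam A.
Proof.
have my := measurable_translation y.
pose m := measure_function_pushforward__canonical__measure_function_Measure lam my.
apply: (@obox_measure_unique m lam) => /=; rewrite /pushforward.
  move=> a b; rewrite (_ : _ @^-1` _ = obox (fun i => a i - y ord0 i) (fun i => b i - y ord0 i)).
    (* The product formula for the volume holds when a_i <= b_i throughout; otherwise both boxes are
       empty. *)
    have [ab|/existsNP[i /negP]] := pselect (forall i, a i <= b i).
      rewrite !borel_lebesgue_obox//; last by move=> i; rewrite lerD2r.
      by congr EFin; apply: eq_bigr => i _; ring.
    rewrite -ltNge => ba; rewrite !(@obox_eq0 _ _ i) ?measure0 ?lerD2r//; exact: ltW.
  by apply/seteqP; split => v /= h i; have := h i; rewrite mxE ltrBlDr ltrBrDr.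
move=> n; rewrite (_ : _ @^-1` _ = obox (fun i => - n%:R - y ord0 i) (fun i => n%:R - y ord0 i)).
  exact: borel_lebesgue_obox_lty.
by apply/seteqP; split => v /= h i; have := h i; rewrite mxE ltrBlDr ltrBrDr.
Qed.

Lemma ge0_integral_translation (f : Rn -> \bar R) y : measurable_fun setT f ->
  (forall x, 0 <= f x)%E -> (\int[lam]_x f (x + y)%R = \int[lam]_x f x)%E.
Proof.
move=> mf f0; rewrite [RHS](ge0_integral_preserving (measurable_translation y) (m1 := lam))//.
by move=> A mA; exact: borel_lebesgue_translation.
Qed.

Lemma integral_translation (f : Rn -> \bar R) y : measurable_fun setT f ->
  (\int[lam]_x f (x + y)%R = \int[lam]_x f x)%E.
Proof.
move=> mf; rewrite [RHS](integral_preserving (measurable_translation y) (m1 := lam))//.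
by move=> A mA; exact: borel_lebesgue_translation.
Qed.

(** Inside a cube the positive and negative parts of f define two finite measures that agree on
    boxes, hence on all Borel sets. On {f > 0} the second one vanishes, so the first does too.
    Cutting to a cube gives the finiteness. *)
Let obox_integral_le0 (f : Rn -> R) : measurable_fun setT f ->
  (forall n : nat, lam.-integrable (cube n%:R) (EFin \o f)) ->
  (forall a b, (\int[lam]_(x in obox a b) (f x)%:E = 0)%E) ->
  {ae lam, forall x, f x <= 0}.
Proof.
move=> mf intf f0.
suff H n : {ae lam, forall x, cube n%:R x -> f x <= 0}.
  have := ae_foralln H; apply: filterS => x Hx.
  have [n _ nx] : (\bigcup_n cube n%:R) x by rewrite cube_cover.
  exact: Hx nx.
have mQ : measurable (cube n%:R) by exact: measurable_obox.
have mF : measurable_fun setT (EFin \o f) by exact/measurable_EFinP.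
pose gp := (EFin \o f)^\+%E \_ (cube n%:R).
pose gm := (EFin \o f)^\-%E \_ (cube n%:R).
have mgp : measurable_fun setT gp.
  by apply/(measurable_restrictT _ _).1 => //; apply: measurable_funTS; exact: measurable_funepos.
have mgm : measurable_fun setT gm.
  by apply/(measurable_restrictT _ _).1 => //; apply: measurable_funTS; exact: measurable_funeneg.
have gp0 x : (0 <= gp x)%E by exact: erestrict_ge0.
have gm0 x : (0 <= gm x)%E by exact: erestrict_ge0.
pose mp := density_measure lam mgp gp0.
pose mm := density_measure lam mgm gm0.
have mpm A : measurable A -> mp A = mm A.
  have fin A' : measurable A' -> lam.-integrable (A' `&` cube n%:R) (EFin \o f).
    by move=> mA'; apply: integrableS (intf n) => //; exact: measurableI.
  apply: obox_measure_unique => [a b|m]; last first.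
    rewrite ltey_eq; apply/orP; left.
    have -> : mp (cube m%:R) = (\int[lam]_(x in cube m%:R `&` cube n%:R) (EFin \o f)^\+ x)%E.
      by rewrite integral_mkcondr.
    apply: integrable_pos_fin_num; last exact: fin (measurable_obox _ _).
    by apply: measurableI => //; exact: measurable_obox.
  have mab : measurable (obox a b `&` cube n%:R) by apply: measurableI => //; exact: measurable_obox.
  have -> : mp (obox a b) = (\int[lam]_(x in obox a b `&` cube n%:R) (EFin \o f)^\+ x)%E.
    by rewrite integral_mkcondr.
  have -> : mm (obox a b) = (\int[lam]_(x in obox a b `&` cube n%:R) (EFin \o f)^\- x)%E.
    by rewrite integral_mkcondr.
  have iab := fin _ (measurable_obox a b).
  rewrite -[LHS](subeK _ (integrable_neg_fin_num mab iab)).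
  have IE : (\int[lam]_(x in obox a b `&` cube n%:R) (EFin \o f) x =
    \int[lam]_(x in obox a b `&` cube n%:R) (EFin \o f)^\+ x -
    \int[lam]_(x in obox a b `&` cube n%:R) (EFin \o f)^\- x)%E by rewrite integralE.
  have I0 : (\int[lam]_(x in obox a b `&` cube n%:R) (EFin \o f) x = 0)%E.
    by rewrite oboxI; exact: f0.
  by rewrite -IE I0 add0e.
pose P : set Rn := [set x | 0 < f x].
have mP : measurable P.
  by rewrite -[X in measurable X]setTI; exact: measurable_fun_ltr.
have mgpP : measurable_fun P gp := measurable_funTS mgp.
have : (\int[lam]_(x in P) `|gp x| = 0)%E.
  under eq_integral do rewrite gee0_abs//.
  have -> : (\int[lam]_(x in P) gp x = mp P)%E by [].
  rewrite mpm//; apply: integral0_eq => x /= fx.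
  rewrite /gm patchE; case: ifP => // _.
  by rewrite funenegE/= -EFin_max; congr EFin; apply/max_idPr; rewrite oppr_le0 ltW.
move=> /(ae_eq_integral_abs _ mP mgpP).1; apply: filterS => x /= Hx nx.
rewrite leNgt; apply/negP => fx.
have := Hx fx; rewrite /gp patchE mem_set// funeposE/= -EFin_max => -[].
by rewrite max_l ?ltW// => fx0; rewrite fx0 ltxx in fx.
Qed.

Lemma obox_integral_eq0 (f : Rn -> R) : measurable_fun setT f ->
  (forall n : nat, lam.-integrable (cube n%:R) (EFin \o f)) ->
  (forall a b, (\int[lam]_(x in obox a b) (f x)%:E = 0)%E) ->
  {ae lam, forall x, f x = 0}.
Proof.
move=> mf intf f0; have h1 := obox_integral_le0 mf intf f0.
have h2 : {ae lam, forall x, - f x <= 0}.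
  apply: obox_integral_le0; first exact: measurableT_comp.
    move=> n; exact: integrableN (intf n).
  move=> a b; under eq_integral do rewrite EFinN.
  rewrite integralN ?f0 ?oppe0//.
  have [n abn] := obox_sub_cube a b.
  have iab : lam.-integrable (obox a b) (EFin \o f).
    by apply: (integrableS _ _ abn (intf n)); exact: measurable_obox.
  exact: (integrable_add_def (measurable_obox a b) iab).
apply: filterS2 h1 h2 => x; lra.
Qed.

End open_boxes.

(** * Borel hulls and Borel versions in the completion *)

Section completion.
Context {R : realType} {N : nat}.
Local Notation Rn := 'rV[R]_N.
Local Notation L := (lebesgue_rVType R N).
Local Notation lam := (@borel_lebesgue R N).
Local Notation mu := (@lebesgue_rV R N).

Lemma borel_lebesgue_measurable (A : set Rn) : measurable A -> measurable (A : set L).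
Proof. exact: caratheodory_measurable_mu_ext. Qed.

Lemma lebesgue_rVE (A : set Rn) : measurable A -> mu A = lam A.
Proof. exact: measurable_mu_extE. Qed.

Lemma measurable_completion : measurable_fun setT (id : L -> Rn).
Proof. by move=> _ A mA; rewrite setTI; exact: borel_lebesgue_measurable. Qed.

Lemma ge0_integral_completion (f : Rn -> \bar R) : measurable_fun setT f ->
  (forall x, 0 <= f x)%E -> (\int[lam]_x f x = \int[mu]_x f x)%E.
Proof.
move=> mf f0; apply: (ge0_integral_preserving measurable_completion) => // A mA.
exact: lebesgue_rVE.
Qed.

Lemma integral_completion (f : Rn -> \bar R) : measurable_fun setT f ->
  (\int[lam]_x f x = \int[mu]_x f x)%E.
Proof.
move=> mf; apply: (integral_preserving measurable_completion) => // A mA.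
exact: lebesgue_rVE.
Qed.

(** When the outer measure is finite, the hull is the intersection over k of countable Borel covers
    exceeding it by at most 1/(k+1); otherwise the whole space does. *)
Lemma measurable_hull (A : set L) : exists2 B : set Rn, measurable B &
  A `<=` B /\ lam B = mu A.
Proof.
have [Aoo|Afin] := eqVneq (mu A) +oo%E.
  exists setT => //; split=> //; apply/eqP; rewrite eq_le Aoo leey/= -Aoo.
  by rewrite -lebesgue_rVE//; exact: le_mu_ext.
have Afin' : mu A \is a fin_num by rewrite ge0_fin_numE ?ltey// mu_ext_ge0.
have /choice[F FP] (k : nat) : exists F : (set Rn)^nat,
    [/\ forall i, measurable (F i), A `<=` \bigcup_i F i &
      (lam (\bigcup_i F i) <= mu A + k.+1%:R^-1%:E)%E].
  have k0 : 0 < k.+1%:R^-1 :> R by rewrite invr_gt0.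
  have [x [F [mF AF] <-] xA] := lb_ereal_inf_adherent k0 Afin'.
  exists F; split => //; apply: le_trans (ltW xA).
  by apply: measure_sigma_subadditive => //; exact: bigcup_measurable.
have mF k : measurable (\bigcup_i F k i).
  by apply: bigcup_measurable => i _; have [] := FP k.
exists (\bigcap_k \bigcup_i F k i); first exact: bigcap_measurable.
have AF : A `<=` \bigcap_k \bigcup_i F k i.
  by move=> x Ax k _; have [_ + _] := FP k; exact.
split=> //; apply/eqP; rewrite eq_le; apply/andP; split; last first.
  by rewrite -lebesgue_rVE; [exact: le_mu_ext|exact: bigcap_measurable].
apply/lee_addgt0Pr => e e0.
have [k ke] : exists k : nat, k.+1%:R^-1 < e.
  exists (Num.truncn e^-1); rewrite invf_plt ?posrE//; exact: truncnS_gt.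
have [_ _ lamF] := FP k; apply: (@le_trans _ _ (lam (\bigcup_i F k i))).
  by apply: le_measure; rewrite ?inE//; [exact: bigcap_measurable|exact: bigcap_inf].
by apply: le_trans lamF _; rewrite leeD2l// lee_fin ltW.
Qed.

Lemma ae_completion (P : Rn -> Prop) : {ae lam, forall x, P x} -> {ae mu, forall x, P x}.
Proof.
move=> [Z [mZ Z0 PZ]]; exists Z; split => //; first exact: borel_lebesgue_measurable.
by rewrite lebesgue_rVE.
Qed.

Let null_bigcup (Z : (set Rn)^nat) : (forall n, measurable (Z n)) ->
  (forall n, lam (Z n) = 0%E) -> lam (\bigcup_n Z n) = 0%E.
Proof.
move=> mZ Z0; apply: measure_negligible; first exact: bigcup_measurable.
by apply: negligible_bigcup => n; exists (Z n); split => //; exact: Z0.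
Qed.

(** Work cube by cube, where measures are finite: a hull of A in the cube has the same measure as
    this piece of A, so the difference is null, and the hull of that difference is a Borel null
    set. *)
Lemma measurable_borel_approx (A : set L) : measurable A ->
  exists B Z : set Rn, [/\ measurable B, measurable Z, lam Z = 0%E, A `<=` B & B `\` A `<=` Z].
Proof.
move=> mA.
have mQ n : measurable (cube n%:R : set Rn) by exact: measurable_obox.
pose An n : set L := A `&` (cube n%:R : set Rn).
have mAn n : measurable (An n).
  by apply: measurableI => //; exact: borel_lebesgue_measurable.
have /choice[B BP] n : exists B : set Rn,
    [/\ measurable B, An n `<=` B & lam B = mu (An n)].
  by have [B mB [AB BA]] := measurable_hull (An n); exists B.
have /choice[Z ZP] n : exists Z : set Rn,
    [/\ measurable Z, B n `\` An n `<=` Z & lam Z = 0%E].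
  have [mB AB BA] := BP n.
  have [Z mZ [BZ Z0]] := measurable_hull (B n `\` An n).
  exists Z; split => //; rewrite Z0.
  have mB' := borel_lebesgue_measurable mB.
  have Bfin : (mu (B n) < +oo)%E.
    rewrite lebesgue_rVE// BA; apply: (@le_lt_trans _ _ (lam (cube n%:R))).
      by rewrite -(lebesgue_rVE (mQ n)); apply: le_mu_ext; exact: subIsetr.
    exact: borel_lebesgue_obox_lty.
  have E : mu (B n) = mu (An n) by rewrite lebesgue_rVE.
  rewrite measureD// setIidr//; transitivity (mu (B n) - mu (B n))%E.
    by congr (_ - _)%E; exact: esym E.
  by rewrite subee// ge0_fin_numE.
exists (\bigcup_n B n), (\bigcup_n Z n); split.
- by apply: bigcup_measurable => n _; have [] := BP n.
- by apply: bigcup_measurable => n _; have [] := ZP n.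
- by apply: null_bigcup => n; have [] := ZP n.
- move=> x Ax; have [n _ nx] : (\bigcup_n cube n%:R) (x : Rn) by rewrite cube_cover.
  by exists n => //; have [_ + _] := BP n; apply.
- move=> x [[n _ Bx] Ax]; exists n => //; have [_ + _] := ZP n; apply.
  by split => // -[].
Qed.

(** The superlevel sets at rational levels determine u. Each is a Borel set up to a Borel null set,
    and u is set to 0 on the union [Y] of these countably many null sets. *)
Lemma measurable_borel_version (u : L -> R) : measurable_fun setT u ->
  exists2 u' : Rn -> R, measurable_fun setT u' & {ae mu, forall x, u x = u' x}.
Proof.
move=> mu_.
have /choice[B /choice[Z BZ]] (c : rat) : exists B Z : set Rn,
   [/\ measurable B, measurable Z, lam Z = 0%E, [set x | ratr c < u x] `<=` B &
      B `\` [set x | ratr c < u x] `<=` Z].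
  apply: measurable_borel_approx; rewrite -[X in measurable X]setTI.
  exact: measurable_fun_ltr.
pose Y := \bigcup_c Z c.
have mY : measurable Y by apply: bigcupT_measurable_rat => c; have [] := BZ c.
have Y0 : lam Y = 0%E.
  pose Z' n := if unpickle n is Some c then Z c else set0.
  have -> : Y = \bigcup_n Z' n.
    apply/seteqP; split => x [].
      move=> c _ Zx; have E : Z' (pickle c) = Z c by rewrite /Z' pickleK.
      by exists (pickle c); [exact: Logic.I|rewrite E].
    by move=> n _; rewrite /Z'; case: unpickle => [c Zx|[]]; exists c.
  apply: null_bigcup => n; rewrite /Z'; case: unpickle => // c; by have [] := BZ c.
pose u' x := if x \in Y then 0 else u x.
exists u'; last first.
  exists Y; split; first exact: borel_lebesgue_measurable.
    by rewrite lebesgue_rVE.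
  by move=> x /= uu'; apply: contrapT => xY; apply: uu'; rewrite /u' memNset.
have mu'c (c : rat) : measurable [set x | ratr c < u' x].
  (* Off [Y] the hull [B c] is exactly the superlevel set; on [Y] the value 0 exceeds c exactly when
     c is negative. *)
  have -> : [set x | ratr c < u' x] = (B c `\` Y) `|` (if ratr c < 0 :> R then Y else set0).
    have [_ _ _ uB Bu] := BZ c.
    apply/seteqP; split => x /=; rewrite /u'.
      case: ifPn => [/set_mem xY ->|/negP xY cu]; first by right.
      by left; split; [exact: uB|move=> /mem_set].
    move=> [[Bx xY]|]; last by case: ifPn => // c0 xY; rewrite mem_set.
    by rewrite memNset//; apply: contrapT => cu; apply: xY; exists c => //; exact: Bu.
  apply: measurableU; last by case: ifP.
  by apply: measurableD => //; have [] := BZ c.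
apply: (measurability _ (RGenOInfty.measurableE R)) => _ [_ [z ->] <-].
rewrite setTI (_ : _ @^-1` _ = \bigcup_(c : rat) [set x | z < ratr c /\ ratr c < u' x]).
  apply: bigcupT_measurable_rat => c.
  have [zc|cz] := ltP z (ratr c).
    by rewrite (_ : [set _ | _] = [set x | ratr c < u' x])//; apply/seteqP; split => x //= [].
  rewrite (_ : [set _ | _] = set0)//; by apply/seteqP; split => x //= [].
apply/seteqP; split => x /=; rewrite in_itv/= andbT.
  by move=> /rat_in_itvoo[c]; rewrite in_itv/= => /andP[zc cu]; exists c.
by move=> [c _ [zc]]; exact: lt_trans.
Qed.

End completion.

Lemma measurable_fun_integral_prod d1 d2 (T1 : measurableType d1) (T2 : measurableType d2)
    (R : realType) (m2 : {sigma_finite_measure set T2 -> \bar R}) (f : T1 * T2 -> \bar R) :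
  measurable_fun setT f -> measurable_fun setT (fun x => \int[m2]_y f (x, y))%E.
Proof.
move=> mf; rewrite (_ : (fun x => _) = fun x =>
  (\int[m2]_y f^\+ (x, y) - \int[m2]_y f^\- (x, y))%E); last first.
  apply/funext => x; rewrite integralE -[fun y => f (x, y)]/(f \o pair x).
  by rewrite (funepos_comp _ (pair x)) (funeneg_comp _ (pair x)).
apply: emeasurable_funB.
  apply: (@measurable_fun_fubini_tonelli_F _ _ _ _ _ m2 f^\+%E).
    exact: measurable_funepos.
  by move=> z; exact: funepos_ge0.
apply: (@measurable_fun_fubini_tonelli_F _ _ _ _ _ m2 f^\-%E).
  exact: measurable_funeneg.
by move=> z; exact: funeneg_ge0.
Qed.

(** * Shifts of weakly differentiable functions *)

Section local_integrability.
Context {R : realType} {N : nat}.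
Local Notation Rn := 'rV[R]_N.
Local Notation lam := (@borel_lebesgue R N).
Local Notation leb := (@lebesgue_measure R).
Implicit Types (w : Rn -> R) (x y : Rn) (i : 'I_N) (n m : nat).

Definition loc_integrable w :=
  measurable_fun setT w /\ forall n, lam.-integrable (cube n%:R) (EFin \o w).

Lemma measurable_cube (r : R) : measurable (cube r : set Rn).
Proof. exact: measurable_obox. Qed.

Lemma loc_integrable_mul w (phi : Rn -> R) m M : loc_integrable w ->
  measurable_fun setT phi -> (forall x, `|phi x| <= M) ->
  (forall x, phi x != 0 -> cube m%:R x) ->
  lam.-integrable setT (EFin \o (w \* phi)).
Proof.
move=> [mw iw] mphi phiM phim.
have := integrableZl (measurable_cube m%:R) M (iw m).
move=> /(integrable_mkcond _ (measurable_cube m%:R)).1.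
apply: le_integrable => //.
  by apply/measurable_EFinP; exact: measurable_funM.
move=> x _; rewrite patchE; case: ifPn => [_|xm].
  rewrite /= lee_fin !normrM mulrC ler_wpM2r// (le_trans (phiM x))//.
  exact: ler_norm.
have phi0 : phi x = 0 by apply/eqP; apply: contraNT xm => /phim xm; exact: mem_set.
by rewrite /= phi0 mulr0 normr0.
Qed.

Lemma cube_shift (r : R) n : exists m, forall x y,
  (forall j, `|y ord0 j| <= r) -> cube n%:R x -> cube m%:R (x + y).
Proof.
exists (Num.truncn (n%:R + r)).+1 => x y yr xn j.
have := truncnS_gt (n%:R + r); have := yr j; have /andP[] := xn j.
by rewrite mxE ler_norml => ? ? /andP[? ?] ?; apply/andP; split; lra.
Qed.

Lemma integral_cube_shift w n m y : loc_integrable w ->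
  (forall x, cube n%:R x -> cube m%:R (x + y)) ->
  (\int[lam]_(x in cube n%:R) `|w (x + y)%R|%:E <=
   \int[lam]_(x in cube m%:R) `|w x|%:E)%E.
Proof.
move=> [mw _] nm; rewrite (integral_mkcond (cube n%:R)) (integral_mkcond (cube m%:R)).
have mabs : measurable_fun setT (fun x => `|w x|%:E).
  by apply/measurable_EFinP; exact: measurableT_comp.
have mF : measurable_fun setT ((fun x => `|w x|%:E) \_ (cube m%:R)).
  apply/(measurable_restrictT _ _).1; first exact: measurable_cube.
  exact: measurable_funTS.
rewrite -(ge0_integral_translation y mF); last by move=> x; rewrite erestrict_ge0.
apply: ge0_le_integral => //.
- by move=> x _; rewrite erestrict_ge0.
- apply/(measurable_restrictT _ _).1; first exact: measurable_cube.
  apply: measurable_funTS; apply: (measurableT_comp mabs).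
  exact: measurable_translation.
- apply: (measurableT_comp mF); exact: measurable_translation.
- move=> x _; rewrite !patchE; case: ifPn => [/set_mem xn|_]; last by case: ifP => // _; rewrite lee_fin.
  by rewrite mem_set//; exact: nm.
Qed.

Lemma loc_integrable_shift w y : loc_integrable w -> loc_integrable (fun x => w (x + y)).
Proof.
move=> lw; have [mw iw] := lw.
have mwy : measurable_fun setT (fun x => w (x + y)).
  apply: (measurableT_comp mw); exact: measurable_translation.
split => // n; apply/integrableP; split; first exact/measurable_EFinP/measurable_funTS.
have [m nm] := cube_shift (\sum_j `|y ord0 j|) n.
apply: le_lt_trans (integral_cube_shift lw _) _.
  by move=> x; apply: nm => j; rewrite (bigD1 j)//= lerDl sumr_ge0.
by have /integrableP[_] := iw m.
Qed.

Lemma measurable_addscale (v : Rn) :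
  measurable_fun setT (fun z : Rn * measurableTypeR R => z.1 + z.2 *: v).
Proof.
apply: measurable_fun_coordP => j.
rewrite (_ : (fun _ => _) = fun z : Rn * measurableTypeR R => z.1 ord0 j + z.2 * v ord0 j).
  apply: measurable_funD; first by apply: (measurableT_comp (measurable_coord j)); exact: measurable_fst.
  by apply: measurable_funM => //; exact: measurable_snd.
by apply/funext => z; rewrite !mxE.
Qed.

Definition segment_integral w i (h : R) x : \bar R :=
  (\int[leb]_(t in `[0%R, h]) (w (x + t *: delta_mx ord0 i)%R)%:E)%E.

(** The integrand of [segment_integral] extended by zero to all t, so that Tonelli applies on the
    full product space. *)
Definition segment_kernel w i (h : R) (z : Rn * measurableTypeR R) : R :=
  w (z.1 + z.2 *: delta_mx ord0 i) * \1_(`[0, h]%classic : set R) z.2.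

Lemma measurable_segment_kernel w i h : measurable_fun setT w ->
  measurable_fun setT (segment_kernel w i h).
Proof.
move=> mw; apply: measurable_funM.
  by apply: (measurableT_comp mw); exact: measurable_addscale.
have mi : measurable_fun setT (\1_(`[0, h]%classic : set R) : measurableTypeR R -> R).
  exact: measurable_indic.
exact: (measurableT_comp mi measurable_snd).
Qed.

Lemma segment_integralE w i h x :
  segment_integral w i h x = (\int[leb]_t (segment_kernel w i h (x, t))%:E)%E.
Proof.
rewrite /segment_integral integral_mkcond; apply: eq_integral => t _.
by rewrite patchE /segment_kernel/= indicE; case: ifP; rewrite ?mulr1 ?mulr0.
Qed.

(** By Tonelli: for each t in [0, h] the shifted cube stays in one larger cube, so the double
    integral is at most h times the integral of |w| there. *)
Lemma segment_kernel_fin w i h n : 0 <= h -> loc_integrable w ->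
  (\int[lam]_(x in cube n%:R) \int[leb]_t `|segment_kernel w i h (x, t)|%:E < +oo)%E.
Proof.
move=> h0 lw; have [mw iw] := lw.
have [m nm] := cube_shift h n.
pose k z := (`|segment_kernel w i h z| * \1_(cube n%:R : set Rn) z.1)%:E.
have mk : measurable_fun setT k.
  apply/measurable_EFinP; apply: measurable_funM.
    by apply: measurableT_comp => //; exact: measurable_segment_kernel.
  have mi : measurable_fun setT (\1_(cube n%:R : set Rn) : Rn -> R).
    by apply: measurable_indic; exact: measurable_cube.
  exact: (measurableT_comp mi measurable_fst).
have k0 z : (0 <= k z)%E by rewrite lee_fin mulr_ge0.
rewrite integral_mkcond.
transitivity ((\int[lam]_x \int[leb]_t k (x, t) < +oo)%E).
  congr (_ < _)%E; apply: eq_integral => x _; rewrite patchE.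
  case: ifPn => xn.
    by apply: eq_integral => t _; rewrite /k/= indicE xn mulr1.
  by rewrite integral0_eq// => t _; rewrite /k/= indicE (negbTE xn) mulr0.
rewrite (@fubini_tonelli _ _ _ _ _ lam leb k mk k0).
have I0 : (0 <= \int[lam]_(x in cube m%:R) `|w x|%:E)%E by exact: integral_ge0.
apply: (@le_lt_trans _ _ (\int[leb]_(t in `[0%R, h]) \int[lam]_(x in cube m%:R) `|w x|%:E)%E).
  rewrite [leRHS]integral_mkcond; apply: ge0_le_integral => //.
  - by move=> t _; exact: integral_ge0.
  - exact: measurable_fun_fubini_tonelli_G.
  - by apply/(measurable_restrictT _ _).1.
  move=> t _; rewrite patchE; case: ifPn => [/set_mem th|th].
    apply: le_trans (@integral_cube_shift _ n m (t *: delta_mx ord0 i) lw _).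
      rewrite [leRHS]integral_mkcond le_eqVlt; apply/orP; left; apply/eqP.
      apply: eq_integral => x _; rewrite patchE /k/segment_kernel/= !indicE (mem_set th) mulr1.
      by case: ifP; rewrite ?mulr1 ?mulr0.
    move=> x; apply: nm => j; move: th; rewrite /= in_itv/= => /andP[t0 th].
    rewrite !mxE eqxx/=; case: eqP => _; first by rewrite mulr1 ger0_norm.
    by rewrite mulr0 normr0.
  by rewrite integral0_eq// => x _; rewrite /k/segment_kernel/= indicE (negbTE th) mulr0 normr0 mul0r.
rewrite integral_cst//= lebesgue_measure_itv/=.
have /integrableP[_ Ioo] := iw m; apply: lte_mul_pinfty => //.
  by rewrite ge0_fin_numE.
by case: ifP; rewrite ltry.
Qed.

End local_integrability.

(** [fine] sends both infinities to 0, so it can only lower the absolute value. *)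
Lemma abse_fine_le (R : realType) (y : \bar R) : (`|fine y|%:E <= `|y|)%E.
Proof. by case: y => [r||] //=; rewrite normr0 leey. Qed.

(** * Weak derivatives and increments along segments *)

Section weak_derivative.
Context {R : realType} {N : nat}.
Local Notation Rn := 'rV[R]_N.
Local Notation lam := (@borel_lebesgue R N).
Local Notation leb := (@lebesgue_measure R).
Implicit Types (w u g : Rn -> R) (x y : Rn) (i : 'I_N) (n m : nat) (h : R).

Lemma measurable_segment_integral w i h : measurable_fun setT w ->
  measurable_fun setT (segment_integral w i h).
Proof.
move=> mw; rewrite (_ : segment_integral w i h =
  fun x => \int[leb]_t (EFin \o segment_kernel w i h) (x, t))%E; last first.
  by apply/funext => x; rewrite segment_integralE.
apply: measurable_fun_integral_prod.
by apply/measurable_EFinP; exact: measurable_segment_kernel.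
Qed.

Lemma segment_kernel_integrable w i h : 0 <= h -> loc_integrable w ->
  {ae lam, forall x, leb.-integrable setT (fun t => (segment_kernel w i h (x, t))%:E)}.
Proof.
move=> h0 lw; have [mw iw] := lw.
have mk : measurable_fun setT (segment_kernel w i h) by exact: measurable_segment_kernel.
have mk1 x : measurable_fun setT (fun t => (segment_kernel w i h (x, t))%:E).
  by apply/measurable_EFinP; apply: (measurableT_comp mk); exact: pair1_measurable.
pose J x := (\int[leb]_t `|segment_kernel w i h (x, t)|%:E)%E.
have mJ : measurable_fun setT J.
  apply: (@measurable_fun_fubini_tonelli_F _ _ _ _ _ leb (fun z => `|segment_kernel w i h z|%:E)) => //.
  by apply/measurable_EFinP; exact: measurableT_comp.
have J0 x : (0 <= J x)%E by exact: integral_ge0.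
suff H n : {ae lam, forall x, cube n%:R x -> J x \is a fin_num}.
  have := ae_foralln H; apply: filterS => x Hx.
  have [n _ nx] : (\bigcup_n cube n%:R) x by rewrite cube_cover.
  apply/integrableP; split => //; rewrite -ge0_fin_numE; last exact: integral_ge0.
  exact: Hx nx.
apply: integrable_ae; first exact: measurable_cube.
apply/integrableP; split; first exact: measurable_funTS.
under eq_integral do rewrite gee0_abs//.
exact: segment_kernel_fin.
Qed.

Lemma loc_integrable_segment w i h : 0 <= h -> loc_integrable w ->
  loc_integrable (fun x => fine (segment_integral w i h x)).
Proof.
move=> h0 lw; have [mw _] := lw.
have mS : measurable_fun setT (segment_integral w i h) by exact: measurable_segment_integral.
have mF : measurable_fun setT (fun x => fine (segment_integral w i h x)).
  exact: measurableT_comp.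
split => // n; apply/integrableP; split; first exact/measurable_EFinP/measurable_funTS.
apply: le_lt_trans (segment_kernel_fin i n h0 lw).
have mk : measurable_fun setT (segment_kernel w i h) by exact: measurable_segment_kernel.
apply: ge0_le_integral => //.
- exact: measurable_cube.
- by apply/measurable_EFinP/measurable_funTS; exact: measurableT_comp.
- apply: measurable_funTS.
  apply: (@measurable_fun_fubini_tonelli_F _ _ _ _ _ leb (fun z => `|segment_kernel w i h z|%:E)) => //.
  by apply/measurable_EFinP; exact: measurableT_comp.
- move=> x _; apply: (@le_trans _ _ `|segment_integral w i h x|%E).
    exact: abse_fine_le.
  rewrite segment_integralE; apply: le_abse_integral => //.
  by apply/measurable_EFinP; apply: (measurableT_comp mk); exact: pair1_measurable.
Qed.

Lemma measurable_prod_fun (s : 'I_N -> R -> R) : (forall j, continuous (s j)) ->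
  measurable_fun setT (prod_fun s).
Proof.
move=> cs; apply: (@measurable_prod _ Rn R setT 'I_N (index_enum _) (fun j v => s j (v ord0 j))) => j _.
apply: (measurableT_comp (continuous_measurable_fun (cs j))).
exact: measurable_coord.
Qed.

(* Products of one-variable bumps are enough test functions, since they
   approximate the indicators of boxes. *)
Definition has_weak_derivative u g i :=
  forall s (a b : 'I_N -> R), (forall j, smooth1 (s j)) ->
    (forall j z, s j z != 0 -> z \in `[a j, b j]) ->
    (\int[lam]_x (u x * partial i (prod_fun s) x)%:E =
     - \int[lam]_x (g x * prod_fun s x)%:E)%E.

Definition box_bump n (a b : 'I_N -> R) : Rn -> R :=
  prod_fun (fun j => itv_bump n (a j) (b j)).

Lemma measurable_box_bump n a b : measurable_fun setT (box_bump n a b).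
Proof.
apply: measurable_prod_fun => j; exact/smooth1_continuous/itv_bump_smooth.
Qed.

Lemma box_bump_ge0 n a b x : 0 <= box_bump n a b x.
Proof. by apply: prodr_ge0 => j _; exact: itv_bump_ge0. Qed.

Lemma box_bump_le1 n a b x : `|box_bump n a b x| <= 1.
Proof.
rewrite ger0_norm ?box_bump_ge0//.
by apply: prodr_ile1 => j; rewrite itv_bump_ge0 itv_bump_le1.
Qed.

Lemma box_bump_supp n a b x : box_bump n a b x != 0 -> obox a b x.
Proof. by move=> H j; apply: (@itv_bump_supp _ n); apply: contra_neq H => H; rewrite /box_bump /prod_fun (bigD1 j)//= H mul0r. Qed.

Lemma box_bump_cvg a b x : box_bump n a b x @[n --> \oo] --> (\1_(obox a b) x : R).
Proof.
have -> : \1_(obox a b) x = \prod_j ((a j < x ord0 j < b j)%R%:R : R).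
  rewrite indicE; have [/set_mem xab|/negP xab] := boolP (x \in obox a b).
    by rewrite big1// => j _; rewrite xab.
  have [j /negP/negbTE jab] : exists j, ~ (a j < x ord0 j < b j).
    by apply/existsNP => H; apply: xab; rewrite inE.
  by rewrite (bigD1 j)//= jab mul0r.
rewrite /box_bump /prod_fun.
apply: (@cvg_big R 'I_N *%R 1 xpredT (@mul_continuous R) nat \oo _
  (fun j n => itv_bump n (a j) (b j) (x ord0 j))) => j _.
exact: itv_bump_cvg.
Qed.

Let bump_kernel n a b i h (z : Rn * measurableTypeR R) : R :=
  box_bump n a b (z.1 - z.2 *: delta_mx ord0 i) * \1_(`[0, h]%classic : set R) z.2.

Let measurable_bump_kernel n a b i h : measurable_fun setT (bump_kernel n a b i h).
Proof.
have -> : bump_kernel n a b i h = fun z : Rn * measurableTypeR R =>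
  box_bump n a b (z.1 + z.2 *: (- delta_mx ord0 i)) * \1_(`[0, h]%classic : set R) z.2.
  by apply/funext => z; rewrite /bump_kernel scalerN.
apply: measurable_funM.
  apply: (measurableT_comp (measurable_box_bump n a b)); exact: measurable_addscale.
have mi : measurable_fun setT (\1_(`[0, h]%classic : set R) : measurableTypeR R -> R).
  exact: measurable_indic.
exact: (measurableT_comp mi measurable_snd).
Qed.

Let bump_kernel_integral n a b i h x : 0 <= h ->
  leb.-integrable setT (fun t => (bump_kernel n a b i h (x, t))%:E) /\
  (\int[leb]_t (bump_kernel n a b i h (x, t))%:E =
   (fine (\int[leb]_(t in `[0%R, h]) (box_bump n a b (x - t *: delta_mx ord0 i))%:E))%:E)%E.
Proof.
move=> h0.
have ib : leb.-integrable setT (fun t => (bump_kernel n a b i h (x, t))%:E).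
  have := @integrable_indic_itv R 0 h true false.
  apply: le_integrable => //.
    apply/measurable_EFinP; apply: (measurableT_comp (measurable_bump_kernel n a b i h)).
    exact: pair1_measurable.
  move=> t _; rewrite /= lee_fin normrM ler_piMl//; exact: box_bump_le1.
split => //; rewrite [X in fine X](_ : _ = \int[leb]_t (bump_kernel n a b i h (x, t))%:E)%E.
  by rewrite fineK//; exact: integrable_fin_num.
rewrite integral_mkcond; apply: eq_integral => t _.
by rewrite patchE /bump_kernel/= indicE; case: ifP; rewrite ?mulr1 ?mulr0.
Qed.

(* Shifting the test function along [e_i] and integrating in the shift. *)
Lemma integral_segment_bump g i h n a b : 0 <= h -> loc_integrable g ->
  (\int[lam]_x (fine (segment_integral g i h x) * box_bump n a b x)%:E =
   \int[lam]_x (g x * fine (\int[leb]_(t in `[0%R, h])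
      (box_bump n a b (x - t *: delta_mx ord0 i))%:E))%:E)%E.
Proof.
move=> h0 lg; have [mg _] := lg; set e := delta_mx ord0 i.
set phi := box_bump n a b.
have mphi : measurable_fun setT phi by exact: measurable_box_bump.
pose k1 (z : Rn * measurableTypeR R) := (segment_kernel g i h z * phi z.1)%:E.
pose k2 (z : Rn * measurableTypeR R) := (g z.1 * bump_kernel n a b i h z)%:E.
have mk : measurable_fun setT (segment_kernel g i h) by exact: measurable_segment_kernel.
have mk1 : measurable_fun setT k1.
  apply/measurable_EFinP; apply: measurable_funM => //.
  exact: (measurableT_comp mphi measurable_fst).
have mk2 : measurable_fun setT k2.
  apply/measurable_EFinP; apply: measurable_funM => //.
  exact: (measurableT_comp mg measurable_fst).
(* For fixed t the two kernels differ by a translation in x, so integrability passes from [k1] to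
   [k2], and the identity follows by Fubini, this translation, and Fubini back. *)
have k12 x t : k1 (x, t) = k2 (x + t *: e, t).
  by rewrite /k1 /k2 /segment_kernel /bump_kernel/= addrK; congr EFin; rewrite -mulrA [in LHS](mulrC (\1_ _ _)).
have mk2t t : measurable_fun setT (fun x => k2 (x, t)).
  by apply: (measurableT_comp mk2); exact: pair2_measurable.
have ik1 : (lam \x leb)%E.-integrable setT k1.
  apply/integrable12ltyP => //; have [m abm] := obox_sub_cube a b.
  apply: le_lt_trans (segment_kernel_fin i m h0 lg).
  have mJ : measurable_fun setT
      ((fun x => \int[leb]_t `|segment_kernel g i h (x, t)|%:E)%E \_ (cube m%:R)).
    apply/(measurable_restrictT _ _).1; first exact: measurable_cube.
    apply: measurable_funTS.
    apply: (@measurable_fun_fubini_tonelli_F _ _ _ _ _ leb (fun z => `|segment_kernel g i h z|%:E)) => //.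
    by apply/measurable_EFinP; exact: measurableT_comp.
  rewrite [leRHS]integral_mkcond; apply: ge0_le_integral => //.
  - by move=> x _; exact: integral_ge0.
  - apply: (@measurable_fun_fubini_tonelli_F _ _ _ _ _ leb (abse \o k1)).
      exact: measurableT_comp.
    by move=> z; exact: abse_ge0.
  - move=> x _; rewrite patchE; case: ifPn => [_|/negP xm].
      apply: ge0_le_integral => //.
      + apply: measurableT_comp => //; apply: (measurableT_comp mk1); exact: pair1_measurable.
      + apply/measurable_EFinP; apply: measurableT_comp => //.
        by apply: (measurableT_comp mk); exact: pair1_measurable.
      + move=> t _; rewrite /k1/= lee_fin normrM ler_piMr//; exact: box_bump_le1.
    rewrite integral0_eq// => t _; rewrite /k1/= (_ : phi x = 0) ?mulr0 ?normr0//.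
    by apply/eqP; apply: contrapT => /negP /box_bump_supp /abm xm'; apply: xm; rewrite inE.
have ik2 : (lam \x leb)%E.-integrable setT k2.
  apply/integrable21ltyP => //.
  rewrite (_ : integral _ _ _ = \int[leb]_t \int[lam]_x `|k1 (x, t)|)%E.
    exact: (@integrable21ltyP _ _ _ _ _ lam leb k1 mk1).1 ik1.
  apply: eq_integral => t _; apply/esym.
  rewrite -[RHS](@ge0_integral_translation R N (fun x => `|k2 (x, t)|%E) (t *: e))//.
    by apply: eq_integral => x _; rewrite k12.
  by apply: measurableT_comp => //; exact: mk2t.
transitivity (\int[lam]_x \int[leb]_t k1 (x, t))%E.
  apply: ae_eq_integral => //.
  - apply/measurable_EFinP; apply: measurable_funM => //.
    by have [] := loc_integrable_segment i h0 lg.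
  - exact: measurable_fubini_F ik1.
  (* The segment integral is finite for almost every x, where [fine] changes nothing. *)
  - have := segment_kernel_integrable i h0 lg; apply: filterS => x ix _.
    rewrite segment_integralE EFinM fineK; last exact: integrable_fin_num.
    rewrite muleC -integralZl//; apply: eq_integral => t _.
    by rewrite /k1 EFinM muleC.
rewrite (Fubini ik1).
transitivity (\int[leb]_t \int[lam]_x k2 (x, t))%E.
  apply: eq_integral => t _; rewrite -(integral_translation (t *: e) (mk2t t)).
  by apply: eq_integral => x _; rewrite k12.
rewrite -(Fubini ik2); apply: eq_integral => x _.
have [ib Eb] := bump_kernel_integral n a b i x h0.
by rewrite /k2/= EFinM -Eb -integralZl.
Qed.

(** Test the weak derivative against the bump integrated over its shifts by t e_i, 0 <= t <= h. The
    i-th partial of this function is phi(x) - phi(x - h e_i); moving the second shift onto u gives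
    the increment of u, and [integral_segment_bump] moves the t-integral onto g. *)
Lemma weak_derivative_bump u g i h n a b : 0 < h ->
  loc_integrable u -> loc_integrable g -> has_weak_derivative u g i ->
  (\int[lam]_x ((u x - u (x + h *: delta_mx ord0 i) + fine (segment_integral g i h x))
     * box_bump n a b x)%:E = 0)%E.
Proof.
move=> h0 lu lg W; set e := delta_mx ord0 i; set phi := box_bump n a b.
have [mu_ _] := lu.
have [f [sf df fE fsupp]] := itv_bump_window n (a i) (b i) h0.
(* Shifting along e_i affects only the i-th factor, so integrating in the shift replaces just that
   factor, by the sliding integral f. *)
pose s := repl_fun (fun j => itv_bump n (a j) (b j)) i f.
have ss j : smooth1 (s j).
  by rewrite /s /repl_fun; case: eqP => // _; exact: itv_bump_smooth.
have phiE x t : phi (x - t *: e) =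
    itv_bump n (a i) (b i) (x ord0 i - t) * \prod_(j < N | j != i) itv_bump n (a j) (b j) (x ord0 j).
  rewrite /phi /box_bump /prod_fun (bigD1 i)//=; congr (_ * _).
    by rewrite !mxE !eqxx mulr1.
  by apply: eq_bigr => j /negbTE ji; rewrite !mxE ji mulr0 subr0.
have sE x : prod_fun s x = f (x ord0 i) * \prod_(j < N | j != i) itv_bump n (a j) (b j) (x ord0 j).
  rewrite /prod_fun (bigD1 i)//= /s /repl_fun eqxx; congr (_ * _).
  by apply: eq_bigr => j /negbTE ->.
have psiE x : fine (\int[leb]_(t in `[0%R, h]) (phi (x - t *: e))%:E)%E = prod_fun s x.
  under eq_integral do rewrite phiE EFinM muleC.
  rewrite ge0_integralZl_EFin//=.
  - by rewrite fE sE/= mulrC.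
  - by move=> t _; rewrite lee_fin itv_bump_ge0.
  - apply/measurable_EFinP; apply: measurable_funTS; apply: continuous_measurable_fun.
    move=> y; apply: (@continuous_comp _ _ _ (fun t => x ord0 i - t) (itv_bump n (a i) (b i))).
      by apply: continuousB; [exact: cst_continuous|].
    by apply: smooth1_continuous; exact: itv_bump_smooth.
  - by apply: prodr_ge0 => j _; exact: itv_bump_ge0.
have dpsi x : partial i (prod_fun s) x = phi x - phi (x - h *: e).
  have df' z : is_derive z (1 : R) (s i) (itv_bump n (a i) (b i) z - itv_bump n (a i) (b i) (z - h)).
    by rewrite /s /repl_fun eqxx; exact: df.
  rewrite (partial_prod_fun df') phiE -[phi x](_ : phi (x - 0 *: e) = _); last first.
    by rewrite scale0r subr0.
  rewrite phiE subr0 -mulrBl /prod_fun (bigD1 i)//= /repl_fun eqxx; congr (_ * _).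
  by apply: eq_bigr => j /negbTE ji; rewrite ji /s /repl_fun ji.
have [m abm] := obox_sub_cube a b.
have mphi : measurable_fun setT phi by exact: measurable_box_bump.
have iphi w : loc_integrable w -> lam.-integrable setT (EFin \o (w \* phi)).
  move=> lw; apply: (loc_integrable_mul (m := m) (M := 1)) => //.
    by move=> x; exact: box_bump_le1.
  by move=> x /box_bump_supp/abm.
have i1 := iphi _ lu.
have lu' := loc_integrable_shift (h *: e) lu.
have i2 := iphi _ lu'.
have i3 := iphi _ (loc_integrable_segment i (ltW h0) lg).
pose v x := u x * phi (x - h *: e).
have mv : measurable_fun setT v.
  apply: measurable_funM => //; apply: (measurableT_comp mphi); exact: measurable_translation.
have i4 : lam.-integrable setT (EFin \o v).
  have [m' mm'] := @cube_shift R N h m.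
  apply: (loc_integrable_mul (m := m') (M := 1)) => //.
  - by apply: (measurableT_comp mphi); exact: measurable_translation.
  - by move=> x; exact: box_bump_le1.
  move=> x /box_bump_supp/abm xm; rewrite -(subrK (h *: e) x); apply: mm' => // j.
  rewrite !mxE eqxx/=; case: eqP => _; first by rewrite mulr1 gtr0_norm.
  by rewrite mulr0 normr0 ltW.
have E1 : (\int[lam]_x (u x * partial i (prod_fun s) x)%:E =
    \int[lam]_x (u x * phi x)%:E - \int[lam]_x (v x)%:E)%E.
  rewrite -integralB_EFin//; apply: eq_integral => x _.
  by rewrite dpsi -EFinB mulrBr.
have E2 : (\int[lam]_x (u (x + h *: e)%R * phi x)%:E = \int[lam]_x (v x)%:E)%E.
  rewrite -(@integral_translation R N (EFin \o v) (h *: e)); last exact/measurable_EFinP.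
  by apply: eq_integral => x _; rewrite /= /v addrK.
have E3 : (\int[lam]_x (fine (segment_integral g i h x) * phi x)%:E =
    \int[lam]_x (g x * prod_fun s x)%:E)%E.
  rewrite (integral_segment_bump _ _ _ _ (ltW h0) lg).
  by apply: eq_integral => x _; rewrite -/phi -/e psiE.
(* The i-th factor reaches up to b_i + h; every side is enlarged by h so that one formula serves all
   factors. *)
have sab j z : s j z != 0 -> z \in `[a j, b j + h].
  rewrite /s /repl_fun; have [->|_] := eqVneq j i; first exact: fsupp.
  move=> /itv_bump_supp/andP[az zb]; rewrite in_itv/=; apply/andP; split; first exact: ltW.
  by rewrite (le_trans (ltW zb))// lerDl ltW.
have E4 := W s a (fun j => b j + h) ss sab.
have i12 : lam.-integrable setT
    (fun x => (u x * phi x)%:E - (u (x + h *: e)%R * phi x)%:E)%E.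
  exact: integrableB.
transitivity (\int[lam]_x (u x * phi x)%:E - \int[lam]_x (u (x + h *: e)%R * phi x)%:E
    + \int[lam]_x (fine (segment_integral g i h x) * phi x)%:E)%E.
  transitivity (\int[lam]_x (((u x * phi x)%:E - (u (x + h *: e)%R * phi x)%:E)
      + (fine (segment_integral g i h x) * phi x)%:E))%E.
    by apply: eq_integral => x _; rewrite -EFinB -EFinD; congr EFin; rewrite mulrDl mulrBl.
  rewrite (integralD measurableT i12 i3); congr (_ + _)%E.
  exact: (integralB_EFin measurableT i1 i2).
rewrite E2 -E1 E4 -E3 addeC subee//; exact: integrable_fin_num i3.
Qed.

(** As n grows, the box bumps tend to the indicator of the box, dominated by 1, so
    [weak_derivative_bump] shows that the defect [f] has zero integral over every box. *)
Lemma weak_derivative_segment u g i h : 0 < h ->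
  loc_integrable u -> loc_integrable g -> has_weak_derivative u g i ->
  {ae lam, forall x, u (x + h *: delta_mx ord0 i) - u x = fine (segment_integral g i h x)}.
Proof.
move=> h0 lu lg W.
pose f x := u x - u (x + h *: delta_mx ord0 i) + fine (segment_integral g i h x).
suff : {ae lam, forall x, f x = 0} by apply: filterS => x; rewrite /f => ?; lra.
have lu' := loc_integrable_shift (h *: delta_mx ord0 i) lu.
have lF := loc_integrable_segment i (ltW h0) lg.
have lf : loc_integrable f.
  split.
    by apply: measurable_funD; [apply: measurable_funB; [exact: lu.1|exact: lu'.1]|exact: lF.1].
  move=> n.
  exact: (integrableD (measurable_cube _)
    (integrableB (measurable_cube _) (lu.2 n) (lu'.2 n)) (lF.2 n)).
apply: obox_integral_eq0; [exact: lf.1|exact: lf.2|].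
move=> a b; have [m abm] := obox_sub_cube a b.
have mab := measurable_obox a b.
have iab : lam.-integrable (obox a b) (EFin \o f).
  by apply: (integrableS _ _ abm (lf.2 m)) => //; exact: measurable_cube.
pose G n x := (f x * box_bump n a b x)%:E.
have mG n : measurable_fun setT (G n).
  by apply/measurable_EFinP; apply: measurable_funM; [exact: lf.1|exact: measurable_box_bump].
have IG n : (\int[lam]_(x in obox a b) G n x = 0)%E.
  rewrite integral_mkcond -[RHS](weak_derivative_bump n a b h0 lu lg W).
  apply: eq_integral => x _; rewrite patchE; case: ifPn => // /negP xab.
  rewrite (_ : box_bump n a b x = 0) ?mulr0//.
  by apply/eqP; apply: contrapT => /negP /box_bump_supp xab'; apply: xab; rewrite inE.
have DC : (\int[lam]_(x in obox a b) G n x)%E @[n --> \oo] -->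
    (\int[lam]_(x in obox a b) (EFin \o f) x)%E.
  apply: (@dominated_cvg _ _ _ lam (obox a b) mab G (EFin \o f) (abse \o (EFin \o f))).
  - by move=> n; exact: measurable_funTS.
  - move=> x xab; apply: cvg_EFin; first by apply: nearW.
    have := @box_bump_cvg a b x; rewrite indicE mem_set// => H.
    by rewrite -[X in _ --> X]mulr1; apply: cvgMr.
  - by [].
  - exact: integrable_abse.
  - move=> n x _; rewrite /G/= lee_fin normrM ler_piMr//; exact: box_bump_le1.
rewrite (_ : (fun n => _) = cst 0%E) in DC; last by apply/funext => n; rewrite IG.
apply: (cvg_unique _ DC); [exact: ereal_hausdorff|exact: cvg_cst].
Qed.

End weak_derivative.

(** * L^p bounds on increments *)

Section shift_bound.
Context {R : realType} {N : nat}.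
Local Notation Rn := 'rV[R]_N.
Local Notation lam := (@borel_lebesgue R N).
Local Notation leb := (@lebesgue_measure R).
Implicit Types (u g : Rn -> R) (x y : Rn) (i : 'I_N) (h p : R).

Lemma powR_normD p (a b : R) : 0 <= p ->
  `|a + b| `^ p <= 2 `^ p * (`|a| `^ p + `|b| `^ p).
Proof.
move=> p0; have mono (s t : R) : 0 <= s -> s <= t -> s `^ p <= t `^ p.
  by move=> s0 st; apply: ge0_ler_powR => //; rewrite nnegrE// (le_trans s0).
have [ab|ba] := leP `|a| `|b|.
  apply: (@le_trans _ _ ((2 * `|b|) `^ p)).
    by apply: mono => //; rewrite (le_trans (ler_normD _ _))// mulr_natl mulr2n lerD2r.
  by rewrite powRM// ler_wpM2l ?powR_ge0// lerDr powR_ge0.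
apply: (@le_trans _ _ ((2 * `|a|) `^ p)).
  by apply: mono => //; rewrite (le_trans (ler_normD _ _))// mulr_natl mulr2n lerD2l ltW.
by rewrite powRM// ler_wpM2l ?powR_ge0// lerDl powR_ge0.
Qed.

Lemma le_poweR (a b : \bar R) (r : R) : 0 <= r -> (0 <= a)%E -> (a <= b)%E ->
  (a `^ r <= b `^ r)%E.
Proof.
move=> r0 a0 ab; apply: gt0_ler_poweR => //; rewrite in_itv/= leey andbT//.
exact: le_trans ab.
Qed.

Lemma measurable_norm_powR d (T : measurableType d) (f : T -> R) p : measurable_fun setT f ->
  measurable_fun setT (fun t => (`|f t| `^ p)%:E).
Proof.
move=> mf; apply/measurable_EFinP; apply: (measurableT_comp (measurable_powR p)).
exact: measurableT_comp.
Qed.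

(** Hoelder against the indicator of [0, h], with conjugate exponent p / (p - 1); the norm of the
    indicator raised to the power p is h^(p-1). *)
Lemma segment_integral_powR g i h p x : 0 < h -> 1 < p -> measurable_fun setT g ->
  ((`|fine (segment_integral g i h x)| `^ p)%:E <=
   (h `^ (p - 1))%:E * \int[leb]_t (`|segment_kernel g i h (x, t)| `^ p)%:E)%E.
Proof.
move=> h0 p1 mg; have p0 : 0 < p by apply: lt_trans p1.
have mk : measurable_fun setT (fun t => segment_kernel g i h (x, t)).
  apply: (measurableT_comp (measurable_segment_kernel i h mg)); exact: pair1_measurable.
pose I : R -> R := \1_(`[0, h]%classic : set R).
have mI : measurable_fun setT I by exact: measurable_indic.
pose q := p / (p - 1).
have q0 : 0 < q by rewrite divr_gt0// subr_gt0.
have pq : p^-1 + q^-1 = 1 by rewrite /q; field; rewrite !gt_eqF ?subr_gt0.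
set S := (\int[leb]_t `|segment_kernel g i h (x, t)|%:E)%E.
set P := (\int[leb]_t (`|segment_kernel g i h (x, t)| `^ p)%:E)%E.
have S0 : (0 <= S)%E by exact: integral_ge0.
have P0 : (0 <= P)%E by apply: integral_ge0 => t _; rewrite lee_fin powR_ge0.
have SP : (S <= P `^ p^-1 * (h `^ q^-1)%:E)%E.
  have := hoelder leb mk mI p0 q0 pq; rewrite Lnorm1.
  rewrite (_ : integral _ _ _ = S); last first.
    apply: eq_integral => t _; rewrite /= /segment_kernel/= /I indicE.
    by case: (_ \in _); rewrite ?mulr1 ?mulr0.
  rewrite (_ : ('N[leb]_p%:E[_] = P `^ p^-1)%E); last first.
    by rewrite unlock; congr (_ `^ _)%E; apply: eq_integral => t _; rewrite /= poweR_EFin.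
  rewrite (_ : ('N[leb]_q%:E[_] = (h `^ q^-1)%:E)%E)//.
  rewrite unlock -poweR_EFin; congr (_ `^ _)%E.
  transitivity (\int[leb]_t (I t)%:E)%E.
    apply: eq_integral => t _; rewrite /= /I indicE.
    case: (_ \in _); rewrite ?normr1 ?normr0 ?poweR_EFin ?powR1//.
    by rewrite powR0// gt_eqF.
  transitivity (leb (`[0, h]%classic : set R)); first by rewrite integral_indic// setIT.
  by rewrite lebesgue_measure_itv/= lte_fin h0 oppr0 adde0.
apply: (@le_trans _ _ (S `^ p)%E).
  rewrite -poweR_EFin; apply: le_poweR; [exact: ltW|by []|].
  rewrite (le_trans (abse_fine_le _))// segment_integralE; apply: le_abse_integral => //.
  exact/measurable_EFinP.
apply: (@le_trans _ _ ((P `^ p^-1 * (h `^ q^-1)%:E) `^ p)%E).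
  by apply: le_poweR => //; exact: ltW.
rewrite poweRM ?poweR_ge0 ?lee_fin ?powR_ge0//.
rewrite -poweRrM mulVf ?gt_eqF// poweRe1// muleC poweR_EFin -powRrM.
by rewrite (_ : q^-1 * p = p - 1)// /q; field; rewrite !gt_eqF ?subr_gt0.
Qed.

(** Integrate [segment_integral_powR] in x and exchange the integrals: each t in [0, h] contributes
    the full L^p integral of g by translation invariance, and h^(p-1) h = h^p. *)
Lemma shift_powR_dir u g i h p : 0 < h -> 1 < p ->
  loc_integrable u -> loc_integrable g -> has_weak_derivative u g i ->
  (\int[lam]_x (`|u (x + h *: delta_mx ord0 i)%R - u x| `^ p)%:E <=
   (h `^ p)%:E * \int[lam]_x (`|g x| `^ p)%:E)%E.
Proof.
move=> h0 p1 lu lg W; have [mu_ _] := lu; have [mg _] := lg.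
have p0 : 0 < p by apply: lt_trans p1.
have mk : measurable_fun setT (segment_kernel g i h) by exact: measurable_segment_kernel.
pose k z := (`|segment_kernel g i h z| `^ p)%:E.
have mkp : measurable_fun setT k by exact: measurable_norm_powR.
have k0 z : (0 <= k z)%E by rewrite lee_fin powR_ge0.
have mF : measurable_fun setT (fun x => fine (segment_integral g i h x)).
  by have [] := loc_integrable_segment i (ltW h0) lg.
have mdu : measurable_fun setT (fun x => u (x + h *: delta_mx ord0 i) - u x).
  apply: measurable_funB => //; apply: (measurableT_comp mu_); exact: measurable_translation.
rewrite (ge0_ae_eq_integral (g := fun x => (`|fine (segment_integral g i h x)| `^ p)%:E) )//.
- apply: (@le_trans _ _ (\int[lam]_x ((h `^ (p - 1))%:E * \int[leb]_t k (x, t)))%E).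
    apply: ge0_le_integral => //.
    + exact: measurable_norm_powR.
    + apply: measurable_funeM; exact: measurable_fun_fubini_tonelli_F.
    + by move=> x _; exact: segment_integral_powR.
  rewrite ge0_integralZl_EFin//; last 3 first.
  + by move=> x _; exact: integral_ge0.
  + exact: measurable_fun_fubini_tonelli_F.
  + exact: powR_ge0.
  rewrite (@fubini_tonelli _ _ _ _ _ lam leb k mkp k0).
  have -> : (\int[leb]_t \int[lam]_x k (x, t) =
      \int[leb]_(t in `[0%R, h]) \int[lam]_x (`|g x| `^ p)%:E)%E.
    rewrite [RHS]integral_mkcond; apply: eq_integral => t _.
    rewrite patchE; case: ifPn => th.
      rewrite -[RHS](@ge0_integral_translation R N _ (t *: delta_mx ord0 i)).
      + by apply: eq_integral => x _; rewrite /k /segment_kernel/= indicE th mulr1.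
      + exact: measurable_norm_powR.
      + by move=> x; rewrite lee_fin powR_ge0.
    rewrite integral0_eq// => x _; rewrite /k /segment_kernel/= indicE (negbTE th) mulr0 normr0.
    by rewrite powR0// gt_eqF.
  rewrite integral_cst//= lebesgue_measure_itv/= lte_fin h0 oppr0 adde0.
  rewrite [X in (_ * X)%E]muleC muleA -EFinM; rewrite le_eqVlt; apply/orP; left; apply/eqP; congr (_ * _)%E; congr EFin.
  by rewrite -[X in _ * X](powRr1 (ltW h0)) -powRD ?subrK// gt_eqF.
- exact: measurable_norm_powR.
- exact: measurable_norm_powR.
- by have := weak_derivative_segment h0 lu lg W; apply: filterS => x /= ->.
Qed.

(** Shifts run over the whole cube [0, h]^N with a single bound, because the bound is later
    integrated in y over that cube. *)
Definition shift_bound p (A : R) u := forall h y, 0 < h ->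
  (forall j, 0 <= y ord0 j <= h) ->
  (\int[lam]_x (`|u (x + y)%R - u x| `^ p)%:E <= (h `^ p * A)%:E)%E.

(** Move one coordinate at a time; each split of an increment costs a factor 2^p, which the
    recursion [c] accumulates. The constant depends on p and N only, so it is uniform over a bounded
    sequence. *)
Lemma shift_bound_weak_derivative p : 1 < p ->
  exists2 C, 0 <= C & forall u (g : 'I_N -> Rn -> R) B,
    loc_integrable u -> (forall i, loc_integrable (g i)) ->
    (forall i, has_weak_derivative u (g i) i) ->
    (forall i, (\int[lam]_x (`|g i x| `^ p)%:E <= B%:E)%E) ->
    shift_bound p (C * B) u.
Proof.
move=> p1; have p0 : 0 < p by apply: lt_trans p1.
pose c := fix c (l : seq 'I_N) : R := if l is _ :: l then 2 `^ p * (1 + c l) else 0.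
have c0 l : 0 <= c l by elim: l => //= i l IH; rewrite mulr_ge0 ?powR_ge0// addr_ge0.
exists (c (index_enum 'I_N)) => // u g B lu lg W gB h y h0 yh.
(* The sign of B is known only through some coordinate, since N is arbitrary here. *)
have B0 (i : 'I_N) : 0 <= B by rewrite -lee_fin; apply: le_trans (gB i); exact: integral_ge0.
have [mu_ _] := lu.
pose yl (l : seq 'I_N) : Rn := \sum_(j <- l) y ord0 j *: delta_mx ord0 j.
suff H l : (\int[lam]_x (`|u (x + yl l)%R - u x| `^ p)%:E <= (h `^ p * (c l * B))%:E)%E.
  rewrite [y]row_sum_delta; exact: H.
elim: l => [|i l IH] /=.
  rewrite mul0r mulr0 integral0_eq// => x _.
  by rewrite /yl big_nil addr0 subrr normr0 powR0// gt_eqF.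
have mshift z : measurable_fun setT (fun x => u (x + z) - u x).
  apply: measurable_funB => //; apply: (measurableT_comp mu_); exact: measurable_translation.
pose z := yl l.
have E x : u (x + yl (i :: l)) - u x =
    (u (x + z + y ord0 i *: delta_mx ord0 i) - u (x + z)) + (u (x + z) - u x).
  by rewrite /yl big_cons -/(yl l) -/z subrKA -(addrA x z) (addrC z).
have mA : measurable_fun setT (fun x =>
    (`|u (x + z + y ord0 i *: delta_mx ord0 i) - u (x + z)| `^ p)%:E).
  exact: (measurableT_comp (measurable_norm_powR p (mshift (y ord0 i *: delta_mx ord0 i)))
    (measurable_translation z)).
have mB : measurable_fun setT (fun x => (`|u (x + z) - u x| `^ p)%:E).
  exact: measurable_norm_powR.
apply: (@le_trans _ _ (\int[lam]_x ((2 `^ p)%:E *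
   ((`|u (x + z + y ord0 i *: delta_mx ord0 i)%R - u (x + z)%R| `^ p)%:E +
    (`|u (x + z)%R - u x| `^ p)%:E)))%E).
  apply: ge0_le_integral => //.
  - exact: measurable_norm_powR.
  - by apply: measurable_funeM; exact: emeasurable_funD.
  - by move=> x _; rewrite E -EFinD -EFinM lee_fin powR_normD// ltW.
rewrite ge0_integralZl_EFin//; last 2 first.
- by move=> x _; rewrite adde_ge0.
- exact: emeasurable_funD.
rewrite ge0_integralD//.
have -> : (\int[lam]_x (`|u (x + z + y ord0 i *: delta_mx ord0 i)%R - u (x + z)%R| `^ p)%:E =
    \int[lam]_x (`|u (x + y ord0 i *: delta_mx ord0 i)%R - u x| `^ p)%:E)%E.
  by rewrite -[RHS](@ge0_integral_translation R N _ z)//; exact: measurable_norm_powR.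
have dir : (\int[lam]_x (`|u (x + y ord0 i *: delta_mx ord0 i)%R - u x| `^ p)%:E <= (h `^ p * B)%:E)%E.
  have [y0|y0] := eqVneq (y ord0 i) 0.
    rewrite y0 integral0_eq ?lee_fin ?mulr_ge0 ?powR_ge0 ?(B0 i)// => x _.
    by rewrite scale0r addr0 subrr normr0 powR0// gt_eqF.
  have /andP[yi0 yih] := yh i.
  have yi : 0 < y ord0 i by rewrite lt_neqAle eq_sym y0.
  apply: le_trans (shift_powR_dir yi p1 lu (lg i) (W i)) _.
  apply: (@le_trans _ _ ((h `^ p)%:E * \int[lam]_x (`|g i x| `^ p)%:E)%E).
    apply: lee_wpmul2r; first exact: integral_ge0.
    by rewrite lee_fin ge0_ler_powR// ?nnegrE// ltW.
  by rewrite EFinM lee_wpmul2l// lee_fin powR_ge0.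
rewrite -!mulrA EFinM; apply: (@le_trans _ _ ((2 `^ p)%:E * ((h `^ p * B)%:E + (h `^ p * (c l * B))%:E))%E).
  by rewrite lee_wpmul2l ?lee_fin ?powR_ge0// leeD.
by rewrite -EFinD -!EFinM lee_fin le_eqVlt; apply/orP; left; apply/eqP; ring.
Qed.

End shift_bound.

(** * Higher integrability *)

Section higher_integrability.
Context {R : realType} {N : nat}.
Local Notation Rn := 'rV[R]_N.
Local Notation lam := (@borel_lebesgue R N).
Implicit Types (u : Rn -> R) (x y : Rn) (h p t : R).

(* The cube of side [h] has twice the volume allowed to [{|u| > l / 2}], so half
   of the shifts of a point of [{|u| > l}] change [u] by at least [l / 2]. *)
Lemma level_set_bound u p t (A S l : R) : (0 < N)%N -> 0 < p -> 0 < t -> 0 < A -> 0 < l ->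
  measurable_fun setT u -> shift_bound p S u ->
  (\int[lam]_x (`|u x| `^ t)%:E <= A%:E)%E ->
  (lam [set x | (l < `|u x|)%R] <=
    (2 * (2 / l) `^ p * (2 * (2 / l) `^ t * A) `^ (p / N%:R) * S)%:E)%E.
Proof.
move=> N0 p0 t0 A0 l0 mu_ Su uA.
pose c := 2 * (2 / l) `^ t * A.
have l20 : 0 < 2 / l by rewrite divr_gt0.
have c0 : 0 < c by rewrite !mulr_gt0// powR_gt0.
pose h := c `^ (N%:R)^-1.
have h0 : 0 < h by rewrite powR_gt0.
have hN : h ^+ N = c.
  by rewrite -powR_mulrn ?ltW// -powRrM mulVf ?powRr1 ?ltW// pnatr_eq0 -lt0n.
have hp : h `^ p = c `^ (p / N%:R) by rewrite -powRrM mulrC.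
pose Q : set Rn := obox (fun=> 0) (fun=> h).
have mQ : measurable Q by exact: measurable_obox.
have lQ : lam Q = c%:E.
  rewrite borel_lebesgue_obox; last by move=> _; exact: ltW.
  by rewrite subr0 prodr_const card_ord hN.
pose X : set Rn := [set x | l < `|u x|].
have mX : measurable X.
  rewrite -[X in measurable X]setTI; apply: measurable_fun_ltr => //.
  exact: measurableT_comp.
pose k (z : Rn * Rn) := (`|u (z.1 + z.2) - u z.1| `^ p * \1_Q z.2)%:E.
have mk : measurable_fun setT k.
  apply/measurable_EFinP; apply: measurable_funM; last first.
    have mi : measurable_fun setT (\1_Q : Rn -> R) by exact: measurable_indic.
    exact: (measurableT_comp mi measurable_snd).
  apply: (measurableT_comp (measurable_powR p)); apply: measurableT_comp => //.
  apply: measurable_funB.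
    by apply: (measurableT_comp mu_); exact: measurable_addrV.
  exact: (measurableT_comp mu_ measurable_fst).
have k0 z : (0 <= k z)%E by rewrite lee_fin mulr_ge0 ?powR_ge0.
(* Upper bound: integrate in x first, for which [shift_bound] applies to each y in [Q], a set of
   volume c. *)
have H1 : (\int[lam]_x \int[lam]_y k (x, y) <= (c * (h `^ p * S))%:E)%E.
  rewrite (@fubini_tonelli _ _ _ _ _ lam lam k mk k0).
  apply: (@le_trans _ _ (\int[lam]_(y in Q) (h `^ p * S)%:E)%E).
    rewrite [leRHS]integral_mkcond; apply: ge0_le_integral => //.
    - by move=> y _; exact: integral_ge0.
    - exact: measurable_fun_fubini_tonelli_G.
    - by apply/(measurable_restrictT _ _).1.
    - move=> y _; rewrite patchE; case: ifPn => yQ.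
        apply: le_trans (Su h y h0 _); last first.
          by move=> j; have /set_mem/(_ j)/andP[? ?] := yQ; rewrite !ltW.
        rewrite le_eqVlt; apply/orP; left; apply/eqP; apply: eq_integral => x _.
        by rewrite /k/= indicE yQ mulr1.
      by rewrite integral0_eq// => x _; rewrite /k/= indicE (negbTE yQ) mulr0.
  by rewrite integral_cst// [X in (_ * X)%E](_ : _ = c%:E)// muleC -EFinM.
have H2 x : X x -> ((c / 2)%:E <= ((2 / l) `^ p)%:E * \int[lam]_y k (x, y))%E.
  move=> Xx.
  have mkx : measurable_fun setT (fun y => k (x, y)).
    by apply: (measurableT_comp mk); exact: pair1_measurable.
  have mux : measurable_fun setT (fun y => (`|u (x + y)| `^ t)%:E).
    apply: measurable_norm_powR; apply: (measurableT_comp mu_).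
    have := measurable_translation x; under eq_fun do rewrite addrC; exact.
  have muxA : (\int[lam]_y (`|u (x + y)%R| `^ t)%:E <= A%:E)%E.
    apply: le_trans uA.
    have mt : measurable_fun setT (fun y => (`|u y| `^ t)%:E) by exact: measurable_norm_powR.
    have t0' y : (0 <= (`|u y| `^ t)%:E)%E by rewrite lee_fin powR_ge0.
    rewrite -(@ge0_integral_translation R N _ x mt t0').
    by under eq_integral do rewrite addrC.
  have ge1 (a e : R) : 0 < e -> l / 2 <= a -> 1 <= (2 / l) `^ e * a `^ e.
    move=> e0 la; have a0 : 0 <= a by apply: le_trans la; rewrite divr_ge0 ?ltW.
    rewrite -powRM ?(ltW l20)//; apply: (@le_trans _ _ (1 `^ e)); first by rewrite powR1.
    rewrite ge0_ler_powR ?nnegrE ?(ltW e0)//; first by rewrite mulr_ge0 ?(ltW l20).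
    by rewrite -ler_pdivrMl// mulr1 invf_div.
  (* For y in [Q], either |u(x + y)| <= l/2, and u changes by at least l/2, or |u(x + y)| > l/2: one
     of the two terms is at least 1. *)
  have : (c%:E <= \int[lam]_y (((2 / l) `^ p)%:E * k (x, y) +
      ((2 / l) `^ t)%:E * (`|u (x + y)%R| `^ t)%:E))%E.
    rewrite -lQ -(setIT Q) -integral_indic//; apply: ge0_le_integral => //.
    - by apply/measurable_EFinP; exact: measurable_indic.
    - by apply: emeasurable_funD; exact: measurable_funeM.
    move=> y _; rewrite /k -!EFinM -EFinD lee_fin /=.
    rewrite indicE; case: (_ \in Q); last by rewrite !mulr0 add0r mulr_ge0 ?powR_ge0.
    rewrite mulr1; have [ul|lu] := leP `|u (x + y)| (l / 2).
      apply: (@le_trans _ _ ((2 / l) `^ p * `|u (x + y) - u x| `^ p)).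
        apply: ge1 => //; rewrite distrC.
        by move: Xx; rewrite /X/= => Xx; have := lerB_dist (u x) (u (x + y)); lra.
      by rewrite lerDl mulr_ge0 ?powR_ge0.
    apply: (@le_trans _ _ ((2 / l) `^ t * `|u (x + y)| `^ t)); first by rewrite ge1// ltW.
    by rewrite lerDr mulr_ge0 ?powR_ge0.
  have f1 y : (0 <= ((2 / l) `^ p)%:E * k (x, y))%E by rewrite mule_ge0 ?lee_fin ?powR_ge0.
  have f2 y : (0 <= ((2 / l) `^ t)%:E * (`|u (x + y)%R| `^ t)%:E)%E.
    by rewrite mule_ge0 ?lee_fin ?powR_ge0.
  have m1 := measurable_funeM ((2 / l) `^ p)%:E mkx.
  have m2 := measurable_funeM ((2 / l) `^ t)%:E mux.
  rewrite (ge0_integralD lam measurableT (fun y _ => f1 y) m1 (fun y _ => f2 y) m2).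
  rewrite !ge0_integralZl_EFin// ?powR_ge0// => H.
  (* The second term integrates to at most c/2, half the volume of [Q], which leaves c/2 for the
     first. *)
  have H' : (c%:E <= ((2 / l) `^ p)%:E * \int[lam]_y k (x, y) + (c / 2)%:E)%E.
    apply: le_trans H _; rewrite leeD2l// (_ : c / 2 = (2 / l) `^ t * A).
      by rewrite EFinM lee_wpmul2l// lee_fin powR_ge0.
    by rewrite /c; field.
  by move: H'; rewrite -leeBlDr// -EFinB; congr (_ <= _)%E; congr EFin; field.
have mkF : measurable_fun setT (fun x => \int[lam]_y k (x, y))%E.
  exact: measurable_fun_fubini_tonelli_F.
have : ((c / 2)%:E * lam X <= ((2 / l) `^ p)%:E * (c * (h `^ p * S))%:E)%E.
  rewrite -integral_cst//.
  apply: (@le_trans _ _ (\int[lam]_(x in X) (((2 / l) `^ p)%:E * \int[lam]_y k (x, y)))%E).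
    apply: ge0_le_integral => //.
    - by move=> x _; rewrite lee_fin divr_ge0// ltW.
    - by apply: measurable_funTS; exact: measurable_funeM.
  apply: (@le_trans _ _ (\int[lam]_x (((2 / l) `^ p)%:E * \int[lam]_y k (x, y)))%E).
    apply: ge0_subset_integral => //; first exact: measurable_funeM.
    by move=> x _; rewrite mule_ge0 ?lee_fin ?powR_ge0//; exact: integral_ge0.
  rewrite ge0_integralZl_EFin// ?powR_ge0//; last by move=> x _; exact: integral_ge0.
  by rewrite lee_wpmul2l// lee_fin powR_ge0.
rewrite -EFinM -lee_pdivlMl ?divr_gt0// -EFinM => /le_trans; apply.
by rewrite lee_fin le_eqVlt -hp -/c; apply/orP; left; apply/eqP; field; rewrite gt_eqF.
Qed.

(** If |a| <= 1 the first term suffices. Otherwise 2^j < |a| <= 2^(j+1) for some j, and the j-th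
    term alone dominates |a|^(t+1). *)
Lemma norm_powR_dyadic (a t t' : R) : 0 < t -> t <= t' <= t + 1 ->
  ((`|a| `^ t')%:E <= (`|a| `^ t)%:E +
    \sum_(0 <= j <oo) (2 `^ (j.+1%:R * (t + 1)) * (2 ^+ j < `|a|)%R%:R)%:E)%E.
Proof.
move=> t0 /andP[tt' t't].
have F0 j : (0 <= (2 `^ (j.+1%:R * (t + 1)) * (2 ^+ j < `|a|)%R%:R)%:E)%E.
  by rewrite lee_fin mulr_ge0 ?powR_ge0.
have [a1|a1] := leP `|a| 1.
  apply: (@le_trans _ _ (`|a| `^ t)%:E); last by rewrite leeDl// nneseries_ge0.
  have [->|an0] := eqVneq `|a| 0.
    by rewrite !powR0// gt_eqF// (lt_le_trans t0).
  have la0 : ln `|a| <= 0 by exact: ln_le0.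
  rewrite lee_fin /powR (negbTE an0) ler_expR.
  by rewrite ler_wnM2r.
have ex : exists j, `|a| <= 2 ^+ j.+1.
  exists (Num.truncn `|a|); apply: ltW; apply: lt_trans (truncnS_gt _) _.
  by rewrite -natrX ltr_nat ltn_expl.
pose j := ex_minn ex.
have [aj ja] : `|a| <= 2 ^+ j.+1 /\ 2 ^+ j < `|a|.
  rewrite /j; case: ex_minnP => -[|m] am min; split => //.
  by rewrite ltNge; apply/negP => /min; rewrite ltnn.
apply: (@le_trans _ _ (2 `^ (j.+1%:R * (t + 1)) * (2 ^+ j < `|a|)%R%:R)%:E).
  rewrite ja mulr1 lee_fin; apply: (@le_trans _ _ (`|a| `^ (t + 1))).
    by rewrite ler_powR// ltW.
  rewrite powRrM powR_mulrn//; apply: ge0_ler_powR; rewrite ?nnegrE//.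
  by rewrite addr_ge0// ltW.
apply: (@le_trans _ _ (\sum_(0 <= j <oo) (2 `^ (j.+1%:R * (t + 1)) * (2 ^+ j < `|a|)%R%:R)%:E)%E).
  rewrite (@nneseriesD1 R _ j)//.
  by rewrite leeDl// nneseries_ge0.
by rewrite leeDr// lee_fin powR_ge0.
Qed.

(* As [p >= N >= 2], the set [{|u| > l}] has measure O(l^-(t + 2)), which is
   summable over dyadic [l] against [l^t']. *)
Lemma integrability_gain p t (A S : R) : (1 < N)%N -> N%:R <= p -> 1 <= t -> 0 < A -> 0 <= S ->
  exists C, forall u t', t <= t' <= t + 1 ->
  measurable_fun setT u -> shift_bound p S u ->
  (\int[lam]_x (`|u x| `^ t)%:E <= A%:E)%E ->
  (\int[lam]_x (`|u x| `^ t')%:E <= C%:E)%E.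
Proof.
move=> N1 Np t1 A0 S0.
have N0 : (0 < N)%N by exact: ltn_trans N1.
have N2 : 2 <= N%:R :> R by rewrite ler_nat.
have p0 : 0 < p by apply: lt_le_trans Np; lra.
have t0 : 0 < t by apply: lt_le_trans t1.
pose c := 2 * 2 `^ p * (2 * 2 `^ t * A) `^ (p / N%:R) * S.
have c0 : 0 <= c by rewrite /c !mulr_ge0 ?powR_ge0.
have level u (j : nat) : measurable_fun setT u -> shift_bound p S u ->
    (\int[lam]_x (`|u x| `^ t)%:E <= A%:E)%E ->
    (lam [set x | (2 ^+ j < `|u x|)%R] <= (c * (2 ^+ j) `^ (- (t + 2)))%:E)%E.
  move=> mu_ Su uA; have l0 : 0 < 2 ^+ j :> R by rewrite exprn_gt0.
  have l1 : 1 <= 2 ^+ j :> R by rewrite exprn_ege1// ler1n.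
  apply: le_trans (level_set_bound N0 p0 t0 A0 l0 mu_ Su uA) _.
  rewrite lee_fin; set l := 2 ^+ j in l0 l1 *.
  have lE e : (2 / l) `^ e = 2 `^ e * l `^ (- e).
    by rewrite powRM ?invr_ge0 ?(ltW l0)// -powR_inv1 ?(ltW l0)// -powRrM mulN1r.
  have -> : 2 * (2 / l) `^ p * (2 * (2 / l) `^ t * A) `^ (p / N%:R) * S =
      c * l `^ (- (p + t * (p / N%:R))).
    rewrite !lE (_ : 2 * (2 `^ t * l `^ (- t)) * A = 2 * 2 `^ t * A * l `^ (- t)); last by ring.
    rewrite (powRM _ (_ : 0 <= 2 * 2 `^ t * A)) ?powR_ge0//; last first.
      by rewrite !mulr_ge0 ?powR_ge0 ?(ltW A0).
    rewrite -powRrM opprD powRD; last by rewrite (gt_eqF l0) implybT.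
    by rewrite /c mulNr; ring.
  (* With l >= 1 it remains to see t + 2 <= p + t p / N, and this is where p >= N >= 2 enters. *)
  rewrite ler_wpM2l// ler_powR// lerN2.
  have pN : 1 <= p / N%:R by rewrite ler_pdivlMr ?mul1r// ltr0n.
  have : t <= t * (p / N%:R) by rewrite ler_peMr// ltW.
  lra.
(* The j-th dyadic term is at most c 2^((j+1)(t+1)) 2^(-j(t+2)) = c 2^(t+1) 2^-j, and these sum to c
   2^(t+1) 2. *)
exists (A + c * 2 `^ (t + 1) * 2) => u t' tt' mu_ Su uA.
pose F (j : nat) x := (2 `^ (j.+1%:R * (t + 1)) * (2 ^+ j < `|u x|)%R%:R)%:E.
have mX j : measurable [set x | (2 ^+ j < `|u x|)%R].
  rewrite -[X in measurable X]setTI; apply: measurable_fun_ltr => //.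
  exact: measurableT_comp.
have FE j x : F j x = ((2 `^ (j.+1%:R * (t + 1)))%:E * (\1_[set x | (2 ^+ j < `|u x|)%R] x)%:E)%E.
  rewrite /F -EFinM indicE; congr (_ * (nat_of_bool _)%:R)%:E.
  by apply/idP/idP => [?|]; rewrite ?inE.
have mI j : measurable_fun setT (fun x => (\1_[set x | (2 ^+ j < `|u x|)%R] x)%:E : \bar R).
  by apply/measurable_EFinP; exact: measurable_indic.
have mF j : measurable_fun setT (F j).
  rewrite (_ : F j = fun x => ((2 `^ (j.+1%:R * (t + 1)))%:E * (\1_[set x | (2 ^+ j < `|u x|)%R] x)%:E)%E).
    exact: measurable_funeM.
  by apply/funext => x; exact: FE.
have F0 j x : (0 <= F j x)%E by rewrite lee_fin mulr_ge0 ?powR_ge0.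
apply: (@le_trans _ _ (\int[lam]_x ((`|u x| `^ t)%:E + \sum_(0 <= j <oo) F j x))%E).
  apply: ge0_le_integral => //.
  - exact: measurable_norm_powR.
  - apply: emeasurable_funD; first exact: measurable_norm_powR.
    by apply: ge0_emeasurable_sum => //.
  - by move=> x _; exact: norm_powR_dyadic.
have mt : measurable_fun setT (fun x => (`|u x| `^ t)%:E) by exact: measurable_norm_powR.
have mS : measurable_fun setT (fun x => \sum_(0 <= j <oo) F j x)%E.
  by apply: ge0_emeasurable_sum => // k x _ _; exact: F0.
have t0' x : (0 <= (`|u x| `^ t)%:E)%E by rewrite lee_fin powR_ge0.
have S0' x : (0 <= \sum_(0 <= j <oo) F j x)%E by exact: nneseries_ge0.
rewrite (ge0_integralD lam measurableT (fun x _ => t0' x) mt (fun x _ => S0' x) mS).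
rewrite EFinD leeD// (integral_nneseries lam measurableT mF)//.
apply: le_trans (epsilon_trick0 xpredT (_ : 0 <= c * 2 `^ (t + 1) * 2)); last first.
  by rewrite !mulr_ge0 ?powR_ge0.
apply: lee_nneseries => [j _ _|j _]; first by apply: integral_ge0 => x _; exact: F0.
under eq_integral do rewrite FE.
rewrite ge0_integralZl_EFin ?powR_ge0//.
rewrite integral_indic// setIT.
apply: (@le_trans _ _ ((2 `^ (j.+1%:R * (t + 1)))%:E * (c * (2 ^+ j) `^ (- (t + 2)))%:E)%E).
  by rewrite lee_wpmul2l ?lee_fin ?powR_ge0//; exact: level.
rewrite -EFinM lee_fin le_eqVlt; apply/orP; left; apply/eqP.
have E1 : (2 ^+ j) `^ (- (t + 2)) = 2 `^ (j%:R * - (t + 2)) :> R.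
  by rewrite -powR_mulrn// -powRrM.
have E2 : (2 ^ j.+1)%:R^-1 = 2 `^ (- j.+1%:R) :> R by rewrite natrX powRN powR_mulrn.
have E3 : 2 `^ (t + 1) * 2 = 2 `^ (t + 1 + 1) :> R.
  by rewrite [RHS]powRD ?powRr1// pnatr_eq0 implybT.
rewrite E1 E2 mulrCA -2!mulrA; congr (_ * _).
rewrite mulrA E3 -!powRD ?pnatr_eq0 ?implybT//; congr powR.
by rewrite -natr1; ring.
Qed.

(** Each use of [integrability_gain] raises the exponent by at most 1, so the induction is on the
    number of unit steps from q to t. *)
Lemma higher_integrability p q t (A S : R) : (1 < N)%N -> N%:R <= p -> 1 <= q -> q <= t ->
  0 < A -> 0 <= S -> exists C, forall u,
  measurable_fun setT u -> shift_bound p S u ->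
  (\int[lam]_x (`|u x| `^ q)%:E <= A%:E)%E ->
  (\int[lam]_x (`|u x| `^ t)%:E <= C%:E)%E.
Proof.
move=> N1 Np q1 qt A0 S0.
have [n tn] : exists n : nat, t <= q + n%:R.
  exists (Num.truncn (t - q)).+1; have := truncnS_gt (t - q); lra.
elim: n t qt tn => [|n IH] t qt tn.
  have -> : t = q by apply/eqP; rewrite eq_le qt andbT; rewrite addr0 in tn.
  by exists A.
(* The intermediate exponent is the larger of q and t - 1. *)
have [t1 [qt1 t1n t1t]] : exists t1, [/\ q <= t1, t1 <= q + n%:R & t1 <= t <= t1 + 1].
  rewrite -natr1 in tn.
  have [tq|qt'] := leP (t - 1) q.
    by exists q; split; rewrite ?lerDl ?qt//=; lra.
  by exists (t - 1); split; [exact: ltW|lra|lra].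
have [C1 HC1] := IH t1 qt1 t1n.
have C10 : 0 < `|C1| + 1 by rewrite ltr_wpDl.
have [C HC] := @integrability_gain p t1 _ S N1 Np (le_trans q1 qt1) C10 S0.
exists C => u mu_ Su uA; apply: HC => //; apply: le_trans (HC1 u mu_ Su uA) _.
by rewrite lee_fin (le_trans (ler_norm _))// lerDl.
Qed.

End higher_integrability.

(** * Almost everywhere convergent subsequences *)

Section subsequences.
Context {R : realType}.

Lemma homo_ltnS (phi : nat -> nat) : (forall n, (phi n < phi n.+1)%N) ->
  {homo phi : i j / (i < j)%N}.
Proof. by move=> h; apply: homo_ltn => [y x z|]; [exact: ltn_trans|]. Qed.

(** Tychonoff replaces the nested extractions: the rows lie in a compact product of segments, hence
    have a cluster point b, and [phi n] is chosen so that the coordinates 0, ..., n are within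
    1/(n+1) of b. *)
Lemma diagonal_subsequence (a : nat -> nat -> R) (M : nat -> R) :
  (forall k i, `|a k i| <= M i) ->
  exists2 phi : nat -> nat, {homo phi : i j / (i < j)%N} &
    forall i, cvgn (fun k => a (phi k) i).
Proof.
move=> aM.
have cK := @tychonoff nat (fun=> R) (fun i => `[- M i, M i]%classic) (fun i => @segment_compact R _ _).
pose F : set_system (prod_topology (fun _ : nat => R)) := a k @[k --> \oo].
have FK : F [set f | forall i, `[- M i, M i]%classic (f i)].
  by exists 0%N => // k _ i; rewrite /= in_itv/= -ler_norml.
have [b [_ bF]] := cK F _ FK.
have near_b n m : exists k, (m < k)%N /\ forall i, (i < n.+1)%N -> `|a k i - b i| < n.+1%:R^-1.
  pose U : set (prod_topology (fun _ : nat => R)) :=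
    [set f | forall i : 'I_n.+1, `|f i - b i| < n.+1%:R^-1].
  have bU : nbhs b U.
    apply: (@filter_forall (prod_topology (fun _ : nat => R)) 'I_n.+1
      (fun i => [set f | `|f i - b i| < n.+1%:R^-1]) (nbhs b)) => i.
    have := @proj_continuous nat (fun=> R) i b.
    move=> /(_ [set y | `|y - b i| < n.+1%:R^-1]); apply.
    apply/nbhs_ballP; exists n.+1%:R^-1 => /=; first by rewrite invr_gt0.
    by move=> y; rewrite /ball/= distrC.
  have Fm : F (a @` [set k | (m < k)%N]) by exists m.+1 => // k /= mk; exists k.
  have [_ [[k mk <-] Uk]] := bF _ _ Fm bU.
  exists k; split=> // i im.
  exact: (Uk (Ordinal im)).
have /choice[g gP] (nm : nat * nat) : exists k, (nm.2 < k)%N /\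
    forall i, (i < nm.1.+1)%N -> `|a k i - b i| < nm.1.+1%:R^-1 by exact: near_b.
pose phi := fix phi n := if n is n'.+1 then g (n, phi n') else g (0%N, 0%N).
have phiS n : (phi n < phi n.+1)%N by have [] := gP (n.+1, phi n).
exists phi; first exact: homo_ltnS.
move=> i; apply/cvg_ex; exists (b i); apply/cvgrPdist_lt => e e0.
near=> n.
have ab : `|a (phi n) i - b i| < n.+1%:R^-1.
  have iSn : (i < n.+1)%N by near: n; exists i => // n /= ?; rewrite ltnS.
  by case: (n) iSn => [|n'] /= iSn; [have [_] := gP (0%N, 0%N)|have [_] := gP (n'.+1, phi n')]; apply.
rewrite distrC; apply: lt_trans ab _; near: n; exact: near_infty_natSinv_lt (PosNum e0).
Unshelve. all: by end_near. Qed.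

Lemma diagonal_subsequence_count (I : countType) (a : nat -> I -> R) (M : I -> R) :
  (forall k i, `|a k i| <= M i) ->
  exists2 phi : nat -> nat, {homo phi : i j / (i < j)%N} &
    forall i, cvgn (fun k => a (phi k) i).
Proof.
move=> aM.
pose a' k m := if unpickle m is Some i then a k i else 0.
have [|phi hphi cphi] := @diagonal_subsequence a' (fun m => if unpickle m is Some i then M i else 0).
  by move=> k m; rewrite /a'; case: unpickle => [i|]; rewrite ?normr0.
exists phi => // i; have := cphi (pickle i); rewrite /a'.
by under eq_fun do rewrite pickleK.
Qed.

End subsequences.

Section ae_convergent_subsequence.
Context d (T : measurableType d) (R : realType) (mu : {measure set T -> \bar R}).

(** Pick indices along which the j-th increment has integral at most 2^-(j+1) over [B j]. The sum of
    these increments is finite almost everywhere, and a point of [B j0] lies in all later [B j], so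
    its increments are absolutely summable. *)
Lemma ae_cvg_subsequence (B : (set T)^nat) (f : nat -> T -> R) :
  (forall j, measurable (B j)) -> {homo B : i j / (i <= j)%N >-> i `<=` j} ->
  \bigcup_j B j = setT -> (forall k, measurable_fun setT (f k)) ->
  (forall j e, 0 < e -> exists K, forall k l, (K <= k)%N -> (K <= l)%N ->
     (\int[mu]_(x in B j) `|f k x - f l x|%:E <= e%:E)%E) ->
  exists (phi : nat -> nat) (v : T -> R), [/\ {homo phi : i j / (i < j)%N},
    measurable_fun setT v & {ae mu, forall x, f (phi k) x @[k --> \oo] --> v x}].
Proof.
move=> mB ndB BT mf cf.
have /choice[K KP] j : exists K, forall k l, (K <= k)%N -> (K <= l)%N ->
     (\int[mu]_(x in B j) `|f k x - f l x|%:E <= (1 / (2 ^ j.+1)%:R)%:E)%E.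
  by apply: cf; rewrite divr_gt0// ltr0n expn_gt0.
pose phi := fix phi j := if j is j'.+1 then maxn (phi j').+1 (K j) else K 0%N.
have phiS j : (phi j < phi j.+1)%N by rewrite /= leq_max ltnSn.
have Kphi j : (K j <= phi j)%N by case: j => //= j; rewrite leq_maxr.
pose dd j x := f (phi j.+1) x - f (phi j) x.
pose g j x := (`|dd j x| * \1_(B j) x)%:E.
have mdd j : measurable_fun setT (dd j) by exact: measurable_funB.
have mg j : measurable_fun setT (g j).
  apply/measurable_EFinP; apply: measurable_funM; first exact: measurableT_comp.
  exact: measurable_indic.
have g0 j x : (0 <= g j x)%E by rewrite lee_fin mulr_ge0.
have ig : (\int[mu]_x \sum_(0 <= j <oo) g j x <= 1)%E.
  rewrite integral_nneseries//.
  apply: le_trans (epsilon_trick0 xpredT (ler01)); apply: lee_nneseries => [j _ _|j _].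
    by apply: integral_ge0 => x _; exact: g0.
  apply: le_trans (KP j _ _ (leq_trans (Kphi j) (ltnW (phiS j))) (Kphi j)).
  rewrite [leRHS]integral_mkcond le_eqVlt; apply/orP; left; apply/eqP.
  apply: eq_integral => x _; rewrite patchE /g indicE.
  by case: ifP; rewrite ?mulr1 ?mulr0.
(* The upper limit exists at every point and is measurable, also where the subsequence diverges. *)
pose v x := fine (limn_esup (fun k => (f (phi k) x)%:E)).
exists phi, v; split.
- exact: homo_ltnS.
- apply: measurableT_comp => //; apply: measurable_fun_limn_esup => k.
  exact/measurable_EFinP.
have mS : measurable_fun setT (fun x => \sum_(0 <= j <oo) g j x)%E.
  by apply: ge0_emeasurable_sum => // k x _ _; exact: g0.
have : {ae mu, forall x, setT x -> (\sum_(0 <= j <oo) g j x \is a fin_num)%E}.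
  apply: integrable_ae => //; apply/integrableP; split => //.
  apply: (@le_lt_trans _ _ 1%E); last exact: ltry.
  by apply: le_trans ig; under eq_integral do rewrite gee0_abs ?nneseries_ge0//.
apply: filterS => x /(_ Logic.I) Sfin.
have [j0 _ xj0] : (\bigcup_j B j) x by rewrite BT.
suff cfx : cvgn (fun k => f (phi k) x).
  have /cvg_ex[l fl] := cfx.
  have flE : (f (phi k) x)%:E @[k --> \oo] --> l%:E.
    by apply: cvg_EFin => //; apply: nearW.
  have -> : v x = l.
    rewrite /v is_cvg_limn_esupE; last by apply/cvg_ex; exists l%:E.
    by have /cvg_lim -> := flE.
  exact: fl.
have cd : cvgn (series (fun j => dd j x)).
  apply: normed_cvg; apply: nondecreasing_is_cvgn.
    by apply: nondecreasing_series => n _ _; exact: normr_ge0.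
  (* The first j0 increments are added separately: x need not be in [B j] for j < j0, so [g] may
     miss them. *)
  exists (\sum_(0 <= j < j0) `|dd j x| + fine (\sum_(0 <= j <oo) g j x)%E) => _ [n _ <-].
  have gS m : \sum_(0 <= j < m) `|dd j x| * \1_(B j) x <= fine (\sum_(0 <= j <oo) g j x)%E.
    by rewrite -lee_fin fineK// -sumEFin; apply: nneseries_lim_ge => j _ _; exact: g0.
  have [nj0|j0n] := leqP n j0.
    rewrite [X in _ <= X + _](big_cat_nat (leq0n n) nj0)//= -addrA lerDl addr_ge0 ?sumr_ge0//.
    by rewrite fine_ge0// nneseries_ge0.
  rewrite -[leLHS]/(\sum_(0 <= j < n) `|dd j x|) (big_cat_nat (leq0n j0) (ltnW j0n))//= lerD2l; apply: le_trans (gS n).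
  rewrite [leRHS](big_cat_nat (leq0n j0) (ltnW j0n))//=.
  apply: (@le_trans _ _ (\sum_(j0 <= j < n) `|dd j x| * \1_(B j) x)).
    rewrite big_nat_cond [leRHS]big_nat_cond; apply: ler_sum => j /andP[/andP[j0j _] _].
    by rewrite indicE mem_set ?mulr1//; exact: ndB xj0.
  by rewrite lerDr sumr_ge0// => j _; rewrite mulr_ge0.
have E k : f (phi k) x = f (phi 0%N) x + series (fun j => dd j x) k.
  elim: k => [|k IH]; first by rewrite /series/= big_geq// addr0.
  by rewrite /series/= big_nat_recr//= addrA -[X in X + _]IH /dd addrC subrK.
under eq_fun do rewrite E.
by apply: is_cvgD => //; exact: is_cvg_cst.
Qed.

End ae_convergent_subsequence.

Lemma cvge0_near_le (R : realType) (w : nat -> \bar R) (e : R) : w k @[k --> \oo] --> 0%E -> 0 < e ->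
  exists K, forall k, (K <= k)%N -> (w k <= e%:E)%E.
Proof.
move=> /fine_cvgP[[K1 _ h1] /cvgrPdist_le h2] e0.
have [K2 _ {}h2] := h2 e e0.
exists (maxn K1 K2) => k; rewrite geq_max => /andP[k1 k2].
have := h2 k k2; rewrite /= sub0r normrN => h; rewrite -(fineK (h1 k k1)) lee_fin.
exact: le_trans (ler_norm _) h.
Qed.

Lemma near_le_cvge0 (R : realType) (w : nat -> \bar R) : (forall k, (0 <= w k)%E) ->
  (forall e, 0 < e -> exists K, forall k, (K <= k)%N -> (w k <= e%:E)%E) ->
  w k @[k --> \oo] --> 0%E.
Proof.
move=> w0 H; have fw k e : (w k <= e%:E)%E -> w k \is a fin_num.
  by move=> we; rewrite ge0_fin_numE// (le_lt_trans we)// ltry.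
apply/fine_cvgP; split.
  by have [K HK] := H 1 ltr01; exists K => // k /= Kk; exact: fw (HK k Kk).
apply/cvgrPdist_le => e e0; have [K HK] := H e e0; exists K => // k /= Kk.
rewrite sub0r normrN ger0_norm ?fine_ge0// -lee_fin fineK ?HK//.
exact: fw (HK k Kk).
Qed.

(** Dominated convergence with the constant M, integrable on a set of finite measure, then the
    triangle inequality through the pointwise limit. *)
Lemma bounded_cvgn_cauchy d (R : realType) (T : measurableType d) (mu : {measure set T -> \bar R})
    (B : set T) (w : nat -> T -> R) (M e : R) : measurable B -> (mu B < +oo)%E ->
  (forall k, measurable_fun setT (w k)) -> (forall k x, `|w k x| <= M) ->
  (forall x, cvgn (w ^~ x)) -> 0 < e ->
  exists K, forall k l, (K <= k)%N -> (K <= l)%N ->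
    (\int[mu]_(x in B) `|w k x - w l x|%:E <= e%:E)%E.
Proof.
move=> mB Boo mw wM cw e0.
pose a x := limn (w ^~ x).
have wa x : w k x @[k --> \oo] --> a x by exact: cw.
have ma : measurable_fun setT a by exact: (measurable_fun_cvg mw).
have iM : mu.-integrable B (EFin \o cst M).
  apply/integrableP; split; first exact/measurable_EFinP.
  by under eq_integral do rewrite /=; rewrite integral_cst// lte_mul_pinfty// lee_fin.
have [||||_ + _] := @dominated_convergence _ T R mu B mB (fun k x => (w k x)%:E)
  (fun x => (a x)%:E) (fun=> M%:E) _ _ _ iM _.
- by move=> k; apply/measurable_EFinP; exact: measurable_funTS.
- by apply/measurable_EFinP; exact: measurable_funTS.
- by apply: aeW => x _; apply: cvg_EFin; [exact: nearW|exact: wa].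
- by apply: aeW => x k _; rewrite lee_fin.
move=> /cvge0_near_le/(_ (divr_gt0 e0 (ltr0Sn _ 1)))[K HK].
exists K => k l Kk Kl.
have mwa k' : measurable_fun B (fun x => `|(w k' x)%:E - (a x)%:E|%E).
  by apply: measurableT_comp => //; apply: emeasurable_funB => //; apply/measurable_EFinP;
    exact: measurable_funTS.
apply: (@le_trans _ _ (\int[mu]_(x in B) (`|(w k x)%:E - (a x)%:E| + `|(w l x)%:E - (a x)%:E|))%E).
  apply: ge0_le_integral => //.
  - apply/measurable_EFinP; apply: measurableT_comp => //.
    by apply: measurable_funB; exact: measurable_funTS.
  - exact: emeasurable_funD.
  move=> x _; rewrite -!EFinB !abse_EFin -EFinD lee_fin (distrC (w l x)).
  by rewrite (le_trans _ (ler_normD _ _))// addrA subrK.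
rewrite ge0_integralD//; apply: le_trans (leeD (HK k Kk) (HK l Kl)) _.
by rewrite -EFinD -splitr.
Qed.

(** * Integrals over small cubes and compactness almost everywhere *)

Section compactness.
Context {R : realType} {N : nat}.
Local Notation Rn := 'rV[R]_N.
Local Notation lam := (@borel_lebesgue R N).
Implicit Types (f : Rn -> R) (x y z : Rn) (h p q : R).

Definition window h : set Rn := obox (fun=> 0) (fun=> h).

(** An average left unnormalised: it is compared with h^N f(x) rather than with f(x). *)
Definition window_integral h f x : R := fine (\int[lam]_(y in window h) (f (x + y)%R)%:E).

Lemma measurable_window h : measurable (window h).
Proof. exact: measurable_obox. Qed.

Lemma borel_lebesgue_window h : 0 <= h -> lam (window h) = (h ^+ N)%:E.
Proof. by move=> h0; rewrite borel_lebesgue_obox// subr0 prodr_const card_ord. Qed.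

Lemma norm_le_powR (a q : R) : 0 <= a -> 1 <= q -> a <= 1 + a `^ q.
Proof.
move=> a0 q1; have [a1|a1] := leP a 1; first by rewrite (le_trans a1)// lerDl powR_ge0.
apply: (@le_trans _ _ (a `^ q)); last by rewrite lerDr.
by rewrite -[leLHS]powRr1// ler_powR// ltW.
Qed.

(** If a > e then (a/e)^(p-1) >= 1. This turns L^p control of an increment into L^1 control on a set
    of finite measure, up to e times that measure. *)
Lemma norm_le_powR_scaled (a e p : R) : 0 <= a -> 0 < e -> 1 <= p ->
  a <= e + e `^ (1 - p) * a `^ p.
Proof.
move=> a0 e0 p1; have [ae|ea] := leP a e.
  by rewrite (le_trans ae)// lerDl mulr_ge0 ?powR_ge0.
have a0' : 0 < a by exact: lt_trans ea.
apply: (@le_trans _ _ (e `^ (1 - p) * a `^ p)); last by rewrite lerDr ltW.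
have -> : e `^ (1 - p) * a `^ p = a * (e `^ (1 - p) * a `^ (p - 1)).
  rewrite mulrCA; congr (_ * _); rewrite -{2}(powRr1 a0) -powRD; last by rewrite (gt_eqF a0') implybT.
  by rewrite addrC subrK.
rewrite ler_peMr// -(opprB p) powRN mulrC ler_pdivlMr ?powR_gt0// mul1r.
by rewrite ge0_ler_powR ?nnegrE ?subr_ge0// ltW.
Qed.

Section one_function.
Variables (f : Rn -> R) (p q A S : R).
Hypotheses (p1 : 1 <= p) (q1 : 1 <= q) (mf : measurable_fun setT f).
Hypotheses (fA : (\int[lam]_x (`|f x| `^ q)%:E <= A%:E)%E) (fS : shift_bound p S f).

Lemma integral_norm_le (D : set Rn) (g : Rn -> R) : measurable D -> measurable_fun setT g ->
  (\int[lam]_x (`|g x| `^ q)%:E <= A%:E)%E ->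
  (\int[lam]_(x in D) `|g x|%:E <= lam D + A%:E)%E.
Proof.
move=> mD mg gA.
apply: (@le_trans _ _ (\int[lam]_(x in D) (cst 1%E x + (`|g x| `^ q)%:E))%E).
  apply: ge0_le_integral => //.
  - by apply/measurable_EFinP; apply: measurable_funTS; exact: measurableT_comp.
  - by apply: emeasurable_funD => //; apply: measurable_funTS; exact: measurable_norm_powR.
  - by move=> x _; rewrite /= -EFinD lee_fin norm_le_powR.
rewrite ge0_integralD//; last by apply: measurable_funTS; exact: measurable_norm_powR.
rewrite integral_cst// mul1e; apply: leeD2l; apply: le_trans gA.
apply: ge0_subset_integral => //; exact: measurable_norm_powR.
Qed.

Lemma loc_integrable_powR : loc_integrable f.
Proof.
split => // n; apply/integrableP; split; first exact/measurable_EFinP/measurable_funTS.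
apply: le_lt_trans (integral_norm_le (measurable_cube _) mf fA) _.
by apply: lte_add_pinfty; [exact: borel_lebesgue_obox_lty|exact: ltry].
Qed.

Lemma window_integrable h x : lam.-integrable (window h) (fun y => (f (x + y))%:E).
Proof.
have [m hm] := obox_sub_cube (fun=> 0) (fun _ : 'I_N => h).
have := (loc_integrable_shift x loc_integrable_powR).2 m.
move=> /(integrableS (measurable_cube _) (measurable_window h) hm).
by apply: eq_integrable; [exact: measurable_window|move=> y _ /=; rewrite addrC].
Qed.

Lemma window_integralE h x :
  (\int[lam]_(y in window h) (f (x + y)%R)%:E = (window_integral h f x)%:E)%E.
Proof.
rewrite /window_integral fineK//; apply: integrable_fin_num; last exact: window_integrable.
exact: measurable_window.
Qed.

Lemma measurable_window_integral h : measurable_fun setT (window_integral h f).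
Proof.
apply: measurableT_comp => //.
rewrite (_ : (fun x => _) = fun x => \int[lam]_y ((f (x + y) * \1_(window h) y)%:E))%E.
  apply: (measurable_fun_integral_prod lam (f := fun z : Rn * Rn => (f (z.1 + z.2) * \1_(window h) z.2)%:E)).
  apply/measurable_EFinP; apply: measurable_funM.
    apply: (measurableT_comp mf); exact: measurable_addrV.
  have mi : measurable_fun setT (\1_(window h) : Rn -> R).
    apply: measurable_indic; exact: measurable_window.
  exact: (measurableT_comp mi measurable_snd).
apply/funext => x; rewrite integral_mkcond; apply: eq_integral => y _.
by rewrite patchE indicE; case: ifP; rewrite ?mulr1 ?mulr0.
Qed.

Let measurable_fxy x : measurable_fun setT (fun y => f (x + y)).
Proof.
have := measurableT_comp mf (measurable_translation x).
by apply: eq_measurable_fun => y _ /=; rewrite addrC.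
Qed.

Lemma window_integral_bound h x : 0 <= h -> `|window_integral h f x| <= h ^+ N + A.
Proof.
move=> h0; rewrite -lee_fin -abse_EFin -window_integralE.
apply: le_trans (le_abse_integral _ _ _) _; first exact: measurable_window.
  by apply/measurable_EFinP; exact: measurable_funTS.
apply: le_trans (integral_norm_le (measurable_window h) (measurable_fxy x) _) _.
  apply: le_trans fA.
  rewrite -(@ge0_integral_translation R N (fun y => (`|f y| `^ q)%:E) x).
  - by under eq_integral do rewrite addrC.
  - exact: measurable_norm_powR.
  - by move=> y; rewrite lee_fin powR_ge0.
by rewrite borel_lebesgue_window// EFinD.
Qed.

(** [norm_le_powR_scaled] is applied to the increment f(x + z + y) - f(x + y). The bound depends on
    f only through S and not at all on x, which gives equicontinuity of a whole sequence. *)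
Lemma window_integral_equicontinuous h e (r : R) x z : 0 <= h -> 0 < e -> 0 < r ->
  (forall j, 0 <= z ord0 j <= r) ->
  `|window_integral h f (x + z) - window_integral h f x| <=
    e * h ^+ N + e `^ (1 - p) * (r `^ p * S).
Proof.
move=> h0 e0 r0 zr; rewrite -lee_fin.
have mQ := measurable_window h.
have md : measurable_fun setT (fun y => f (y + z) - f y).
  by apply: measurable_funB => //; apply: (measurableT_comp mf); exact: measurable_translation.
have mdx : measurable_fun setT (fun y => f (x + z + y) - f (x + y)).
  exact: measurable_funB.
rewrite -abse_EFin EFinB -!window_integralE -integralB_EFin//; [|exact: window_integrable..].
apply: le_trans (le_abse_integral _ _ _) _ => //.
  by apply/measurable_EFinP; exact: measurable_funTS.
have mdp : measurable_fun setT (fun y => ((e `^ (1 - p))%:E * (`|f (x + z + y) - f (x + y)| `^ p)%:E)%E).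
  by apply: measurable_funeM; exact: measurable_norm_powR.
apply: (@le_trans _ _ (\int[lam]_(y in window h) (cst e%:E y +
    (e `^ (1 - p))%:E * (`|f (x + z + y)%R - f (x + y)%R| `^ p)%:E))%E).
  apply: ge0_le_integral => //.
  - by apply/measurable_EFinP; apply: measurable_funTS; exact: measurableT_comp.
  - by apply: emeasurable_funD => //; exact: measurable_funTS.
  - by move=> y _; rewrite -EFinM -EFinD lee_fin norm_le_powR_scaled.
have dp0 y : (0 <= (e `^ (1 - p))%:E * (`|f (x + z + y)%R - f (x + y)%R| `^ p)%:E)%E.
  by rewrite mule_ge0 ?lee_fin ?powR_ge0.
rewrite ge0_integralD//; [|by move=> y _; rewrite /= lee_fin ltW|exact: measurable_funTS].
rewrite integral_cst// [X in (_ * X)%E]borel_lebesgue_window// EFinD leeD//.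
apply: (@le_trans _ _ (\int[lam]_y ((e `^ (1 - p))%:E * (`|f (x + z + y)%R - f (x + y)%R| `^ p)%:E))%E).
  exact: ge0_subset_integral.
rewrite ge0_integralZl_EFin ?powR_ge0//; last exact: measurable_norm_powR.
rewrite EFinM lee_wpmul2l ?lee_fin ?powR_ge0//; apply: le_trans (fS r0 zr).
rewrite -(@ge0_integral_translation R N (fun y => (`|f (y + z) - f y| `^ p)%:E) x).
- rewrite le_eqVlt; apply/orP; left; apply/eqP; apply: eq_integral => y _.
  by rewrite (addrC y x) addrAC.
- exact: measurable_norm_powR.
- by move=> y; rewrite lee_fin powR_ge0.
Qed.

(** The difference at x is the integral over y in the window of f(x) - f(x + y). Exchanging the
    integrals lets [shift_bound] act for each y. *)
Lemma window_integral_approx h e (B : set Rn) b : 0 < h -> 0 < e -> measurable B ->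
  lam B = b%:E ->
  (\int[lam]_(x in B) `|h ^+ N * f x - window_integral h f x|%:E <=
   (h ^+ N * (e * b + e `^ (1 - p) * (h `^ p * S)))%:E)%E.
Proof.
move=> h0 e0 mB Bb; have mQ := measurable_window h.
pose c := e `^ (1 - p); have c0 : 0 <= c by exact: powR_ge0.
pose k (z : Rn * Rn) := ((e + c * `|f (z.1 + z.2) - f z.1| `^ p) * (\1_B z.1 * \1_(window h) z.2))%:E.
have k0 (z : Rn * Rn) : (0 <= k z)%E.
  by rewrite lee_fin !mulr_ge0// addr_ge0 ?(ltW e0)// mulr_ge0 ?powR_ge0.
have mk : measurable_fun setT k.
  apply/measurable_EFinP; apply: measurable_funM; last first.
    have m1 : measurable_fun setT (\1_B : Rn -> R) by exact: measurable_indic.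
    have m2 : measurable_fun setT (\1_(window h) : Rn -> R) by exact: measurable_indic.
    apply: measurable_funM; first exact: (measurableT_comp m1 measurable_fst).
    exact: (measurableT_comp m2 measurable_snd).
  apply: measurable_funD => //; apply: measurable_funM => //.
  apply: (measurableT_comp (measurable_powR p)); apply: measurableT_comp => //.
  apply: measurable_funB; first by apply: (measurableT_comp mf); exact: measurable_addrV.
  exact: (measurableT_comp mf measurable_fst).
have mW := measurable_window_integral h.
have mfW : measurable_fun setT (fun x => `|h ^+ N * f x - window_integral h f x|%:E).
  apply/measurable_EFinP; apply: measurableT_comp => //; apply: measurable_funB => //.
  exact: measurable_funM.
apply: (@le_trans _ _ (\int[lam]_x \int[lam]_y k (x, y))%E).
  rewrite integral_mkcond; apply: ge0_le_integral => //.
  - by move=> x _; rewrite erestrict_ge0.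
  - by apply/(measurable_restrictT _ _).1 => //; exact: measurable_funTS.
  - exact: measurable_fun_fubini_tonelli_F.
  move=> x _; rewrite patchE; case: ifPn => xB; last exact: integral_ge0.
  have cQ : lam.-integrable (window h) (EFin \o cst (f x)).
    apply/integrableP; split; first exact/measurable_EFinP.
    under eq_integral do rewrite /=.
    rewrite integral_cst// [X in (_ * X)%E]borel_lebesgue_window ?(ltW h0)//.
    by rewrite -EFinM ltry.
  have E : (\int[lam]_(y in window h) ((f (x + y)%R)%:E - (f x)%:E) =
      (window_integral h f x - h ^+ N * f x)%:E)%E.
    rewrite integralB_EFin//; last exact: window_integrable.
    rewrite window_integralE EFinB; congr (_ - _)%E.
    by rewrite integral_cst// [X in (_ * X)%E]borel_lebesgue_window ?(ltW h0)// EFinM muleC.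
  rewrite distrC -abse_EFin -E; apply: le_trans (le_abse_integral _ _ _) _ => //.
    apply: emeasurable_funB => //; apply/measurable_EFinP; exact: measurable_funTS.
  rewrite integral_mkcond; apply: ge0_le_integral => //.
  - by move=> y _; rewrite erestrict_ge0.
  - apply/(measurable_restrictT _ _).1 => //; apply: measurableT_comp => //.
    apply: emeasurable_funB => //; apply/measurable_EFinP; exact: measurable_funTS.
  - by apply: (measurableT_comp mk); exact: pair1_measurable.
  move=> y _; rewrite patchE /k/= !indicE xB mul1r; case: ifPn => yQ; last by rewrite mulr0.
  by rewrite mulr1 lee_fin norm_le_powR_scaled.
rewrite (@fubini_tonelli _ _ _ _ _ lam lam k mk k0).
apply: (@le_trans _ _ (\int[lam]_(y in window h) (e * b + c * (h `^ p * S))%:E)%E); last first.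
  by rewrite integral_cst// [X in (_ * X)%E]borel_lebesgue_window ?(ltW h0)// -EFinM mulrC.
rewrite [leRHS]integral_mkcond; apply: ge0_le_integral => //.
- by move=> y _; exact: integral_ge0.
- exact: measurable_fun_fubini_tonelli_G.
- by apply/(measurable_restrictT _ _).1.
move=> y _; rewrite patchE; case: ifPn => yQ; last first.
  by rewrite integral0_eq// => x _; rewrite /k/= [\1_(window h) y]indicE (negbTE yQ) !mulr0.
have mdp : measurable_fun setT (fun x => (`|f (x + y) - f x| `^ p)%:E).
  apply: measurable_norm_powR; apply: measurable_funB => //.
  by apply: (measurableT_comp mf); exact: measurable_translation.
have mI : measurable_fun setT (fun x => (\1_B x)%:E : \bar R).
  by apply/measurable_EFinP; exact: measurable_indic.
have m1 := measurable_funeM e%:E mI; have m2 := measurable_funeM c%:E mdp.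
have f1 x : (0 <= e%:E * (\1_B x)%:E)%E by rewrite mule_ge0 ?lee_fin// ltW.
have f2 x : (0 <= c%:E * (`|f (x + y)%R - f x| `^ p)%:E)%E by rewrite mule_ge0 ?lee_fin ?powR_ge0.
apply: (@le_trans _ _ (\int[lam]_x (e%:E * (\1_B x)%:E + c%:E * (`|f (x + y)%R - f x| `^ p)%:E))%E).
  apply: ge0_le_integral => //.
  - by apply: (measurableT_comp mk); exact: pair2_measurable.
  - exact: emeasurable_funD.
  move=> x _; rewrite /k/= -!EFinM -EFinD lee_fin [\1_(window h) y]indicE yQ mulr1.
  rewrite indicE; case: (_ \in B); rewrite ?mulr1// !mulr0 add0r mulr_ge0// powR_ge0.
rewrite (ge0_integralD lam measurableT (fun x _ => f1 x) m1 (fun x _ => f2 x) m2).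
rewrite !ge0_integralZl_EFin//; last exact: ltW.
rewrite integral_indic// setIT [X in (_ * X + _)%E](_ : _ = b%:E)// EFinD leeD//.
rewrite EFinM lee_wpmul2l ?lee_fin//; apply: fS => // j.
by have /set_mem/(_ j)/andP[? ?] := yQ; rewrite !ltW.
Qed.

End one_function.

Lemma cauchy_seq_cvgn (a : nat -> R) :
  (forall e, 0 < e -> exists K, forall k l, (K <= k)%N -> (K <= l)%N -> `|a k - a l| <= e) ->
  cvgn a.
Proof.
move=> H; apply/cauchy_cvgP/cauchy_exP => e e0.
have [K HK] := H (e / 2) (divr_gt0 e0 (ltr0Sn _ _)).
exists (a K); exists K => // k /= Kk; rewrite /ball/=.
by apply: le_lt_trans (HK _ _ (leqnn _) Kk) _; lra.
Qed.

Lemma cvgn_cauchy_seq (a : nat -> R) e : cvgn a -> 0 < e ->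
  exists K, forall k l, (K <= k)%N -> (K <= l)%N -> `|a k - a l| <= e.
Proof.
move=> /cvg_ex[b /cvgrPdist_le ab] e0.
have [K _ HK] := ab (e / 2) (divr_gt0 e0 (ltr0Sn _ _)).
exists K => k l Kk Kl; have := HK k Kk; have := HK l Kl => /= h1 h2.
have -> : a k - a l = (b - a l) - (b - a k) by ring.
by apply: le_trans (ler_normB _ _) _; lra.
Qed.

(** First d makes d b small, then r makes d^(1-p) r^p S small; the summands 1 in the denominators
    cover b = 0 and S = 0. *)
Lemma small_shift p S b e : 1 <= p -> 0 <= S -> 0 <= b -> 0 < e ->
  exists d r, [/\ 0 < d, 0 < r &
    forall h, 0 <= h <= r -> d * b + d `^ (1 - p) * (h `^ p * S) <= e].
Proof.
move=> p1 S0 b0 e0; pose d := e / (2 * (b + 1)).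
have p0 : 0 < p by apply: lt_le_trans p1.
have d0 : 0 < d by rewrite divr_gt0// mulr_gt0// ltr_wpDl.
pose c := d `^ (1 - p); have c0 : 0 <= c by exact: powR_ge0.
pose t := e / (2 * (c * S + 1)).
have t0 : 0 < t by rewrite divr_gt0// mulr_gt0// ltr_wpDl// mulr_ge0.
exists d, (t `^ p^-1); split => //; first by rewrite powR_gt0.
move=> h /andP[h0 ht]; rewrite -/c.
have hp : h `^ p <= t.
  have pn0 : p != 0 by rewrite gt_eqF.
  rewrite [leRHS](_ : t = (t `^ p^-1) `^ p); last by rewrite -powRrM mulVf// powRr1// ltW.
  by rewrite ge0_ler_powR ?nnegrE ?powR_ge0// ltW.
have half (x : R) : 0 <= x -> e / (2 * (x + 1)) * x <= e / 2.
  move=> x0; have x10 : 0 < x + 1 by rewrite ltr_wpDl.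
  rewrite mulrAC ler_pdivrMr ?mulr_gt0//.
  have -> : e / 2 * (2 * (x + 1)) = e * x + e by field.
  by rewrite lerDl ltW.
have h1 : d * b <= e / 2 by exact: half.
have h2 : c * (h `^ p * S) <= e / 2.
  apply: (@le_trans _ _ (t * (c * S))).
    by rewrite mulrCA; apply: ler_wpM2r => //; rewrite mulr_ge0.
  by apply: half; rewrite mulr_ge0.
by lra.
Qed.

Section sequence.
Variables (u_ : nat -> Rn -> R) (p q A S : R).
Hypotheses (p1 : 1 <= p) (q1 : 1 <= q) (S0 : 0 <= S).
Hypotheses (mu_ : forall k, measurable_fun setT (u_ k)).
Hypotheses (uA : forall k, (\int[lam]_x (`|u_ k x| `^ q)%:E <= A%:E)%E).
Hypotheses (uS : forall k, shift_bound p S (u_ k)).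

(** An Arzela-Ascoli argument: the diagonal subsequence converges at all rational points for all
    sides 1/(n+1), and equicontinuity carries this to every x. *)
Lemma window_integral_subsequence : exists2 phi : nat -> nat,
  {homo phi : i j / (i < j)%N} &
  forall n x, cvgn (fun k => window_integral n.+1%:R^-1 (u_ (phi k)) x).
Proof.
have h0 n : 0 <= n.+1%:R^-1 :> R by rewrite invr_ge0.
pose pt (r : {ffun 'I_N -> rat}) : Rn := \row_j ratr (r j).
pose a k (i : nat * {ffun 'I_N -> rat}) := window_integral i.1.+1%:R^-1 (u_ k) (pt i.2).
have [phi hphi cphi] := diagonal_subsequence_count
  (a := a) (M := fun i => i.1.+1%:R^-1 ^+ N + A)
  (fun k i => window_integral_bound q1 (mu_ k) (uA k) _ (h0 _)).
exists phi => // n x; apply: cauchy_seq_cvgn => e e0.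
have e30 : 0 < e / 3 by rewrite divr_gt0.
have hN0 : 0 <= n.+1%:R^-1 ^+ N :> R by rewrite exprn_ge0.
have [d [rho [d0 rho0 Hd]]] := small_shift p1 S0 hN0 e30.
(* The rational point lies below x in every coordinate, since [shift_bound] covers only shifts with
   nonnegative coordinates. *)
have /choice[r rP] (j : 'I_N) : exists r : rat, x ord0 j - rho < ratr r < x ord0 j.
  have /rat_in_itvoo[r] : x ord0 j - rho < x ord0 j by rewrite ltrBlDr ltrDl.
  by rewrite in_itv; exists r.
pose r' : {ffun 'I_N -> rat} := [ffun j => r j].
have [K HK] := cvgn_cauchy_seq (cphi (n, r')) e30.
have near_r k : `|window_integral n.+1%:R^-1 (u_ k) x - a k (n, r')| <= e / 3.
  have -> : x = pt r' + (x - pt r') by rewrite addrC subrK.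
  apply: le_trans (window_integral_equicontinuous p1 q1 (mu_ k) (uA k) (uS k) _ (h0 n) d0 rho0 _) _.
    by move=> j; rewrite !mxE ffunE; have /andP[? ?] := rP j; apply/andP; split; lra.
  by apply: Hd; rewrite lexx ltW.
exists K => k l Kk Kl.
have := HK k l Kk Kl; have := near_r (phi k); have := near_r (phi l).
by rewrite !ler_norml => /andP[? ?] /andP[? ?] /andP[? ?]; apply/andP; split; lra.
Qed.

(** The sequence is Cauchy in L^1 on each cube: for small h all its members are uniformly close to
    their averages, and for this h the averages are Cauchy. Each of the three resulting terms takes
    e/3. *)
Lemma shift_bound_ae_cvg_subsequence : exists (phi : nat -> nat) (v : Rn -> R),
  [/\ {homo phi : i j / (i < j)%N}, measurable_fun setT v &
    {ae lam, forall x, u_ (phi k) x @[k --> \oo] --> v x}].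
Proof.
have [phi hphi cphi] := window_integral_subsequence.
pose w k := u_ (phi k).
have [j||psi [v [hpsi mv uv]]] := @ae_cvg_subsequence _ Rn R lam
  (fun j => cube j%:R) w (fun j => measurable_cube _) _ (@cube_cover R N) (fun k => mu_ (phi k)) _.
- by move=> i ij; apply: cube_homo; rewrite ler_nat.
- move=> j e e0; have Boo := @borel_lebesgue_obox_lty R N (fun=> - j%:R) (fun=> j%:R).
  have mB := @measurable_cube R N j%:R.
  have : lam (cube j%:R) \is a fin_num by rewrite ge0_fin_numE.
  move=> /EFin_fin_numP[b Bb].
  have b0 : 0 <= b by rewrite -lee_fin -Bb.
  have e30 : 0 < e / 3 by rewrite divr_gt0.
  have [d [rho [d0 rho0 Hd]]] := small_shift p1 S0 b0 e30.
  (* The side must be of the form 1/(n+1), as [phi] was extracted for these sides only. *)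
  pose n := Num.truncn rho^-1; pose h : R := n.+1%:R^-1.
  have h0 : 0 < h by rewrite invr_gt0.
  have hrho : 0 <= h <= rho.
    by rewrite ltW//= -[leRHS]invrK lef_pV2 ?posrE ?invr_gt0// ltW// truncnS_gt.
  have hN0 : 0 < h ^+ N by rewrite exprn_gt0.
  have [K HK] := bounded_cvgn_cauchy mB Boo
    (fun k => measurable_window_integral (mu_ (phi k)) h)
    (fun k x => window_integral_bound q1 (mu_ (phi k)) (uA (phi k)) x (ltW h0))
    (cphi n) (mulr_gt0 hN0 e30).
  exists K => k l Kk Kl.
  have mw i : measurable_fun setT (w i) by exact: mu_.
  pose W i := window_integral h (w i).
  have mW i : measurable_fun setT (W i) by exact: (measurable_window_integral (mu_ (phi i))).
  have approx i : (\int[lam]_(x in cube j%:R) `|h ^+ N * w i x - W i x|%:E <= (h ^+ N * (e / 3))%:E)%E.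
    apply: le_trans (window_integral_approx p1 q1 (mu_ _) (uA _) (uS _) h0 d0 mB Bb) _.
    by rewrite lee_fin ler_wpM2l ?(ltW hN0)// Hd.
  have m1 i : measurable_fun (cube j%:R) (fun x => `|h ^+ N * w i x - W i x|%:E).
    apply/measurable_EFinP; apply: measurable_funTS; apply: measurableT_comp => //.
    by apply: measurable_funB => //; exact: measurable_funM.
  have m2 : measurable_fun (cube j%:R) (fun x => `|W k x - W l x|%:E).
    by apply/measurable_EFinP; apply: measurable_funTS; apply: measurableT_comp => //; exact: measurable_funB.
  have m3 : measurable_fun (cube j%:R) (fun x => `|w k x - w l x|%:E).
    by apply/measurable_EFinP; apply: measurable_funTS; apply: measurableT_comp => //; exact: measurable_funB.
  rewrite -(@lee_pmul2l _ (h ^+ N)%:E)// -ge0_integralZl_EFin ?(ltW hN0)//.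
  apply: (@le_trans _ _ (\int[lam]_(x in cube j%:R) (`|h ^+ N * w k x - W k x|%:E +
      `|h ^+ N * w l x - W l x|%:E + `|W k x - W l x|%:E))%E).
    apply: ge0_le_integral => //.
    + by move=> x _; rewrite mule_ge0// lee_fin ltW.
    + exact: measurable_funeM.
    + by apply: emeasurable_funD => //; exact: emeasurable_funD.
    move=> x _; rewrite -EFinM -!EFinD lee_fin -{1}(gtr0_norm hN0) -normrM.
    have -> : h ^+ N * (w k x - w l x) = (h ^+ N * w k x - W k x) - (h ^+ N * w l x - W l x) +
      (W k x - W l x) by ring.
    by apply: le_trans (ler_normD _ _) _; rewrite lerD2r ler_normB.
  rewrite ge0_integralD//; [|by move=> x _; rewrite adde_ge0|exact: emeasurable_funD].
  rewrite ge0_integralD//.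
  apply: le_trans (leeD (leeD (approx k) (approx l)) (HK k l Kk Kl)) _.
  by rewrite -!EFinD -EFinM lee_fin le_eqVlt; apply/orP; left; apply/eqP; field.
exists (phi \o psi), v; split => //.
by move=> i j ij; apply: hphi; exact: hpsi.
Qed.

End sequence.

End compactness.

(** * Weighted interpolation *)

Section interpolation.
Context {R : realType}.
Implicit Types (x y e : R).

Lemma cvg_norm_powR (y_ : nat -> R) (y q : R) : 0 < q -> y_ k @[k --> \oo] --> y ->
  `|y_ k| `^ q @[k --> \oo] --> `|y| `^ q.
Proof.
move=> q0 yy; have nyy : `|y_ k| @[k --> \oo] --> `|y| by exact: cvg_norm.
have [y0|y0] := eqVneq y 0.
  rewrite y0 normr0 powR0 ?gt_eqF//; apply/cvgrPdist_le => e e0.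
  have e10 : 0 < e `^ q^-1 by rewrite powR_gt0.
  move/cvgrPdist_le : yy => /(_ _ e10); apply: filterS => k /=.
  rewrite y0 !sub0r !normrN => he; rewrite ger0_norm ?powR_ge0//.
  apply: (@le_trans _ _ ((e `^ q^-1) `^ q)).
    by rewrite ge0_ler_powR ?nnegrE ?powR_ge0// ltW.
  by rewrite -powRrM mulVf ?gt_eqF// powRr1// ltW.
have ny0 : 0 < `|y| by rewrite normr_gt0.
have -> : `|y| `^ q = expR (q * ln `|y|) by rewrite /powR gt_eqF.
have H : {near \oo, (fun k => expR (q * ln `|y_ k|)) =1 (fun k => `|y_ k| `^ q)}.
  have := @cvgr_gt R _ _ _ _ _ nyy 0 ny0.
  by move=> [K _ HK]; exists K => // k /HK /= yk; rewrite /powR gt_eqF.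
apply: cvg_trans (near_eq_cvg H) _.
have lnyy : ln `|y_ k| @[k --> \oo] --> ln `|y| by apply: (cvg_comp _ _ nyy); exact: continuous_ln.
have qlnyy : q * ln `|y_ k| @[k --> \oo] --> q * ln `|y| by apply: cvgMl_tmp.
by apply: (@cvg_comp _ _ _ _ expR _ _ _ qlnyy); exact: continuous_expR.
Qed.

Lemma ler_powR_mulD (x y a b : R) : 0 <= x -> 0 <= y -> 0 <= a -> 0 <= b -> 0 < a + b ->
  x `^ a * y `^ b <= (x + y) `^ (a + b).
Proof.
move=> x0 y0 a0 b0 ab; have [xy|xy] := eqVneq (x + y) 0.
  move: xy => /eqP; rewrite paddr_eq0// => /andP[/eqP -> /eqP ->].
  rewrite addr0 (powR0 (_ : a + b != 0)) ?gt_eqF//.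
  have [a1|a1] := eqVneq a 0; last by rewrite (powR0 a1) mul0r.
  have b1 : b != 0 by rewrite gt_eqF//; move: ab; rewrite a1 add0r.
  by rewrite (powR0 b1) mulr0.
rewrite powRD ?xy ?implybT//.
by apply: ler_pM; rewrite ?powR_ge0// ge0_ler_powR ?nnegrE ?addr_ge0// ?lerDl ?lerDr.
Qed.

(** A weighted Young inequality with a free parameter, by cases: if M <= t eta the first term
    dominates, otherwise the second. *)
Lemma powR_mul_le_scaled (eta M th t : R) : 0 <= eta -> 0 <= M -> 0 < th < 1 -> 0 < t ->
  eta `^ th * M `^ (1 - th) <= t `^ (1 - th) * eta + t `^ (- th) * M.
Proof.
move=> e0 M0 /andP[th0 th1] t0.
have split1 (z : R) : 0 <= z -> z = z `^ th * z `^ (1 - th).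
  move=> z0; have [->|zn0] := eqVneq z 0; first by rewrite powR0 ?mul0r// gt_eqF.
  by rewrite -powRD ?zn0 ?implybT// addrC subrK powRr1.
have th1' : 0 <= 1 - th by rewrite subr_ge0 ltW.
have [Mt|tM] := leP M (t * eta).
  apply: (@le_trans _ _ (t `^ (1 - th) * eta)); last by rewrite lerDl mulr_ge0// powR_ge0.
  rewrite {2}(split1 eta e0) mulrCA ler_wpM2l ?powR_ge0// -powRM// ?(ltW t0)//.
  by rewrite ge0_ler_powR ?nnegrE ?mulr_ge0// ltW.
apply: (@le_trans _ _ (t `^ (- th) * M)); last by rewrite lerDr mulr_ge0// powR_ge0.
rewrite {2}(split1 M M0) mulrA ler_wpM2r ?powR_ge0// powRN mulrC ler_pdivlMr ?powR_gt0//.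
rewrite -powRM ?(ltW t0)// ge0_ler_powR ?nnegrE ?mulr_ge0//; try exact: ltW.
by rewrite mulrC ltW.
Qed.

End interpolation.

Lemma measurable_norm_powRM d (T : measurableType d) (R : realType) (t : R) (w W : T -> R) :
  measurable_fun setT w -> measurable_fun setT W ->
  measurable_fun setT (fun x => (`|w x| `^ t * W x)%:E).
Proof.
move=> mw mW; apply/measurable_EFinP; apply: measurable_funM => //.
by apply: (measurableT_comp (measurable_powR _)); exact: measurableT_comp.
Qed.

Lemma ae_eq_integral_norm_powRM d (T : measurableType d) (R : realType)
    (mu : {measure set T -> \bar R}) (t : R) (u w W : T -> R) :
  measurable_fun setT u -> measurable_fun setT w -> measurable_fun setT W -> (forall x, 0 <= W x) ->
  {ae mu, forall x, u x = w x} ->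
  (\int[mu]_x (`|u x| `^ t * W x)%:E = \int[mu]_x (`|w x| `^ t * W x)%:E)%E.
Proof.
move=> mu_ mw mW W0 uw; apply: ge0_ae_eq_integral => //.
- exact: measurable_norm_powRM.
- exact: measurable_norm_powRM.
- by move=> x _; rewrite lee_fin mulr_ge0 ?powR_ge0.
- by move=> x _; rewrite lee_fin mulr_ge0 ?powR_ge0.
- by apply: filterS uw => x -> _.
Qed.

Lemma integral_norm_powRZ d (T : measurableType d) (R : realType)
    (mu : {measure set T -> \bar R}) (t c : R) (w W : T -> R) :
  measurable_fun setT w -> measurable_fun setT W -> (forall x, 0 <= W x) -> 0 <= c ->
  (\int[mu]_x (`|c * w x| `^ t * W x)%:E = (c `^ t)%:E * \int[mu]_x (`|w x| `^ t * W x)%:E)%E.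
Proof.
move=> mw mW W0 c0; rewrite -ge0_integralZl_EFin ?powR_ge0//.
- by apply: eq_integral => x _; rewrite normrM powRM// ger0_norm// -mulrA EFinM.
- by move=> x _; rewrite lee_fin mulr_ge0 ?powR_ge0.
- exact: measurable_norm_powRM.
Qed.

(** Each integral is a supremum over simple functions lying below, and those below f also lie below
    g. *)
Lemma ge0_integral_homo d (T : measurableType d) (R : realType) (mu : {measure set T -> \bar R})
    (f g : T -> \bar R) : (forall x, 0 <= f x)%E -> (forall x, f x <= g x)%E ->
  (\int[mu]_x f x <= \int[mu]_x g x)%E.
Proof.
move=> f0 fg; have g0 x : (0 <= g x)%E by exact: le_trans (fg x).
rewrite !ge0_integralTE//; apply: ereal_sup_le => _ [h hf <-].
by exists h => // x; exact: le_trans (fg x).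
Qed.

Lemma integral_weight_ge d (T : measurableType d) (R : realType)
    (mu : {measure set T -> \bar R}) (q V0 A : R) (u V : T -> R) : 0 < V0 -> (forall x, V0 <= V x) ->
  measurable_fun setT u -> (\int[mu]_x (`|u x| `^ q * V x)%:E <= A%:E)%E ->
  (\int[mu]_x (`|u x| `^ q)%:E <= (V0^-1 * A)%:E)%E.
Proof.
move=> V00 VV0 mfu uA; rewrite -(@lee_pmul2l _ V0%:E)// -EFinM mulrA mulfV ?gt_eqF// mul1r.
rewrite -ge0_integralZl_EFin ?(ltW V00)//.
- apply: le_trans uA; apply: ge0_integral_homo => x.
    by rewrite mule_ge0// lee_fin ?powR_ge0// ltW.
  by rewrite -EFinM lee_fin mulrC ler_wpM2l ?powR_ge0.
- exact: measurable_norm_powR.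
Qed.

Lemma ae_eq_integral_norm_powR d (T : measurableType d) (R : realType)
    (mu : {measure set T -> \bar R}) (t : R) (u g : T -> R) :
  measurable_fun setT u -> measurable_fun setT g -> {ae mu, forall x, u x = g x} ->
  (\int[mu]_x (`|u x| `^ t)%:E = \int[mu]_x (`|g x| `^ t)%:E)%E.
Proof.
move=> mfu mg ug; apply: ge0_ae_eq_integral => //.
- exact: measurable_norm_powR.
- exact: measurable_norm_powR.
- by apply: filterS ug => x + _ => ->.
Qed.

Lemma integral_norm_powRB d (T : measurableType d) (R : realType)
    (mu : {measure set T -> \bar R}) (t A B : R) (f g W : T -> R) : 0 <= t ->
  measurable_fun setT f -> measurable_fun setT g -> measurable_fun setT W -> (forall x, 0 <= W x) ->
  (\int[mu]_x (`|f x| `^ t * W x)%:E <= A%:E)%E -> (\int[mu]_x (`|g x| `^ t * W x)%:E <= B%:E)%E ->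
  (\int[mu]_x (`|f x - g x| `^ t * W x)%:E <= (2 `^ t * (A + B))%:E)%E.
Proof.
move=> t0 mf mg mW W0 fA gB.
have pos (h : T -> R) x : (0 <= (`|h x| `^ t * W x)%:E)%E by rewrite lee_fin mulr_ge0 ?powR_ge0.
have m1 := measurable_norm_powRM t mf mW; have m2 := measurable_norm_powRM t mg mW.
have m3 : measurable_fun setT (fun x => (`|f x| `^ t * W x)%:E + (`|g x| `^ t * W x)%:E)%E.
  exact: emeasurable_funD.
apply: (@le_trans _ _ (\int[mu]_x ((2 `^ t)%:E *
    ((`|f x| `^ t * W x)%:E + (`|g x| `^ t * W x)%:E)))%E).
  apply: ge0_integral_homo => x; first by rewrite lee_fin mulr_ge0 ?powR_ge0.
  rewrite -EFinD -EFinM lee_fin -mulrDl mulrA ler_wpM2r// -(normrN (g x)).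
  exact: powR_normD.
rewrite ge0_integralZl_EFin ?powR_ge0//; last by move=> x _; rewrite adde_ge0.
by rewrite ge0_integralD// EFinM lee_wpmul2l ?lee_fin ?powR_ge0// EFinD leeD.
Qed.

(** * Weighted integrals along an almost everywhere convergent sequence *)

Section weighted_convergence.
Context d {T : measurableType d} {R : realType} (mu : {measure set T -> \bar R}).
Variables (K V : T -> R) (q r s beta : R).
Hypotheses (r1 : 1 <= r) (rq : r < q) (qs : q <= s).
Hypotheses (K0 : forall x, 0 < K x) (V0 : forall x, 0 < V x).
Hypotheses (mK : measurable_fun setT K) (mV : measurable_fun setT V).
Hypotheses (beta0 : 0 <= beta) (beta_le : beta <= r / (q - r)).

Let sigma := (s + beta * (s - q)) / (s - r).
Let eta x := K x `^ sigma * V x `^ (- beta).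

Let rs : r < s. Proof. exact: lt_le_trans qs. Qed.
Let r0 : 0 < r. Proof. exact: lt_le_trans r1. Qed.
Let q0 : 0 < q. Proof. exact: lt_trans rq. Qed.
Let s0 : 0 < s. Proof. exact: lt_le_trans qs. Qed.

Let sigma_num : s - r < s + beta * (s - q).
Proof. by rewrite ltrD2l (lt_le_trans (_ : _ < 0)) ?oppr_lt0// mulr_ge0// subr_ge0. Qed.

Let sigma_gt1 : 1 < sigma.
Proof. by rewrite ltr_pdivlMr ?subr_gt0// mul1r. Qed.

Let th_itv : 0 < sigma^-1 < 1.
Proof. by rewrite invr_gt0 (lt_trans _ sigma_gt1)//= invf_lt1// (lt_trans _ sigma_gt1). Qed.

(* [K |y|^r] is the geometric mean of [eta], [|y|^q V] and [|y|^s] with weights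
   [1 / sigma], [beta / sigma] and [1 - (1 + beta) / sigma]; the last one is
   nonnegative because [beta <= r / (q - r)]. *)
Lemma weighted_young t x (y : R) : 0 < t ->
  `|y| `^ r * K x <= t `^ (1 - sigma^-1) * eta x +
    t `^ (- sigma^-1) * (`|y| `^ q * V x + `|y| `^ s).
Proof.
move=> t0; set th := sigma^-1; have /andP[th0 th1] := th_itv; rewrite -/th in th0 th1.
have e0 : 0 <= eta x by rewrite mulr_ge0 ?powR_ge0.
have qV0 : 0 <= `|y| `^ q * V x by rewrite mulr_ge0 ?powR_ge0// ltW.
have M0 : 0 <= `|y| `^ q * V x + `|y| `^ s by rewrite addr_ge0 ?powR_ge0.
apply: le_trans (powR_mul_le_scaled e0 M0 (introT andP (conj th0 th1)) t0).
have [->|yn0] := eqVneq y 0.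
  by rewrite normr0 powR0 ?gt_eqF// mul0r mulr_ge0 ?powR_ge0.
have ny0 : 0 < `|y| by rewrite normr_gt0.
pose g := 1 - th - beta * th.
have qr0 : 0 < q - r by rewrite subr_gt0.
have sr0 : 0 < s - r by rewrite subr_gt0.
have num0 : 0 < s + beta * (s - q) by exact: lt_trans sigma_num.
have thE : th = (s - r) / (s + beta * (s - q)) by rewrite /th /sigma invf_div.
have bth0 : 0 <= beta * th by rewrite mulr_ge0// ltW.
have g0 : 0 <= g.
  (* In this form the sign of g is that of r - beta (q - r). *)
  have -> : g = (r - beta * (q - r)) / (s + beta * (s - q)).
    by rewrite /g thE; field; rewrite gt_eqF.
  by rewrite divr_ge0 ?(ltW num0)// subr_ge0 -ler_pdivlMr.
have gE : beta * th + g = 1 - th by rewrite /g; ring.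
have gr : q * (beta * th) + s * g = r.
  by rewrite /g thE; field; rewrite gt_eqF.
(* In fact an equality: sigma th = 1 leaves K to the power 1, the powers of V cancel, and those of
   |y| add up to r. The last two factors are then merged into the power 1 - th of their sum. *)
apply: (@le_trans _ _ (eta x `^ th * ((`|y| `^ q * V x) `^ (beta * th) * (`|y| `^ s) `^ g))).
  rewrite /eta !powRM ?powR_ge0 ?(ltW (V0 _))// -!powRrM.
  rewrite (_ : sigma * th = 1); last by rewrite /th divff// gt_eqF// (lt_trans _ sigma_gt1).
  rewrite powRr1 ?(ltW (K0 _))//.
  have -> : K x * V x `^ (- beta * th) * (`|y| `^ (q * (beta * th)) * V x `^ (beta * th) * `|y| `^ (s * g)) =
     K x * (V x `^ (- beta * th) * V x `^ (beta * th)) * (`|y| `^ (q * (beta * th)) * `|y| `^ (s * g)) by ring.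
  rewrite -!powRD ?(gt_eqF ny0) ?(gt_eqF (V0 _)) ?implybT// gr mulNr addNr powRr0.
  by rewrite mulr1 mulrC.
rewrite ler_wpM2l ?powR_ge0// -gE ler_powR_mulD ?powR_ge0//.
by rewrite gE subr_gt0.
Qed.

Let meta : measurable_fun setT eta.
Proof. by apply: measurable_funM; exact: (measurableT_comp (measurable_powR _)). Qed.

Let eta0 x : 0 <= eta x. Proof. by rewrite mulr_ge0 ?powR_ge0. Qed.

Lemma weighted_integral_le (w : T -> R) E A B : measurable_fun setT w ->
  (\int[mu]_x (eta x)%:E <= E%:E)%E ->
  (\int[mu]_x (`|w x| `^ q * V x)%:E <= A%:E)%E -> (\int[mu]_x (`|w x| `^ s)%:E <= B%:E)%E ->
  (\int[mu]_x (`|w x| `^ r * K x)%:E <= (E + (A + B))%:E)%E.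
Proof.
move=> mw iE iA iB.
have f0 x : (0 <= (`|w x| `^ q * V x)%:E)%E by rewrite lee_fin mulr_ge0 ?powR_ge0// ltW.
have m2 := measurable_norm_powRM q mw mV.
have m3 := measurable_norm_powR s mw.
have m1 : measurable_fun setT (fun x => (eta x)%:E) by exact/measurable_EFinP.
apply: (@le_trans _ _ (\int[mu]_x ((eta x)%:E + ((`|w x| `^ q * V x)%:E + (`|w x| `^ s)%:E)))%E).
  apply: ge0_le_integral => //.
  - by move=> x _; rewrite lee_fin mulr_ge0 ?powR_ge0// ltW.
  - exact: measurable_norm_powRM.
  - by apply: emeasurable_funD => //; exact: emeasurable_funD.
  move=> x _; rewrite -!EFinD lee_fin.
  by have := weighted_young x (w x) ltr01; rewrite !powR1 !mul1r.
have e0 x : setT x -> (0 <= (eta x)%:E)%E by rewrite lee_fin.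
rewrite ge0_integralD//; [|by move=> x _; rewrite adde_ge0|exact: emeasurable_funD].
rewrite ge0_integralD//.
by rewrite !EFinD leeD// leeD.
Qed.

(** Fatou, applied after exchanging f for the lower limit of the sequence, which is defined
    everywhere and equals f almost everywhere. *)
Lemma ae_cvg_integral_le (f_ : nat -> T -> R) (f : T -> R) A :
  (forall k, measurable_fun setT (f_ k)) -> (forall k x, 0 <= f_ k x) ->
  measurable_fun setT f -> (forall x, 0 <= f x) ->
  {ae mu, forall x, f_ k x @[k --> \oo] --> f x} ->
  (forall k, \int[mu]_x (f_ k x)%:E <= A%:E)%E -> (\int[mu]_x (f x)%:E <= A%:E)%E.
Proof.
move=> mf_ f_0 mf f0 ff fA.
have mf_' k : measurable_fun setT (fun x => (f_ k x)%:E) by exact/measurable_EFinP.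
have f_0' k x : setT x -> (0 <= (f_ k x)%:E)%E by rewrite lee_fin.
rewrite (@ge0_ae_eq_integral _ _ _ mu setT _ (fun x => limn_einf (fun k => (f_ k x)%:E)))//.
- apply: le_trans (fatou mu measurableT mf_' f_0') _.
  rewrite limn_einf_lim; apply: lime_le; first exact: is_cvg_einfs.
  apply: nearW => k; apply: le_trans (fA k); apply: ereal_inf_lbound.
  by exists k => //=.
- exact/measurable_EFinP.
- rewrite (_ : (fun x => _) = fun x => - limn_esup (-%E \o (fun k => (f_ k x)%:E)))%E.
    by apply: measurableT_comp => //; apply: measurable_fun_limn_esup => k; exact: measurableT_comp.
  by apply/funext => x; rewrite limn_esupN oppeK.
- by move=> x _; rewrite lee_fin.
- move=> x _; rewrite limn_einf_lim; apply: lime_ge; first exact: is_cvg_einfs.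
  by apply: nearW => k; apply: le_ereal_inf_tmp => _ [l _ <-]; rewrite lee_fin.
- apply: filterS ff => x fx _; apply/esym.
  have /cvg_limn_einf_sup[-> _] : (f_ k x)%:E @[k --> \oo] --> (f x)%:E; last by [].
  by apply: cvg_EFin => //; apply: nearW.
Qed.

Lemma weighted_cvg0 (w : nat -> T -> R) A B : (\int[mu]_x (eta x)%:E < +oo)%E ->
  (forall k, measurable_fun setT (w k)) ->
  {ae mu, forall x, w k x @[k --> \oo] --> 0} ->
  (forall k, (\int[mu]_x (`|w k x| `^ q * V x)%:E <= A%:E)%E) ->
  (forall k, (\int[mu]_x (`|w k x| `^ s)%:E <= B%:E)%E) ->
  (\int[mu]_x (`|w k x| `^ r * K x)%:E)%E @[k --> \oo] --> 0%E.
Proof.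
move=> iE mw w0 wA wB; have /andP[th0 th1] := th_itv.
have wK0 k x : 0 <= `|w k x| `^ r * K x by rewrite mulr_ge0 ?powR_ge0// ltW.
apply: near_le_cvge0 => [k|e e0]; first by apply: integral_ge0 => x _; rewrite lee_fin.
have A0 : 0 <= A.
  rewrite -lee_fin; apply: le_trans (wA 0%N); apply: integral_ge0 => x _.
  by rewrite lee_fin mulr_ge0 ?powR_ge0// ltW.
have B0 : 0 <= B.
  by rewrite -lee_fin; apply: le_trans (wB 0%N); apply: integral_ge0 => x _; rewrite lee_fin powR_ge0.
have AB0 : 0 < A + B + 1 by rewrite ltr_wpDl// addr_ge0.
(* The choice gives t^(-1/sigma) = 1/y = e / (2 (A + B + 1)), so the second term of [weighted_young]
   integrates to at most e/2 for every k. *)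
pose y := 2 * (A + B + 1) / e; have y0 : 0 < y by rewrite divr_gt0// mulr_gt0.
pose t := y `^ sigma; have t0 : 0 < t by rewrite powR_gt0.
have tE : t `^ (- sigma^-1) = y^-1.
  by rewrite powRN /t -powRrM divff ?gt_eqF ?(lt_trans _ sigma_gt1)// powRr1// ltW.
pose c := t `^ (1 - sigma^-1); have c0 : 0 <= c by exact: powR_ge0.
pose f k x := Num.min (`|w k x| `^ r * K x) (c * eta x).
have mwK k : measurable_fun setT (fun x => `|w k x| `^ r * K x) by apply/measurable_EFinP; exact: measurable_norm_powRM.
have mf k : measurable_fun setT (f k) by apply: measurable_minr => //; exact: measurable_funM.
have f0 k x : 0 <= f k x by rewrite le_min wK0 mulr_ge0 ?eta0.
have mf' k : measurable_fun setT (fun x => (f k x)%:E) by exact/measurable_EFinP.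
have eE0 x : setT x -> (0 <= (eta x)%:E)%E by rewrite lee_fin.
have ieta : mu.-integrable setT (fun x => (c * eta x)%:E).
  apply/integrableP; split; first by apply/measurable_EFinP; exact: measurable_funM.
  have -> : (\int[mu]_x `|(c * eta x)%:E| = \int[mu]_x (c%:E * (eta x)%:E))%E.
    by apply: eq_integral => x _; rewrite -EFinM gee0_abs// lee_fin mulr_ge0.
  rewrite ge0_integralZl_EFin//; last exact/measurable_EFinP.
  by rewrite lte_mul_pinfty.
have [|||_ + _] := @dominated_convergence _ T R mu setT measurableT (fun k x => (f k x)%:E)
  (cst 0%E) (fun x => (c * eta x)%:E) mf' _ _ ieta _.
- exact: measurable_cst.
- apply: filterS w0 => x wx _.
  have : `|w k x| `^ r * K x @[k --> \oo] --> `|0 : R| `^ r * K x.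
    by apply: cvgMr_tmp; exact: cvg_norm_powR.
  rewrite normr0 powR0 ?gt_eqF// mul0r => wx0.
  suff fx0 : f k x @[k --> \oo] --> (0 : R) by apply: cvg_EFin => //; exact: nearW.
  apply: (squeeze_cvgr _ (@cvg_cst _ (0 : R) _ _ _) wx0).
  by apply: nearW => k; rewrite f0/= ge_min lexx.
- by apply: aeW => x k _; rewrite gee0_abs ?lee_fin ?f0// ge_min lexx orbT.
move=> /cvge0_near_le/(_ (divr_gt0 e0 (ltr0Sn _ 1)))[k0 Hk0].
exists k0 => k kk0; have := Hk0 k kk0; under eq_integral do rewrite sube0 gee0_abs ?lee_fin//.
move=> fk.
have m2 := measurable_norm_powRM q (mw k) mV.
have m3 := measurable_norm_powR s (mw k).
have g0 x : (0 <= (`|w k x| `^ q * V x)%:E)%E by rewrite lee_fin mulr_ge0 ?powR_ge0// ltW.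
have h0 x : (0 <= (`|w k x| `^ q * V x)%:E + (`|w k x| `^ s)%:E)%E by rewrite adde_ge0.
have mh : measurable_fun setT (fun x => (`|w k x| `^ q * V x)%:E + (`|w k x| `^ s)%:E)%E by exact: emeasurable_funD.
have y10 : 0 <= y^-1 by rewrite invr_ge0 ltW.
apply: (@le_trans _ _ (\int[mu]_x ((f k x)%:E +
    (y^-1)%:E * ((`|w k x| `^ q * V x)%:E + (`|w k x| `^ s)%:E)))%E).
  apply: ge0_le_integral => //.
  - by move=> x _; rewrite lee_fin.
  - by apply/measurable_EFinP.
  - by apply: emeasurable_funD => //; exact: measurable_funeM.
  (* Either the minimum defining [f] is the left side itself, or it is c eta and [weighted_young]
     applies. *)
  move=> x _; suff: `|w k x| `^ r * K x <= f k x + y^-1 * (`|w k x| `^ q * V x + `|w k x| `^ s) by [].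
  rewrite -tE.
  rewrite /f; case: (leP (`|w k x| `^ r * K x) (c * eta x)) => _; last exact: weighted_young.
  by rewrite lerDl mulr_ge0 ?powR_ge0// addr_ge0 ?powR_ge0// mulr_ge0 ?powR_ge0// ltW.
rewrite ge0_integralD//; [|by move=> x _; rewrite lee_fin|by move=> x _; rewrite mule_ge0|exact: measurable_funeM].
rewrite ge0_integralZl_EFin// ge0_integralD//.
apply: (@le_trans _ _ ((e / 2)%:E + (y^-1)%:E * (A%:E + B%:E))%E).
  by apply: leeD => //; apply: lee_wpmul2l; rewrite ?lee_fin//; apply: leeD.
rewrite -EFinD -EFinM -EFinD lee_fin [leRHS]splitr lerD2l /y invf_div.
rewrite mulrAC ler_pdivrMr ?mulr_gt0//.
have -> : e / 2 * (2 * (A + B + 1)) = e * (A + B) + e by field.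
by rewrite lerDl ltW.
Qed.

End weighted_convergence.

Section poweR.
Context {R : realType}.
Implicit Types (I : \bar R) (p m : R).

Lemma poweR_inv_le I p m : 0 < p -> (0 <= I)%E -> 0 <= m ->
  (I `^ p^-1 <= m%:E)%E -> (I <= (m `^ p)%:E)%E.
Proof.
move=> p0 I0 m0 Im; have -> : I = ((I `^ p^-1) `^ p)%E.
  by rewrite -poweRrM mulVf ?gt_eqF// poweRe1.
by rewrite -poweR_EFin gt0_ler_poweR ?(ltW p0)// in_itv/= ?poweR_ge0 ?lee_fin ?m0 leey.
Qed.

Lemma le_poweR_inv I p m : 0 < p -> (0 <= I)%E -> 0 <= m ->
  (I <= (m `^ p)%:E)%E -> (I `^ p^-1 <= m%:E)%E.
Proof.
move=> p0 I0 m0 Im; have -> : m%:E = ((m `^ p)%:E `^ p^-1)%E.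
  by rewrite poweR_EFin -powRrM mulfV ?gt_eqF// powRr1.
by rewrite gt0_ler_poweR// ?in_itv/= ?leey ?I0 ?lee_fin ?powR_ge0// invr_ge0 ltW.
Qed.

End poweR.

(** * From [Mspace] to normalised Borel functions *)

Section Mspace_theory.
Context {R : realType} {N : nat}.
Local Notation Rn := 'rV[R]_N.
Local Notation L := (lebesgue_rVType R N).
Local Notation mu := (@lebesgue_rV R N).
Local Notation lam := (@borel_lebesgue R N).
Implicit Types (u w v g W : Rn -> R).

Lemma lebesgue_measurable_borel u : measurable_fun [set: Rn] u -> lebesgue_measurable u.
Proof. by move=> mu_; exact: (measurableT_comp mu_ measurable_completion). Qed.

Lemma Lnorm_le_integral u p m : 0 < p -> 0 <= m -> ('N[mu]_p%:E[EFin \o u] <= m%:E)%E ->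
  (\int[mu]_x (`|u x| `^ p)%:E <= (m `^ p)%:E)%E.
Proof.
move=> p0 m0; rewrite unlock => um; apply: poweR_inv_le => //.
by apply: integral_ge0 => x _; rewrite lee_fin powR_ge0.
Qed.

Lemma cube_sub_box n : cube n%:R `<=` [set v : Rn | forall i : 'I_N, v ord0 i \in `[- n%:R, n%:R]].
Proof. by move=> v + i => /(_ i)/andP[? ?]; rewrite in_itv/= !ltW. Qed.

Lemma Lp_loc_borel_version g : Lp_loc 1%E g ->
  exists2 g', loc_integrable g' & {ae mu, forall x, g x = g' x}.
Proof.
move=> [mg gC]; have [g' mg' gg'] := measurable_borel_version mg.
exists g' => //; split=> // n; apply/integrableP; split.
  exact/measurable_EFinP/measurable_funTS.
apply: le_lt_trans (gC _ (@compact_box R N (fun=> - n%:R) (fun=> n%:R))).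
rewrite Lnorm1.
have mcube : measurable (cube n%:R : set Rn) by exact: measurable_cube.
pose W : Rn -> R := \1_(cube n%:R : set Rn).
have W0 x : 0 <= W x by [].
have mW : measurable_fun [set: Rn] W by exact: measurable_indic.
apply: (@le_trans _ _ (\int[mu]_x (`|g' x| `^ 1 * W x)%:E)%E).
  rewrite -ge0_integral_completion.
  - rewrite integral_mkcond le_eqVlt; apply/orP; left; apply/eqP.
    apply: eq_integral => x _; rewrite patchE /W indicE powRr1//.
    by case: (x \in _); rewrite ?mulr1 ?mulr0.
  - exact: measurable_norm_powRM.
  - by move=> x; rewrite lee_fin mulr_ge0 ?powR_ge0.
rewrite -(ae_eq_integral_norm_powRM 1 mg (lebesgue_measurable_borel mg') (lebesgue_measurable_borel mW) W0 gg').
apply: ge0_integral_homo => x; first by rewrite lee_fin mulr_ge0 ?powR_ge0.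
rewrite /W /= indicE patchE lee_fin powRr1//.
case: ifPn => [_|/negP xB]; first by case: (x \in cube _); rewrite ?mulr1// mulr0.
rewrite memNset ?mulr0// => xc; apply: xB; apply/mem_set; exact: cube_sub_box.
Qed.

Lemma compact_sub_cube (C : set Rn) : compact C -> exists n, C `<=` cube n%:R.
Proof.
move=> cC; have [M [Mr CM]] := compact_bounded cC.
exists (Num.truncn (M + 1)).+1 => v Cv i; rewrite -ltr_norml.
apply: le_lt_trans (truncnS_gt _); apply: le_trans (CM (M + 1) _ v Cv); last by rewrite ltrDl.
rewrite [leRHS]mx_normrE; exact: (le_bigmax _ (fun j => `|v j.1 j.2|) (ord0, i)).
Qed.

Lemma Lp_loc1_powR u q A : 1 <= q -> lebesgue_measurable u ->
  (\int[mu]_x (`|u x| `^ q)%:E <= A%:E)%E -> Lp_loc 1%E u.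
Proof.
move=> q1 mu_ uA; split=> // C /compact_sub_cube[n Cn]; rewrite Lnorm1.
have mI : measurable_fun [set: L] (\1_(cube n%:R : set Rn) : L -> R).
  by apply: lebesgue_measurable_borel; apply: measurable_indic; exact: measurable_cube.
have mI' : measurable_fun [set: L] (fun x => (\1_(cube n%:R : set Rn) x : R)%:E) by exact/measurable_EFinP.
have mp : measurable_fun [set: L] (fun x => (`|u x| `^ q)%:E) by exact: measurable_norm_powR.
apply: (@le_lt_trans _ _ (\int[mu]_x ((\1_(cube n%:R : set Rn) x)%:E + (`|u x| `^ q)%:E))%E).
  apply: ge0_integral_homo => x; first by rewrite lee_fin.
  rewrite /= -EFinD lee_fin patchE indicE; case: ifPn => [/set_mem xC|_].
    by rewrite mem_set ?norm_le_powR//; exact: Cn.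
  by rewrite normr0 addr_ge0// powR_ge0.
rewrite ge0_integralD//; apply: lte_add_pinfty; last by apply: le_lt_trans uA _; exact: ltry.
rewrite -(@ge0_integral_completion R N (fun x => (\1_(cube n%:R : set Rn) x)%:E)).
- rewrite integral_indic ?setIT//; last exact: measurable_cube.
  exact: borel_lebesgue_obox_lty.
- by apply/measurable_EFinP; apply: measurable_indic; exact: measurable_cube.
- by move=> x; rewrite lee_fin.
Qed.

Lemma measurable_partial_prod_fun (s : 'I_N -> R -> R) i : (forall j, smooth1 (s j)) ->
  measurable_fun [set: Rn] (partial i (prod_fun s)).
Proof.
move=> ss; have [d td d0] := ss i.
have di x : is_derive x (1 : R) (s i) (d 1%N x) by rewrite -d0.
rewrite (partial_prod_fun di); apply: measurable_prod_fun => j.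
rewrite /repl_fun; case: ifP => _; last exact: smooth1_continuous.
apply: smooth1_continuous; exists (fun k => d k.+1) => //; move=> k; exact: td.
Qed.

(** Both sides of the integration by parts formula keep their values when the functions change on a
    null set and the measure is restricted to Borel sets. *)
Lemma weak_gradient_has_weak_derivative u u' (G : Rn -> Rn) (g : 'I_N -> Rn -> R) i :
  lebesgue_measurable u -> measurable_fun [set: Rn] u' -> {ae mu, forall x, u x = u' x} ->
  is_weak_gradient u G -> measurable_fun [set: Rn] (g i) ->
  {ae mu, forall x, G x ord0 i = g i x} -> has_weak_derivative u' (g i) i.
Proof.
move=> mu_ mu' uu' [GL GP] mg Gg s a b ss sab.
have phiT := test_function_prod_fun ss sab.
have mp := measurable_partial_prod_fun i ss.
have mphi : measurable_fun [set: Rn] (prod_fun s).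
  by apply: measurable_prod_fun => j; exact: smooth1_continuous.
have aux (f : L -> R) (f' h : Rn -> R) : lebesgue_measurable f -> measurable_fun [set: Rn] f' ->
    measurable_fun [set: Rn] h -> {ae mu, forall x, f x = f' x} ->
    (\int[lam]_x (f' x * h x)%:E = \int[mu]_x (f x * h x)%:E)%E.
  move=> mf mf' mh ff'; have mLh := lebesgue_measurable_borel mh.
  have mLf' := lebesgue_measurable_borel mf'.
  rewrite integral_completion; last by apply/measurable_EFinP; exact: measurable_funM.
  apply: (@ae_eq_integral _ L R mu setT _ _ measurableT).
  - by apply/measurable_EFinP; exact: (measurable_funM mLf' mLh).
  - by apply/measurable_EFinP; exact: (measurable_funM mf mLh).
  - by apply: filterS ff' => x fx _; rewrite fx.
rewrite (aux u)// (aux (fun x => G x ord0 i) (g i) _ (GL i).1)//.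
exact: GP.
Qed.

Lemma coord_le_euclidean_norm (v : Rn) i : `|v ord0 i| <= euclidean_norm v.
Proof.
rewrite -sqrtr_sqr ler_wsqrtr// (bigD1 i)//= lerDl.
by apply: sumr_ge0 => j _; exact: sqr_ge0.
Qed.

Lemma shift_boundZ p S u c : 0 <= c -> measurable_fun [set: Rn] u ->
  shift_bound p S u -> shift_bound p (c `^ p * S) (fun x => c * u x).
Proof.
move=> c0 mu_ uS h y h0 yh.
have md : measurable_fun [set: Rn] (fun x => u (x + y) - u x).
  by apply: measurable_funB => //; apply: (measurableT_comp mu_); exact: measurable_translation.
have := @integral_norm_powRZ _ Rn R lam p c _ (cst 1) md (measurable_cst _) (fun=> ler01) c0.
under eq_integral do rewrite mulr1 mulrBr.
under [in RHS]eq_integral do rewrite mulr1.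
by move=> ->; rewrite mulrCA EFinM lee_wpmul2l ?lee_fin ?powR_ge0//; exact: uS.
Qed.

(** Dividing by m makes every bound independent of u and m. Taking m as any positive upper bound of
    the norm includes functions of norm 0. *)
Lemma Mspace_borel_version p q V V0 : 1 < p -> 1 <= q -> 0 < V0 -> (forall x, V0 <= V x) ->
  lebesgue_measurable V -> exists2 C, 0 <= C & forall u m, 0 < m -> Mspace q p V u ->
    (Mnorm q p V u <= m%:E)%E ->
    exists w, [/\ measurable_fun [set: Rn] w, {ae mu, forall x, u x = m * w x},
      (\int[lam]_x (`|w x| `^ q)%:E <= V0^-1%:E)%E, (\int[mu]_x (`|w x| `^ q * V x)%:E <= 1)%E &
      shift_bound p C w].
Proof.
move=> p1 q1 V00 VV0 mV; have [C C0 HC] := @shift_bound_weak_derivative R N p p1.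
exists C => // u m m0 [[mu_ _] _ [G0 hG0] [mE _]] um.
have p0 : 0 < p by exact: lt_trans p1.
have q0 : 0 < q by exact: lt_le_trans q1.
have V0' x : 0 <= V x by apply: le_trans (VV0 x); exact: ltW.
pose G := weak_gradient u.
have hG : is_weak_gradient u G by exact: (@xgetPex _ _ (is_weak_gradient u) (ex_intro _ G0 hG0)).
have um1 : (weighted_norm q V u <= m%:E)%E by apply: le_trans um; rewrite leeDl// Lnorm_ge0.
have um2 : ('N[mu]_p%:E[EFin \o (@euclidean_norm R N \o G)] <= m%:E)%E.
  by apply: le_trans um; rewrite leeDr// poweR_ge0.
have uV : (\int[mu]_x (`|u x| `^ q * V x)%:E <= (m `^ q)%:E)%E.
  apply: poweR_inv_le (ltW m0) um1 => //.
  by apply: integral_ge0 => x _; rewrite lee_fin mulr_ge0 ?powR_ge0.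
have uE := Lnorm_le_integral p0 (ltW m0) um2.
have [u' mu' uu'] := measurable_borel_version mu_.
have /choice[g hg] i : exists g', loc_integrable g' /\ {ae mu, forall x, G x ord0 i = g' x}.
  by have [g' ? ?] := Lp_loc_borel_version (hG.1 i); exists g'.
have mLu' := lebesgue_measurable_borel mu'.
have u'V : (\int[mu]_x (`|u' x| `^ q * V x)%:E <= (m `^ q)%:E)%E.
  by rewrite -(ae_eq_integral_norm_powRM q mu_ mLu' mV V0' uu').
have u'q : (\int[lam]_x (`|u' x| `^ q)%:E <= (V0^-1 * m `^ q)%:E)%E.
  rewrite integral_completion; last exact: measurable_norm_powR.
  exact: integral_weight_ge mLu' u'V.
have gp i : (\int[lam]_x (`|g i x| `^ p)%:E <= (m `^ p)%:E)%E.
  have [[mg _] Gg] := hg i; have mLg := lebesgue_measurable_borel mg.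
  rewrite integral_completion; last exact: measurable_norm_powR.
  rewrite -(ae_eq_integral_norm_powR p (hG.1 i).1 mLg Gg); apply: le_trans uE.
  apply: ge0_integral_homo => x; first by rewrite lee_fin powR_ge0.
  rewrite lee_fin ge0_ler_powR ?nnegrE ?normr_ge0 ?(ltW p0)//= [leRHS]ger0_norm ?sqrtr_ge0//.
  exact: coord_le_euclidean_norm.
have u'S : shift_bound p (C * m `^ p) u'.
  apply: (HC u' g).
  - exact: loc_integrable_powR mu' u'q.
  - by move=> i; have [] := hg i.
  - move=> i; have [[mg _] Gg] := hg i.
    exact: weak_gradient_has_weak_derivative mu_ mu' uu' hG mg Gg.
  - exact: gp.
have mi0 : 0 <= m^-1 by rewrite invr_ge0 ltW.
have mpow t : m^-1 `^ t * m `^ t = 1.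
  by rewrite -powRM ?(ltW m0)// mulVf ?gt_eqF// powR1.
have mw : measurable_fun [set: Rn] (fun x => m^-1 * u' x) by exact: measurable_funM.
have wV : (\int[mu]_x (`|m^-1 * u' x| `^ q * V x)%:E <= 1%:E)%E.
  rewrite (@integral_norm_powRZ _ L R mu q m^-1 u' V)//.
  by rewrite -(mpow q) EFinM lee_wpmul2l// lee_fin powR_ge0.
exists (fun x => m^-1 * u' x); split => //.
- by apply: filterS uu' => x ->; rewrite mulrA mulfV ?gt_eqF// mul1r.
- rewrite integral_completion; last exact: measurable_norm_powR.
  by rewrite -[leRHS]mule1 -EFinM; exact: integral_weight_ge (lebesgue_measurable_borel mw) wV.
- by have := shift_boundZ mi0 mu' u'S; rewrite mulrCA mpow mulr1.
Qed.

End Mspace_theory.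

(** * Embedding and compactness by scaling normalised functions *)

Theorem theorem2p6 (R : realType) (N : nat) (p q r : R)
    (K V : 'rV[R]_N -> R) (alpha : \bar R) (V0 beta s : R)
    (N_ge2 : (2 <= N)%N) (p_geN : N%:R <= p)
    (r_ge1 : 1 <= r) (r_ltq : r < q)
    (K_gt0 : forall x, 0 < K x) (V_gt0 : forall x, 0 < V x)
    (mK : lebesgue_measurable K) (mV : lebesgue_measurable V)
    (alpha_gt1 : (1 < alpha)%E) (K_loc : Lp_loc alpha K)
    (V0_gt0 : 0 < V0) (infV : V0 <= inf (range V))
    (beta_ge0 : 0 <= beta) (beta_le : beta <= r / (q - r)) (s_geq : q <= s)
    (KV_L1 : Lp_space 1%E (fun x =>
       K x `^ ((s + beta * (s - q)) / (s - r)) * V x `^ (- beta))) :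
  compact_embedding (Mspace q p V) (Mnorm q p V)
    (weighted_Lp r K) (weighted_norm r K).
Proof.
have aeS (P Q : 'rV[R]_N -> Prop) : (forall x, P x -> Q x) ->
    {ae lebesgue_rV N, forall x, P x} -> {ae lebesgue_rV N, forall x, Q x}.
  by move=> PQ; apply: (@filterS _ (almost_everywhere (lebesgue_rV N : {measure set (lebesgue_rVType R N) -> \bar R}))).
have V0V x : V0 <= V x.
  apply: le_trans infV _; apply: ge_inf; last by exists x.
  by exists 0 => _ [y _ <-]; exact: ltW.
have q1 : 1 <= q by exact: le_trans (ltW r_ltq).
have p1 : 1 < p by apply: lt_le_trans p_geN; rewrite ltr1n.
have p1' := ltW p1.
have r0 : 0 < r by exact: lt_le_trans r_ge1.
have q0 : 0 < q by exact: lt_trans r_ltq.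
have s0 : 0 < s by exact: lt_le_trans s_geq.
have K0 x : 0 <= K x by exact: ltW.
have V0' x : 0 <= V x by exact: ltW.
have [C C0 HC] := Mspace_borel_version p1 q1 V0_gt0 V0V mV.
have iV0 : 0 < V0^-1 by rewrite invr_gt0.
have [C1 HC1] := higher_integrability N_ge2 p_geN q1 s_geq iV0 C0.
(* [higher_integrability] gives no sign for its constant; the absolute value makes [D]
   nonnegative. *)
pose Cs : R := `|C1|.
pose eta x := K x `^ ((s + beta * (s - q)) / (s - r)) * V x `^ (- beta).
have eta0 x : 0 <= eta x by rewrite mulr_ge0 ?powR_ge0.
have eta_lty : (\int[lebesgue_rV N]_x (eta x)%:E < +oo)%E.
  have [_] := KV_L1; rewrite Lnorm1; apply: le_lt_trans.
  apply: ge0_integral_homo => x; first by rewrite lee_fin.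
  by rewrite lee_fin ler_norm.
have eta_ge0 : (0 <= \int[lebesgue_rV N]_x (eta x)%:E)%E.
  by apply: integral_ge0 => x _; rewrite lee_fin.
have : (\int[lebesgue_rV N]_x (eta x)%:E)%E \is a fin_num by rewrite ge0_fin_numE.
move=> /EFin_fin_numP[E etaE].
have E0 : 0 <= E by rewrite -lee_fin -etaE.
pose D := E + (1 + Cs).
have D0 : 0 <= D by rewrite addr_ge0// addr_ge0// normr_ge0.
have higher (w : 'rV[R]_N -> R) : measurable_fun [set: 'rV[R]_N] w ->
    (\int[borel_lebesgue N]_x (`|w x| `^ q)%:E <= V0^-1%:E)%E -> shift_bound p C w ->
    (\int[lebesgue_rV N]_x (`|w x| `^ s)%:E <= Cs%:E)%E.
  move=> mw wq wS; rewrite -integral_completion; last exact: measurable_norm_powR.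
  by apply: le_trans (HC1 w mw wS wq) _; rewrite lee_fin ler_norm.
have weighted (u w : 'rV[R]_N -> R) m : 0 < m -> lebesgue_measurable u -> lebesgue_measurable w ->
    {ae lebesgue_rV N, forall x, u x = m * w x} ->
    (\int[lebesgue_rV N]_x (`|w x| `^ q * V x)%:E <= 1)%E ->
    (\int[lebesgue_rV N]_x (`|w x| `^ s)%:E <= Cs%:E)%E ->
    weighted_Lp r K u /\ (weighted_int r K u <= (m `^ r * D)%:E)%E.
  move=> m0 mfu mw uw wV ws; have m0' := ltW m0.
  have mmw : lebesgue_measurable (fun x => m * w x) by exact: measurable_funM.
  have uK : (weighted_int r K u <= (m `^ r * D)%:E)%E.
    rewrite /weighted_int (ae_eq_integral_norm_powRM r mfu mmw mK K0 uw).
    rewrite (integral_norm_powRZ _ r mw mK K0 m0') EFinM lee_wpmul2l ?lee_fin ?powR_ge0//.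
    apply: (@weighted_integral_le _ (lebesgue_rVType R N) R (lebesgue_rV N) K V q r s beta r_ge1 r_ltq s_geq K_gt0 V_gt0 mK mV
      beta_ge0 beta_le w E 1 Cs mw) => //.
    by rewrite etaE.
  split=> //; split; last by apply: le_lt_trans uK _; exact: ltry.
  apply: (@Lp_loc1_powR R N u q (V0^-1 * m `^ q) q1 mfu).
  apply: (@integral_weight_ge _ (lebesgue_rVType R N) R (lebesgue_rV N) q V0 _ u V V0_gt0 V0V mfu).
  rewrite (ae_eq_integral_norm_powRM q mfu mmw mV V0' uw).
  rewrite (integral_norm_powRZ _ q mw mV V0' m0').
  by rewrite -[leRHS]mule1 lee_wpmul2l ?lee_fin ?powR_ge0.
have weighted_int_ge0 u : (0 <= weighted_int r K u)%E.
  by apply: integral_ge0 => x _; rewrite lee_fin mulr_ge0 ?powR_ge0.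
have embed u m : 0 < m -> Mspace q p V u -> (Mnorm q p V u <= m%:E)%E ->
    weighted_Lp r K u /\ (weighted_norm r K u <= (D `^ r^-1 * m)%:E)%E.
  move=> m0 Mu um; have [w [mw uw wq wV wS]] := HC u m m0 Mu um.
  have [[mfu _] _ _ _] := Mu.
  have [uY uD] := weighted u w m m0 mfu (lebesgue_measurable_borel mw) uw wV (higher w mw wq wS).
  split=> //; apply: le_poweR_inv => //; first by rewrite mulr_ge0 ?powR_ge0// ltW.
  rewrite powRM ?powR_ge0 ?(ltW m0)// -powRrM mulVf ?gt_eqF// powRr1//.
  by rewrite mulrC.
have Mfin u : Mspace q p V u -> exists2 M, 0 <= M & Mnorm q p V u = M%:E.
  move=> [_ uV _ [_ uG]]; have n0 : (0 <= Mnorm q p V u)%E by rewrite adde_ge0 ?poweR_ge0// Lnorm_ge0.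
  have : Mnorm q p V u \is a fin_num.
    by rewrite ge0_fin_numE// /Mnorm lte_add_pinfty// poweR_lty.
  by move=> /EFin_fin_numP[M ME]; exists M => //; rewrite -lee_fin -ME.
split.
- move=> u Mu; have [M M0 ME] := Mfin u Mu.
  have M1 : 0 < M + 1 by rewrite ltr_wpDl.
  have uM1 : (Mnorm q p V u <= (M + 1)%:E)%E by rewrite ME lee_fin lerDl.
  by have [] := embed u (M + 1) M1 Mu uM1.
- exists (D `^ r^-1) => u Mu; have [M M0 ME] := Mfin u Mu; rewrite ME.
  apply/lee_addgt0Pr => e e0.
  (* [embed] asks for a positive bound, so the norm M, possibly 0, is raised by d, small enough that
     D^(1/r) d <= e. *)
  pose d := e / (D `^ r^-1 + 1).
  have d1 : 0 < D `^ r^-1 + 1 by rewrite ltr_wpDl ?powR_ge0.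
  have d0 : 0 < d by rewrite divr_gt0.
  have Md : 0 < M + d by rewrite ltr_wpDl.
  have uMd : (Mnorm q p V u <= (M + d)%:E)%E by rewrite ME lee_fin lerDl ltW.
  have [_] := embed u (M + d) Md Mu uMd; move/le_trans; apply.
  rewrite -EFinM -EFinD lee_fin mulrDr lerD2l /d mulrCA ger_pMr//.
  by rewrite ler_pdivrMr// mul1r lerDl.
move=> u_ Mu [B uB]; pose m := `|B| + 1.
have m0 : 0 < m by rewrite ltr_wpDl.
have um k : (Mnorm q p V (u_ k) <= m%:E)%E.
  by apply: le_trans (uB k) _; rewrite lee_fin (le_trans (ler_norm B))// lerDl.
have /choice[w hw] k := HC (u_ k) m m0 (Mu k) (um k).
have mw k : measurable_fun [set: 'rV[R]_N] (w k) by have [] := hw k.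
have uw k : {ae lebesgue_rV N, forall x, u_ k x = m * w k x} by have [] := hw k.
have wq k : (\int[borel_lebesgue N]_x (`|w k x| `^ q)%:E <= V0^-1%:E)%E by have [] := hw k.
have wV k : (\int[lebesgue_rV N]_x (`|w k x| `^ q * V x)%:E <= 1)%E by have [] := hw k.
have wS k : shift_bound p C (w k) by have [] := hw k.
have ws k := higher (w k) (mw k) (wq k) (wS k).
have [phi [v [hphi mv /ae_completion wv]]] := shift_bound_ae_cvg_subsequence p1' q1 C0 mw wq wS.
have mLv := lebesgue_measurable_borel mv.
have mLw k := lebesgue_measurable_borel (mw (phi k)).
have mpV f (mf : lebesgue_measurable f) :=
  @measurable_norm_powRM _ (lebesgue_rVType R N) R q f V mf mV.
have mps f (mf : lebesgue_measurable f) :=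
  @measurable_norm_powR R _ (lebesgue_rVType R N) f s mf.
(* Fatou gives v the two bounds from which [weighted] deduces that m v lies in L^r_K. *)
have vV : (\int[lebesgue_rV N]_x (`|v x| `^ q * V x)%:E <= 1%:E)%E.
  apply: (@ae_cvg_integral_le _ (lebesgue_rVType R N) R (lebesgue_rV N)
    (fun k x => `|w (phi k) x| `^ q * V x) (fun x => `|v x| `^ q * V x)).
  - by move=> k; apply/measurable_EFinP; exact: (mpV _ (mLw k)).
  - by move=> k x; rewrite mulr_ge0 ?powR_ge0.
  - by apply/measurable_EFinP; exact: (mpV _ mLv).
  - by move=> x; rewrite mulr_ge0 ?powR_ge0.
  - by apply: aeS wv => x wx; apply: cvgMr_tmp; exact: cvg_norm_powR.
  - by move=> k; exact: wV.
have vs : (\int[lebesgue_rV N]_x (`|v x| `^ s)%:E <= Cs%:E)%E.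
  apply: (@ae_cvg_integral_le _ (lebesgue_rVType R N) R (lebesgue_rV N)
    (fun k x => `|w (phi k) x| `^ s) (fun x => `|v x| `^ s)).
  - by move=> k; apply/measurable_EFinP; exact: (mps _ (mLw k)).
  - by move=> k x; exact: powR_ge0.
  - by apply/measurable_EFinP; exact: (mps _ mLv).
  - by move=> x; exact: powR_ge0.
  - by apply: aeS wv => x wx; exact: cvg_norm_powR.
  - by move=> k; exact: ws.
pose z x := m * v x.
have mz : lebesgue_measurable z by exact: measurable_funM.
exists phi, z; split => //.
  by have [] := weighted z v m m0 mz mLv (aeW _ (fun=> erefl)) vV vs.
pose y k x := w (phi k) x - v x.
have my k : lebesgue_measurable (y k) by exact: measurable_funB (mLw k) mLv.
have y0 : (\int[lebesgue_rV N]_x (`|y k x| `^ r * K x)%:E)%E @[k --> \oo] --> 0%E.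
  apply: (@weighted_cvg0 _ (lebesgue_rVType R N) R (lebesgue_rV N) K V q r s beta r_ge1 r_ltq s_geq K_gt0 V_gt0 mK mV beta_ge0 beta_le y
    (2 `^ q * (1 + 1)) (2 `^ s * (Cs + Cs)) eta_lty my).
  - apply: aeS wv => x wx; rewrite -(subrr (v x)).
    by apply: cvgB => //; exact: cvg_cst.
  - by move=> k; exact: integral_norm_powRB (ltW q0) (mLw k) mLv mV V0' (wV (phi k)) vV.
  - move=> k.
    have one (f : 'rV[R]_N -> R) : (\int[lebesgue_rV N]_x (`|f x| `^ s * cst 1 x)%:E =
        \int[lebesgue_rV N]_x (`|f x| `^ s)%:E)%E.
      by apply: eq_integral => x _; rewrite mulr1.
    rewrite -one; apply: (integral_norm_powRB (ltW s0) (mLw k) mLv (measurable_cst _)) => //.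
    + by rewrite one; exact: ws.
    + by rewrite one; exact: vs.
apply: near_le_cvge0 => [k|e e0]; first exact: poweR_ge0.
(* The threshold for the normalised differences: undoing the scaling multiplies it by m^r, which
   gives e^r. *)
have em0 : 0 < (m^-1 * e) `^ r by rewrite powR_gt0// mulr_gt0// invr_gt0.
have [k0 Hk0] := cvge0_near_le y0 em0.
exists k0 => k /Hk0 yk; apply: le_poweR_inv => //; first exact: ltW.
have uzy : {ae lebesgue_rV N, forall x, (u_ (phi k) \- z) x = m * y k x}.
  by apply: aeS (uw (phi k)) => x /= ->; rewrite mulrBr.
have [[muk _] _ _ _] := Mu (phi k).
have muz : lebesgue_measurable (u_ (phi k) \- z) by exact: measurable_funB muk mz.
have mmy : lebesgue_measurable (fun x => m * y k x) by exact: measurable_funM (measurable_cst _) (my k).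
rewrite /weighted_int (ae_eq_integral_norm_powRM r muz mmy mK K0 uzy).
rewrite (integral_norm_powRZ _ r (my k) mK K0 (ltW m0)).
rewrite -[e](mulVKf (_ : m != 0)) ?gt_eqF// powRM ?(ltW m0) ?mulr_ge0 ?invr_ge0 ?(ltW m0) ?(ltW e0)//.
by rewrite EFinM lee_wpmul2l// lee_fin powR_ge0.
Qed.
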